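(* Let $W$ be an irreducible Weyl group of rank $n$, let $\mathcal R$ be the set of its reflections, let $c$ be a Coxeter element of $W$, and let $S=\sum_{r\in\mathcal R}r\in\mathbb C W$. For every integer $l\ge 0$ let $$N_l=|\{(r_1,\ldots,r_l)\in\mathcal R^l\mid r_1\cdots r_l=c\}|.$$ Then for every $l\ge 0$, $$|W|\,N_l=\sum_{i=0}^n(-1)^i\,(\wedge^i\mathrm{ref})(S^l).$$
   Context: $W$ is viewed as a finite reflection group in $\mathrm{GL}(\mathbb C^n)$ via its $n$-dimensional reflection representation (complexified); $\mathrm{ref}$ denotes the character of this representation and $\wedge^i\mathrm{ref}$ the character of its $i$-th exterior power. Characters of $W$ are extended linearly to the group algebra $\mathbb C W$. A Coxeter element is a conjugate of a product, in some order, of the $n$ simple reflections of $W$, each taken once. For $l=0$ the empty product is the identity, and $S^0=1$. *)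

(* Defs.v *)
From HB Require Import structures.
From mathcomp Require Import all_boot all_order all_algebra.
From mathcomp Require Import all_fingroup all_solvable all_field all_character.

Set Implicit Arguments.
Unset Strict Implicit.
Unset Printing Implicit Defensive.

Import Order.TTheory GRing.Theory Num.Theory.
Local Open Scope ring_scope.

Section ExteriorIndex.

Variables i n : nat.

Definition increasing (f : {ffun 'I_i -> 'I_n}) : bool :=
  [forall a : 'I_i, forall b : 'I_i, (a < b)%N ==> (f a < f b)%N].

(* A map f in extIndex indexes the basis vector
   e_{f 0} /\ ... /\ e_{f (i - 1)} of the i-th exterior power of an
   n-dimensional space with basis e_0, ..., e_{n - 1}. *)
Definition extIndex : predArgType := {f : {ffun 'I_i -> 'I_n} | increasing f}.

Lemma extIndex_inj (f : extIndex) : injective (val f).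
Proof.
move=> a b eq_f; apply/val_inj; have /forallP fP := valP f.
case: (ltngtP a b) => // [lt_ab|lt_ba].
- by have /forallP/(_ b)/implyP/(_ lt_ab) := fP a; rewrite eq_f ltnn.
- by have /forallP/(_ a)/implyP/(_ lt_ba) := fP b; rewrite eq_f ltnn.
Qed.

Lemma sorted_extIndex (f : extIndex) :
  sorted ltn [seq val (val f k) | k <- enum 'I_i].
Proof.
have /forallP fP := valP f.
rewrite sorted_map.
have : sorted (relpre (val : 'I_i -> nat) ltn) (enum 'I_i).
  by rewrite -sorted_map val_enum_ord iota_ltn_sorted.
apply: sub_sorted => a b lt_ab.
by have /forallP/(_ b)/implyP/(_ lt_ab) := fP a.
Qed.

Lemma extIndex_sub (f g : extIndex) :
  (forall k, exists l, val f k = val g l) -> f = g.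
Proof.
move=> sub_fg.
pose F (h : extIndex) := [set val h k | k in 'I_i].
have cardF h : #|F h| = i.
  by rewrite card_imset ?card_ord //; apply: extIndex_inj.
have eqF : F f = F g.
  apply/eqP; rewrite eqEcard !cardF leqnn andbT.
  apply/subsetP=> _ /imsetP[k _ ->]; have [l ->] := sub_fg k.
  exact: imset_f.
have eq_s : [seq val (val f k) | k <- enum 'I_i]
          = [seq val (val g k) | k <- enum 'I_i].
  apply: (irr_sorted_eq ltn_trans ltnn); try exact: sorted_extIndex.
  move=> x; apply/mapP/mapP => -[k _ ->].
  - have : val f k \in F g by rewrite -eqF; apply: imset_f.
    by case/imsetP=> l _ ->; exists l; rewrite ?mem_enum.
  - have : val g k \in F f by rewrite eqF; apply: imset_f.
    by case/imsetP=> l _ ->; exists l; rewrite ?mem_enum.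
apply/val_inj/ffunP => k; apply/val_inj.
by move/eq_in_map: eq_s => -> //; rewrite mem_enum.
Qed.

Definition ext_perm (p : extIndex * 'S_i) : {ffun 'I_i -> 'I_n} :=
  [ffun k => val p.1 (p.2 k)].

Lemma ext_perm_inj : injective ext_perm.
Proof.
move=> [f s] [g t] /ffunP eq_fg.
have eqk k : val f (s k) = val g (t k) by have := eq_fg k; rewrite !ffunE.
have fg : f = g.
  apply: extIndex_sub => k; exists (t ((s^-1)%g k)).
  by rewrite -eqk permKV.
subst g; congr (_, _); apply/permP => k.
exact: (@extIndex_inj f).
Qed.

Lemma ext_perm_surj (phi : {ffun 'I_i -> 'I_n}) :
  injective phi -> exists p, phi = ext_perm p.
Proof.
move=> inj_phi; pose A := [set phi k | k in 'I_i].
have cardA : #|A| = i by rewrite card_imset ?card_ord.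
pose f := [ffun k : 'I_i => enum_val (cast_ord (esym cardA) k)].
have incf : increasing f.
  apply/forallP=> a; apply/forallP=> b; apply/implyP=> lt_ab.
  rewrite !ffunE !(enum_val_nth (phi a)) /=.
  have srt : sorted ltn (map val (enum A)).
    apply: (subseq_sorted ltn_trans _ (iota_ltn_sorted 0 n)).
    rewrite -val_enum_ord; apply: map_subseq.
    by rewrite [enum 'I_n]enumT; apply: filter_subseq.
  have szA : size (enum A) = i by rewrite -cardE.
  have := sorted_ltn_nth ltn_trans 0%N srt.
  move/(_ a b); rewrite !inE size_map szA !ltn_ord => /(_ isT isT lt_ab).
  by rewrite !(nth_map (phi a)) ?szA ?ltn_ord.
have phiA k : phi k \in A by apply: imset_f.
pose s0 k := cast_ord cardA (enum_rank_in (phiA k) (phi k)).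
have s0E k : f (s0 k) = phi k.
  by rewrite ffunE /s0 cast_ordK enum_rankK_in.
have inj_s0 : injective s0.
  by move=> k l eq_s; apply: inj_phi; rewrite -!s0E eq_s.
exists (Sub f incf : extIndex, perm inj_s0).
by apply/ffunP => k; rewrite ffunE /= permE s0E.
Qed.

End ExteriorIndex.

Section ExteriorPower.

Variable R : comNzRingType.

Lemma cauchy_binet i n (A : 'M[R]_(i, n)) (B : 'M[R]_(n, i)) :
  \det (A *m B) =
  \sum_(f : extIndex i n) \det (colsub (val f) A) * \det (rowsub (val f) B).
Proof.
pose F (phi : {ffun 'I_i -> 'I_n}) :=
  (\prod_k A k (phi k)) * \det (rowsub phi B).
have -> : \det (A *m B) = \sum_phi F phi.
  rewrite /determinant.
  under eq_bigr => s _.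
    under eq_bigr => k _ do rewrite mxE.
    rewrite bigA_distr_bigA /= mulr_sumr.
    over.
  rewrite exchange_big /=; apply: eq_bigr => phi _.
  rewrite /F /determinant mulr_sumr; apply: eq_bigr => s _.
  rewrite big_split /= mulrCA; congr (_ * (_ * _)).
  by apply: eq_bigr => k _; rewrite mxE.
rewrite (bigID (fun phi : {ffun 'I_i -> 'I_n} => injectiveb phi)) /=.
rewrite [X in _ + X]big1 ?addr0; last first.
  move=> phi /injectivePn[a [b neq_ab eq_phi]].
  rewrite /F (determinant_alternate neq_ab) ?mulr0 // => j.
  by rewrite !mxE eq_phi.
have -> : \sum_(phi : {ffun 'I_i -> 'I_n} | injectiveb phi) F phi =
          \sum_(p : extIndex i n * 'S_i) F (ext_perm p).
  transitivity (\sum_(p in [set: extIndex i n * 'S_i]) F (ext_perm p)).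
    rewrite -(big_imset F (h := @ext_perm i n)) /=; last first.
      by move=> p q _ _; apply: ext_perm_inj.
    apply: eq_bigl => phi; apply/injectiveP/imsetP => [inj_phi | [[f s] _ ->]].
      by have [p ->] := ext_perm_surj inj_phi; exists p; rewrite ?inE.
    by move=> a b; rewrite !ffunE /= => /extIndex_inj; apply: perm_inj.
  by apply: eq_bigl => p; rewrite inE.
rewrite -(pair_bigA _ (fun f s => F (ext_perm (f, s)))) /=.
apply: eq_bigr => f _; rewrite {1}/determinant mulr_suml.
apply: eq_bigr => s _; rewrite /F.
have -> : rowsub (ext_perm (f, s)) B = perm_mx s *m rowsub (val f) B.
  by rewrite -row_permE; apply/matrixP => a b; rewrite !mxE ffunE.
rewrite det_mulmx det_perm mulrCA mulrA; congr (_ * _ * _).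
by apply: eq_bigr => k _; rewrite mxE ffunE.
Qed.

(* The matrix of the i-th exterior power of A in the basis indexed by
   extIndex: its entries are the i x i minors of A. *)
Definition extpow_mx i n (A : 'M[R]_n) : 'M[R]_#|extIndex i n| :=
  \matrix_(p < #|extIndex i n|, q < #|extIndex i n|)
    \det (mxsub (val (enum_val p)) (val (enum_val q)) A).

Lemma extpow_mx1 i n : extpow_mx i (1%:M : 'M[R]_n) = 1%:M.
Proof.
apply/matrixP => p q; rewrite !mxE.
have [-> | neq_pq] := eqVneq p q.
  rewrite [mxsub _ _ _](_ : _ = 1%:M) ?det1 //; apply/matrixP => a b.
  by rewrite !mxE (inj_eq (@extIndex_inj _ _ _)).
have /existsP[k /forallP kP] :
  [exists k, forall l, val (enum_val p) k != val (enum_val q) l].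
  apply: contraR neq_pq => /existsPn noP.
  apply/eqP/enum_val_inj/extIndex_sub => k.
  by have /forallPn[l /negPn/eqP eq_kl] := noP k; exists l.
rewrite (expand_det_row _ k) big1 // => l _.
by rewrite !mxE (negPf (kP l)) mul0r.
Qed.

Lemma extpow_mxM i n (A B : 'M[R]_n) :
  extpow_mx i (A *m B) = extpow_mx i A *m extpow_mx i B.
Proof.
apply/matrixP => p q; rewrite !mxE mxsub_mul cauchy_binet.
rewrite (reindex_onto (@enum_val _ predT) enum_rank) /=; last first.
  by move=> f _; rewrite enum_rankK.
apply: eq_big => [r | r _]; first by rewrite enum_valK eqxx.
rewrite !mxE; congr (_ * _); congr (\det _); apply/matrixP => a b;
  by rewrite !mxE.
Qed.

End ExteriorPower.

Section ExteriorRepresentation.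

Variables (F : fieldType) (gT : finGroupType) (G : {group gT}).
Variables (i n : nat) (rG : mx_representation F G n).

Definition extpow_repr_mx (g : gT) := extpow_mx i (rG g).

Lemma extpow_mx_repr : mx_repr G extpow_repr_mx.
Proof.
split=> [|x y Gx Gy]; rewrite /extpow_repr_mx.
  by rewrite repr_mx1 extpow_mx1.
by rewrite repr_mxM // extpow_mxM.
Qed.

Canonical extpow_repr := MxRepresentation extpow_mx_repr.

End ExteriorRepresentation.

(* Reduced crystallographic root systems in a rational vector space, with the
   coroots as linear forms.  Vectors are rows and linear forms are columns, so
   that the value of the form a on the vector v is the entry of v *m a. *)
Definition pairing n (v : 'rV[rat]_n) (a : 'cV[rat]_n) : rat := (v *m a) 0 0.

Record rootSystem (n : nat) := RootSystem {
  root_seq : seq 'rV[rat]_n;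
  coroot : 'rV[rat]_n -> 'cV[rat]_n;
  _ : 0 \notin root_seq;
  _ : (<<root_seq>> = fullv)%VS;
  _ : {in root_seq, forall a, pairing a (coroot a) = 2};
  _ : {in root_seq &, forall a b, b - pairing b (coroot a) *: a \in root_seq};
  _ : {in root_seq &, forall a b, pairing b (coroot a) \is a Num.int};
  _ : {in root_seq, forall a k, k *: a \in root_seq -> k = 1 \/ k = -1}
}.

(* Matrices act on row vectors from the right, so this is the matrix of
   v |-> v - <v, a^vee> a. *)
Definition root_reflection n (Phi : rootSystem n) (a : 'rV[rat]_n) : 'M[rat]_n :=
  1%:M - coroot Phi a *m a.

Definition irreducible_rootSystem n (Phi : rootSystem n) : Prop :=
  root_seq Phi <> [::] /\
  forall P : {pred 'rV[rat]_n},
    {in root_seq Phi &, forall a b, a \in P -> b \notin P ->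
       pairing a (coroot Phi b) = 0 /\ pairing b (coroot Phi a) = 0} ->
    {in root_seq Phi, forall a, a \in P} \/ {in root_seq Phi, forall a, a \notin P}.

Definition simple_system n (Phi : rootSystem n) (Delta : n.-tuple 'rV[rat]_n) :
    Prop :=
  [/\ {subset Delta <= root_seq Phi},
      basis_of fullv Delta &
      {in root_seq Phi, forall a, exists k : 'I_n -> nat,
         a = \sum_i (k i)%:R *: tnth Delta i \/
         a = - \sum_i (k i)%:R *: tnth Delta i}].

Section WeylGroup.

Variables (n : nat) (Phi : rootSystem n).
Variables (gT : finGroupType) (W : {group gT}) (rW : mx_representation rat W n).

(* The representation rW identifies W with the subgroup of GL_n(Q) generated
   by the reflections in the roots of Phi. *)
Definition Weyl_group : Prop :=
  [/\ mx_faithful rW,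
      {in root_seq Phi, forall a, exists2 w, w \in W & rW w = root_reflection Phi a} &
      W :=: <<[set w in W | has (fun a => rW w == root_reflection Phi a)
                              (root_seq Phi)]>>%g].

(* The fixed space of w is the kernel of rW w - 1, so a rank equal to one says
   that it is a hyperplane. *)
Definition reflections : {set gT} := [set w in W | \rank (rW w - 1%:M) == 1%N].

Definition Coxeter_element (Delta : n.-tuple 'rV[rat]_n) (c : gT) : Prop :=
  exists2 s : 'I_n -> gT,
    (forall i, s i \in W /\ rW (s i) = root_reflection Phi (tnth Delta i)) &
    exists (p : 'S_n) (w : gT),
      w \in W /\ c = ((\prod_(i < n) s (p i)) ^ w)%g.

Definition ref_repr : mx_representation algC W n :=
  map_repr (@ratr algC) rW.

End WeylGroup.

Definition factorization_count (gT : finGroupType) (A : {set gT}) (c : gT)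
    (l : nat) : nat :=
  #|[set t : l.-tuple gT | all (mem A) t && (\prod_(r <- t) r == c)%g]|.

(* Main.v *)
(** In the Hecke algebra with parameter q, deform a Coxeter element c and the
    square of the longest element to T_c and T_{w0}^2.  The spectrum of T_c on
    the regular representation gives the left hand side:

    - a bipartite Coxeter element satisfies T_c^m = T_{w0}^2 for some m, because
      the alternating products of its two colour classes move a point of the
      Coxeter plane through chambers without ever recrossing a wall until w0
      is reached; comparing lengths gives m n = 2 N, N the number of reflections;
    - T_{w0}^2 is central and equals 1 + (q - 1) B, where B at q = 1 is the sum of
      1 + r over all reflections r;
    - on an eigenspace of T_c^m the determinants of the generators are powers of
      q up to sign, so the eigenvalues of T_c are roots of unity times rational
      powers of q;
    - Tr T_c = (q - 1)^n is a polynomial, so non-integral powers of q cancel, and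
      Tr (T_c f(T_c^m)) = sum_i (-1)^i C(n, i) q^(n-i) f(q^(m(n-i))).

    Dividing by powers of q - 1 and setting q = 1 yields
    |W| N_l = sum_i (-1)^i C(n, i) (N - m i)^l.  On the other side, reflections
    are rank one perturbations of the identity whose sum acts as a scalar on the
    reflection representation, so the sum of all reflections acts on the i-th
    exterior power as the scalar N - m i. *)
Require Import Defs.
From mathcomp Require Import all_boot all_order all_algebra.
From mathcomp Require Import all_fingroup all_solvable all_field all_character.
From mathcomp Require Import ring lra zify.
From Stdlib Require Import Classical.

Set Implicit Arguments.
Unset Strict Implicit.
Unset Printing Implicit Defensive.

Import Order.TTheory GRing.Theory Num.Theory.
Local Open Scope ring_scope.

(** * Root systems and length *)

(** Two obstacles shape the work. Eigenvalues of T_c over rational functions in q would require a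
    closed field with fractional powers of q. Instead q is specialised to t^M for positive integers
    t, where M is divisible by every denominator that can occur. Only finitely many patterns of
    exponents and roots of unity remain, so one of them serves infinitely many t and becomes a
    polynomial identity. These roots of unity have m-th power 1 because T_c^m is the identity at q =
    1, so Tr (T_c f(T_c^m)) is the image of Tr T_c under a linear map on monomials; this is how a
    single known trace determines all the others. The product of the Hecke algebra is never
    constructed: left and right multiplications are commuting matrices, and an operator that
    commutes with all left ones is determined by its value at T_1. An arbitrary Coxeter element is
    conjugate to a bipartite one because the Dynkin diagram is a forest. Finally m n = 2 N turns the
    numbers m (n - i) - N from the Hecke side into N - m i. *)

Section RootSystems.

Variables (n : nat) (Phi : rootSystem n) (Delta : n.-tuple 'rV[rat]_n).
Variables (gT : finGroupType) (W : {group gT}) (rW : mx_representation rat W n).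
Hypothesis simpleDelta : simple_system Phi Delta.
Hypothesis weylW : Weyl_group Phi rW.

Definition simple_mx : 'M[rat]_n := \matrix_i tnth Delta i.
Definition simple_coords (v : 'rV[rat]_n) : 'rV[rat]_n := v *m invmx simple_mx.
Local Notation coords := simple_coords.
Definition height (v : 'rV[rat]_n) : rat := \sum_i coords v 0 i.
(** [root_seq] may repeat a root; after [undup] the size of this list is the number N of
    reflections. *)
Definition positive_roots := [seq a <- undup (root_seq Phi) | 0 < height a].
(** The default 1 is never taken on a root, since [Weyl_group] provides the element. *)
Definition root_elt (a : 'rV[rat]_n) : gT :=
  odflt 1%g [pick w in W | rW w == root_reflection Phi a].
Local Notation al := (tnth Delta).
Definition simple_elt (i : 'I_n) := root_elt (al i).
Local Notation s := simple_elt.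

Lemma root_neq0 a : a \in root_seq Phi -> a != 0.
Proof. by case: Phi => r c r0 ? ? ? ? ? /= Ra; apply: contraNneq r0 => <-. Qed.

Lemma pairing_coroot a : a \in root_seq Phi -> pairing a (coroot Phi a) = 2.
Proof. by case: Phi => r c ? ? h2 ? ? ? /=; apply: h2. Qed.

Lemma root_reflect a b : a \in root_seq Phi -> b \in root_seq Phi ->
  b - pairing b (coroot Phi a) *: a \in root_seq Phi.
Proof. by case: Phi => r c ? ? ? h ? ? /=; apply: h. Qed.

Lemma pairing_int a b : a \in root_seq Phi -> b \in root_seq Phi ->
  pairing b (coroot Phi a) \is a Num.int.
Proof. by case: Phi => r c ? ? ? ? h ? /=; apply: h. Qed.

Lemma root_prop a k : a \in root_seq Phi -> k *: a \in root_seq Phi ->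
  k = 1 \/ k = -1.
Proof. by case: Phi => r c ? ? ? ? ? h /= Ra; apply: (h a). Qed.

Lemma root_reflectionE a v :
  v *m root_reflection Phi a = v - pairing v (coroot Phi a) *: a.
Proof.
rewrite /root_reflection mulmxBr mulmx1 mulmxA; congr (_ - _).
by rewrite [v *m _]mx11_scalar mul_scalar_mx.
Qed.

Lemma reflect_root a : a \in root_seq Phi -> a *m root_reflection Phi a = - a.
Proof.
by move=> Ra; rewrite root_reflectionE pairing_coroot // scaler_nat mulr2n opprD addNKr.
Qed.

Lemma rootN a : a \in root_seq Phi -> - a \in root_seq Phi.
Proof.
move=> Ra; rewrite -(reflect_root Ra) root_reflectionE; exact: root_reflect.
Qed.

Lemma root_elt_def a : a \in root_seq Phi ->
  root_elt a \in W /\ rW (root_elt a) = root_reflection Phi a.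
Proof.
case: weylW => _ ex _ Ra; rewrite /root_elt; case: pickP => [w /andP[? /eqP ?]|] //=.
by have [w Ww e] := ex a Ra => /(_ w); rewrite Ww e eqxx.
Qed.

Lemma root_elt_in a : a \in root_seq Phi -> root_elt a \in W.
Proof. by case/root_elt_def. Qed.

Lemma rW_root_elt a : a \in root_seq Phi -> rW (root_elt a) = root_reflection Phi a.
Proof. by case/root_elt_def. Qed.

Lemma rW_inj : {in W &, injective rW}.
Proof. by case: weylW => /mx_faithful_inj. Qed.

Lemma root_act a w : w \in W -> a \in root_seq Phi -> a *m rW w \in root_seq Phi.
Proof.
case: weylW => _ _ eW Ww Ra.
pose X := [set w in W | all (fun a => a *m rW w \in root_seq Phi) (root_seq Phi)].
suff /subsetP sWX : W \subset X.
  by have := sWX w Ww; rewrite inE => /andP[_ /allP/(_ a Ra)].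
have gX : group_set X.
  apply/group_setP; split=> [|x y].
    by rewrite inE group1 /=; apply/allP => b Rb; rewrite repr_mx1 mulmx1.
  rewrite !inE => /andP[Wx /allP hx] /andP[Wy /allP hy]; rewrite groupM //=.
  by apply/allP=> b Rb; rewrite repr_mxM // mulmxA hy // hx.
rewrite {1}eW (gen_subG _ (Group gX)); apply/subsetP=> x; rewrite !inE.
case/andP=> Wx /hasP[b Rb /eqP e]; rewrite Wx; apply/allP=> d Rd.
by rewrite e root_reflectionE root_reflect.
Qed.

Lemma simple_root i : al i \in root_seq Phi.
Proof. by case: simpleDelta => sub _ _; apply: sub; apply: mem_tnth. Qed.

Lemma simple_mx_unit : simple_mx \in unitmx.
Proof.
have [_ bas _] := simpleDelta; have fr := basis_free bas.
rewrite -row_free_unit -kermx_eq0; apply/rowV0P => v /sub_kermxP e.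
apply/rowP => i; rewrite mxE.
have /freeP := fr; apply; rewrite -[RHS]e mulmx_sum_row.
by apply: eq_bigr => j _; rewrite rowK (tnth_nth 0).
Qed.

Lemma coordsK v : coords v *m simple_mx = v.
Proof. by rewrite mulmxKV ?simple_mx_unit. Qed.

Lemma coords_sum v : v = \sum_i coords v 0 i *: al i.
Proof.
by rewrite -{1}[v]coordsK mulmx_sum_row; apply: eq_bigr => i _; rewrite rowK.
Qed.

Lemma coords_lin (k : 'I_n -> rat) i : coords (\sum_j k j *: al j) 0 i = k i.
Proof.
rewrite (_ : \sum_j _ = (\row_j k j) *m simple_mx).
  by rewrite /coords mulmxK ?simple_mx_unit // mxE.
by rewrite mulmx_sum_row; apply: eq_bigr => j _; rewrite rowK mxE.
Qed.

Lemma coords_simple i j : coords (al i) 0 j = (i == j)%:R.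
Proof.
rewrite -(coords_lin (fun j => (i == j)%:R) j); congr (coords _ _ _).
rewrite (bigD1 i) //= eqxx scale1r big1 ?addr0 // => k /negPf.
by rewrite eq_sym => ->; rewrite scale0r.
Qed.

Lemma coordsD u v i : coords (u + v) 0 i = coords u 0 i + coords v 0 i.
Proof. by rewrite /coords mulmxDl mxE. Qed.
Lemma coordsN u i : coords (- u) 0 i = - coords u 0 i.
Proof. by rewrite /coords mulNmx mxE. Qed.
Lemma coordsZ k u i : coords (k *: u) 0 i = k * coords u 0 i.
Proof. by rewrite /coords -scalemxAl mxE. Qed.
Lemma heightD u v : height (u + v) = height u + height v.
Proof. by rewrite -big_split; apply: eq_bigr => i _; rewrite coordsD. Qed.
Lemma heightN u : height (- u) = - height u.
Proof. by rewrite -sumrN; apply: eq_bigr => i _; rewrite coordsN. Qed.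
Lemma heightZ k u : height (k *: u) = k * height u.
Proof. by rewrite mulr_sumr; apply: eq_bigr => i _; rewrite coordsZ. Qed.
Lemma height_simple i : height (al i) = 1.
Proof.
rewrite /height (bigD1 i) //= coords_simple eqxx big1 ?addr0 // => j ne.
by rewrite coords_simple eq_sym (negPf ne).
Qed.

Lemma root_coords_nat a : a \in root_seq Phi -> exists k : 'I_n -> nat,
  (forall i, coords a 0 i = (k i)%:R) \/ (forall i, coords a 0 i = - (k i)%:R).
Proof.
case: simpleDelta => _ _ h /h[k [] ->]; exists k; [left|right] => i.
  by rewrite coords_lin.
by rewrite coordsN coords_lin.
Qed.

Lemma coords_eq0 v : (forall i, coords v 0 i = 0) -> v = 0.
Proof. by move=> h; rewrite (coords_sum v) big1 // => i _; rewrite h scale0r. Qed.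

Lemma root_sign a : a \in root_seq Phi ->
  (0 < height a /\ forall i, 0 <= coords a 0 i) \/
  (height a < 0 /\ forall i, coords a 0 i <= 0).
Proof.
move=> Ra; have nz := root_neq0 Ra.
have [k [h|h]] := root_coords_nat Ra; [left|right].
  have p i : 0 <= coords a 0 i by rewrite h.
  split=> //; rewrite lt0r sumr_ge0 ?andbT //.
  apply: contra nz => /eqP /psumr_eq0P h0; apply/eqP/coords_eq0 => i.
  by apply: h0.
have p i : coords a 0 i <= 0 by rewrite h oppr_le0.
have q i : 0 <= coords (- a) 0 i by rewrite coordsN oppr_ge0.
split=> //; rewrite -oppr_gt0 -heightN lt0r sumr_ge0 ?andbT //.
apply: contra nz => /eqP /psumr_eq0P h0; apply/eqP/coords_eq0 => i.
by apply/eqP; rewrite -oppr_eq0 -coordsN h0.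
Qed.

Lemma height_neq0 a : a \in root_seq Phi -> height a != 0.
Proof. by case/root_sign=> -[h _]; [apply: lt0r_neq0|apply: ltr0_neq0]. Qed.

Lemma coords_ge0 a : a \in root_seq Phi -> 0 < height a -> forall i, 0 <= coords a 0 i.
Proof. by move=> /root_sign[] [h h'] // /lt_trans/(_ h); rewrite ltxx. Qed.

Lemma positive_rootsP a : reflect (a \in root_seq Phi /\ 0 < height a) (a \in positive_roots).
Proof. by rewrite mem_filter mem_undup andbC; apply: andP. Qed.

Lemma positive_roots_uniq : uniq positive_roots.
Proof. by rewrite filter_uniq ?undup_uniq. Qed.

Lemma simple_in i : s i \in W.
Proof. exact: root_elt_in (simple_root i). Qed.
Lemma rW_simple i : rW (s i) = root_reflection Phi (al i).
Proof. exact: rW_root_elt (simple_root i). Qed.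

Lemma act_simple v i : v *m rW (s i) = v - pairing v (coroot Phi (al i)) *: al i.
Proof. by rewrite rW_simple root_reflectionE. Qed.

Lemma pairingD (u v : 'rV[rat]_n) f : pairing (u + v) f = pairing u f + pairing v f.
Proof. by rewrite /pairing mulmxDl mxE. Qed.
Lemma pairingN (u : 'rV[rat]_n) f : pairing (- u) f = - pairing u f.
Proof. by rewrite /pairing mulNmx mxE. Qed.
Lemma pairingZ k (u : 'rV[rat]_n) f : pairing (k *: u) f = k * pairing u f.
Proof. by rewrite /pairing -scalemxAl mxE. Qed.

Lemma root_eltK a : a \in root_seq Phi -> (root_elt a * root_elt a = 1)%g.
Proof.
move=> Ra; apply: rW_inj; rewrite ?groupM ?group1 ?root_elt_in //.
rewrite repr_mxM ?root_elt_in // repr_mx1 rW_root_elt //.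
apply/row_matrixP => i; rewrite !rowE mulmx1; set v := delta_mx 0 i.
rewrite mulmxA !root_reflectionE pairingD pairingN pairingZ pairing_coroot //.
rewrite -addrA -opprD -scalerDl addrCA mulr2n mulrDr mulr1 opprD addNKr.
by rewrite subrr scale0r subr0.
Qed.

Lemma root_eltV a : a \in root_seq Phi -> ((root_elt a)^-1 = root_elt a)%g.
Proof. by move=> Ra; apply/eqP; rewrite eq_invg_mul root_eltK. Qed.

Lemma simple_eltK i : (s i * s i = 1)%g.
Proof. exact: root_eltK (simple_root i). Qed.

Lemma simple_eltV i : ((s i)^-1 = s i)%g.
Proof. exact: root_eltV (simple_root i). Qed.

(** Reflecting in [al i] changes only the i-th coordinate. If the image were negative, the other
    coordinates would be both nonnegative and nonpositive, so a would be a multiple of [al i];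
    reducedness leaves plus or minus [al i], both excluded. *)
Lemma positive_act_simple a i : a \in root_seq Phi -> 0 < height a -> a != al i ->
  0 < height (a *m rW (s i)).
Proof.
move=> Ra pa ne; have Rb := root_act (simple_in i) Ra.
have [[//]|[_ neg]] := root_sign Rb.
have cE j : j != i -> coords (a *m rW (s i)) 0 j = coords a 0 j.
  move=> ji; rewrite act_simple coordsD coordsN coordsZ coords_simple eq_sym.
  by rewrite (negPf ji) mulr0 subr0.
have c0 j : j != i -> coords a 0 j = 0.
  by move=> ji; apply/le_anti; rewrite coords_ge0 // -(cE _ ji) neg.
have aE : a = coords a 0 i *: al i.
  rewrite {1}(coords_sum a) (bigD1 i) //= big1 ?addr0 // => j ji.
  by rewrite c0 // scale0r.
have Ri := simple_root i.
have /(root_prop Ri) : coords a 0 i *: al i \in root_seq Phi by rewrite -aE.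
case=> e; first by case/eqP: ne; rewrite aE e scale1r.
by move: pa; rewrite aE e scaleN1r heightN height_simple oppr_gt0 ltr10.
Qed.

(** * Length and descents *)

Definition inversions w := [seq a <- positive_roots | height (a *m rW w) < 0].
Definition weyl_len w := size (inversions w).
Local Notation len := weyl_len.

(* Right descents, as the action is on the right. *)
Definition right_descent i w := height (al i *m rW w^-1%g) < 0.
Local Notation descent := right_descent.

Lemma simple_positive i : al i \in positive_roots.
Proof. by apply/positive_rootsP; rewrite simple_root height_simple ltr01. Qed.

Lemma root_act_gt0 a w : w \in W -> a \in root_seq Phi ->
  (0 < height (a *m rW w)) = ~~ (height (a *m rW w) < 0).
Proof.
move=> Ww Ra; have := height_neq0 (root_act Ww Ra).
by rewrite -leNgt lt0r => ->.
Qed.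

Lemma perm_positive_roots i : perm_eq positive_roots
  (al i :: [seq a *m rW (s i) | a <- rem (al i) positive_roots]).
Proof.
have Ri := simple_root i; have Wi := simple_in i.
pose P := positive_roots; pose P' := rem (al i) P.
have uP := positive_roots_uniq.
have pP : perm_eq P (al i :: P') by apply: perm_to_rem; apply: simple_positive.
have uP' : uniq P' by apply: rem_uniq.
have P'P a : (a \in P') = (a != al i) && (a \in P) by rewrite mem_rem_uniq.
pose g (a : 'rV[rat]_n) := a *m rW (s i).
have gK : involutive g.
  by move=> a; rewrite /g -mulmxA -repr_mxM // simple_eltK repr_mx1 mulmx1.
have gP' a : a \in P' -> g a \in P'.
  rewrite !P'P => /andP[ne /positive_rootsP[Ra pa]]; apply/andP; split.
    apply: contraTneq pa => e; rewrite -(gK a) e /g act_simple pairing_coroot //.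
    by rewrite scaler_nat mulr2n opprD addNKr heightN height_simple oppr_gt0 ltr10.
  by apply/positive_rootsP; rewrite root_act // positive_act_simple.
rewrite (seq.permPl pP) perm_cons perm_sym.
apply: uniq_perm; rewrite ?map_inj_uniq //; first exact: inv_inj.
move=> a; apply/mapP/idP => [[b Pb ->]|Pa]; first exact: gP'.
by exists (g a); [apply: gP'|rewrite -[RHS]/(g (g a)) gK].
Qed.

(** Left multiplication by [s i] adds [al i] to the inversions and moves the others by [s i]. The
    arbitrary [F] allows this recursion to be matched with that of [hecke_tail] at q = 1. *)
Lemma inversions_simpleM_sum (V : nmodType) (F : gT -> V) i w : w \in W ->
  0 < height (al i *m rW w) ->
  \sum_(a <- inversions (s i * w)%g) F (root_elt a) =
  F (s i) + \sum_(a <- inversions w) F (root_elt (a *m rW (s i))).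
Proof.
move=> Ww pos; have Wi := simple_in i; have Ri := simple_root i.
have uP := positive_roots_uniq.
have pP := perm_to_rem (simple_positive i).
rewrite /inversions !big_filter (perm_big _ (perm_positive_roots i)) [in RHS](perm_big _ pP) /=.
have /negbTE neg : ~~ (height (al i *m rW w) < 0) by rewrite -leNgt ltW.
rewrite !big_cons big_map neg.
rewrite repr_mxM // mulmxA rW_simple reflect_root // mulNmx heightN oppr_lt0 pos.
congr (_ + _); apply: eq_bigl => a.
by rewrite !mulmxA -!rW_simple -(mulmxA a) -repr_mxM // simple_eltK repr_mx1 mulmx1.
Qed.

Lemma len_simpleM i w : w \in W ->
  len (s i * w)%g = if height (al i *m rW w) < 0 then (len w).-1 else (len w).+1.
Proof.
move=> Ww; have Wi := simple_in i; have Ri := simple_root i.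
have pP := perm_to_rem (simple_positive i).
rewrite /len /inversions !size_filter (seq.permP (perm_positive_roots i)).
rewrite [in RHS](seq.permP pP) /= count_map.
rewrite repr_mxM // mulmxA rW_simple reflect_root // mulNmx heightN oppr_lt0.
rewrite [X in (_ + X)%N = _](eq_count (a2 := fun a => height (a *m rW w) < 0)) => [|a /=].
  by rewrite root_act_gt0 //; case: (_ < 0).
by rewrite !mulmxA -!rW_simple -(mulmxA a) -repr_mxM // simple_eltK repr_mx1 mulmx1.
Qed.

Lemma inversionsP w a : reflect [/\ a \in root_seq Phi, 0 < height a & height (a *m rW w) < 0]
   (a \in inversions w).
Proof.
rewrite mem_filter andbC; apply: (iffP andP); first by case=> /positive_rootsP[].
by case=> *; split=> //; apply/positive_rootsP.
Qed.

Lemma lenV w : w \in W -> len w^-1%g = len w.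
Proof.
move=> Ww; have Wv : (w^-1)%g \in W by rewrite groupV.
(* Negating the image turns a root inverted by w into a root inverted by its inverse. *)
pose g (a : 'rV[rat]_n) := - (a *m rW w).
have aK (a : 'rV[rat]_n) : a *m rW w *m rW (w^-1)%g = a.
  by rewrite -mulmxA -repr_mxM // mulgV repr_mx1 mulmx1.
have aVK (a : 'rV[rat]_n) : a *m rW (w^-1)%g *m rW w = a.
  by rewrite -mulmxA -repr_mxM // mulVg repr_mx1 mulmx1.
suff p : perm_eq (map g (inversions w)) (inversions (w^-1)%g).
  by rewrite /len -(perm_size p) size_map.
have uI x : uniq (inversions x) by rewrite filter_uniq ?positive_roots_uniq.
apply: uniq_perm => // [|b].
  rewrite map_inj_uniq //.
  by move=> a b /oppr_inj e; rewrite -(aK a) e aK.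
apply/mapP/inversionsP => [[a /inversionsP[Ra pa na] ->]|[Rb pb nb]].
  by rewrite /g rootN ?root_act // heightN oppr_gt0 mulNmx aK heightN oppr_lt0.
exists (- (b *m rW (w^-1)%g)); last by rewrite /g mulNmx aVK opprK.
apply/inversionsP; rewrite rootN ?root_act // heightN oppr_gt0 mulNmx aVK.
by rewrite heightN oppr_lt0.
Qed.

Lemma len1 : len 1 = 0%N.
Proof.
rewrite /len /inversions (eq_in_filter (a2 := pred0)) ?filter_pred0 // => a.
by case/positive_rootsP=> _ pa; rewrite repr_mx1 mulmx1 ltNge ltW.
Qed.

Lemma lenM_simple i w : w \in W ->
  len (w * s i)%g = if descent i w then (len w).-1 else (len w).+1.
Proof.
move=> Ww; rewrite -lenV ?groupM ?simple_in // invMg simple_eltV.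
by rewrite len_simpleM ?groupV // lenV.
Qed.

(** Averaging the standard scalar product over the finite group makes it invariant. The root system
    only provides coroots as linear forms, so a Euclidean structure has to be created. *)
Definition inner_mx := \sum_(w in W) rW w *m (rW w)^T.
Definition inner (u v : 'rV[rat]_n) : rat := (u *m inner_mx *m v^T) 0 0.

Lemma inner_act w u v : w \in W -> inner (u *m rW w) (v *m rW w) = inner u v.
Proof.
move=> Ww; rewrite /inner trmx_mul !mulmxA -(mulmxA u) -(mulmxA u).
congr ((_ *m _ *m _) 0 0); rewrite /inner_mx mulmx_sumr mulmx_suml.
rewrite [RHS](reindex_inj (mulgI w)) /=.
apply: eq_big => [x|x Wx]; first by rewrite groupMl.
by rewrite repr_mxM // trmx_mul !mulmxA.
Qed.

Lemma innerC u v : inner u v = inner v u.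
Proof.
have E : inner_mx^T = inner_mx.
  by rewrite /inner_mx raddf_sum; apply: eq_bigr => w _; rewrite /= trmx_mul trmxK.
have e : u *m inner_mx *m v^T = (v *m inner_mx *m u^T)^T.
  by rewrite !trmx_mul trmxK E mulmxA.
by rewrite /inner e mxE.
Qed.

Lemma innerD u v x : inner (u + v) x = inner u x + inner v x.
Proof. by rewrite /inner !mulmxDl mxE. Qed.
Lemma innerN u x : inner (- u) x = - inner u x.
Proof. by rewrite /inner !mulNmx mxE. Qed.
Lemma innerZ k u x : inner (k *: u) x = k * inner u x.
Proof. by rewrite /inner -!scalemxAl mxE. Qed.
Lemma inner_sum I (r : seq I) P (F : I -> 'rV[rat]_n) x :
  inner (\sum_(i <- r | P i) F i) x = \sum_(i <- r | P i) inner (F i) x.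
Proof. by rewrite /inner !mulmx_suml summxE. Qed.

Lemma inner_gt0 v : v != 0 -> 0 < inner v v.
Proof.
move=> nz; have E w : (v *m (rW w *m (rW w)^T) *m v^T) 0 0 = \sum_i (v *m rW w) 0 i ^+ 2.
  rewrite mulmxA -mulmxA -trmx_mul mxE; apply: eq_bigr => i _.
  by rewrite [X in _ * X]mxE.
have -> : inner v v = \sum_(w in W) \sum_i (v *m rW w) 0 i ^+ 2.
  by rewrite /inner mulmx_sumr mulmx_suml summxE; apply: eq_bigr => w _.
have ge w : 0 <= \sum_i (v *m rW w) 0 i ^+ 2.
  by apply: sumr_ge0 => i _; apply: sqr_ge0.
rewrite (bigD1 1%g) ?group1 //= ltr_wpDr ?sumr_ge0 // lt0r ge andbT.
apply: contra nz => /eqP /psumr_eq0P h; apply/eqP/rowP => i; rewrite mxE.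
have /eqP := h (fun _ _ => sqr_ge0 _) i isT.
by rewrite repr_mx1 mulmx1 sqrf_eq0 => /eqP.
Qed.

Lemma inner_root_gt0 a : a \in root_seq Phi -> 0 < inner a a.
Proof. by move=> Ra; apply/inner_gt0/root_neq0. Qed.

(* Invariance under the reflection in a applied to the pair (v, a). *)
Lemma pairing_inner a v : a \in root_seq Phi ->
  pairing v (coroot Phi a) = 2 * inner v a / inner a a.
Proof.
move=> Ra; have := inner_act v a (root_elt_in Ra).
rewrite rW_root_elt // reflect_root // root_reflectionE.
rewrite innerC innerN innerC innerD innerN innerZ => e.
have nz := lt0r_neq0 (inner_root_gt0 Ra).
apply: (mulIf nz); rewrite mulfVK // mulr_natl mulr2n -{1}e opprB.
by rewrite addrNK.
Qed.

Lemma root_elt_eq a x : a \in root_seq Phi -> x \in W ->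
  (forall v, v *m rW x = v - (2 * inner v a / inner a a) *: a) -> x = root_elt a.
Proof.
move=> Ra Wx h; apply: rW_inj => //; first exact: root_elt_in.
apply/row_matrixP => i; rewrite !rowE h rW_root_elt // root_reflectionE.
by rewrite pairing_inner.
Qed.

(** Coroots need not be compared: [pairing_inner] writes both reflections through the invariant
    form, which w preserves. *)
Lemma root_eltJ a w : w \in W -> a \in root_seq Phi ->
  root_elt (a *m rW w) = (root_elt a ^ w)%g.
Proof.
move=> Ww Ra; have Wa := root_elt_in Ra.
apply/esym/root_elt_eq => [||v]; rewrite ?root_act ?groupJ //.
rewrite conjgE !repr_mxM ?groupM ?groupV // rW_root_elt // !mulmxA.
rewrite root_reflectionE pairing_inner // mulmxBl -scalemxAl.
rewrite -mulmxA -repr_mxM ?groupV // mulVg repr_mx1 mulmx1 inner_act //.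
rewrite -(inner_act (v *m _) a Ww).
by rewrite -mulmxA -repr_mxM ?groupV // mulVg repr_mx1 mulmx1.
Qed.

Lemma root_eltN a : a \in root_seq Phi -> root_elt (- a) = root_elt a.
Proof.
move=> Ra; rewrite -[in LHS](reflect_root Ra) -rW_root_elt // root_eltJ ?root_elt_in //.
by rewrite conjgE mulKg.
Qed.

(** A root negated by the reflection in b is a multiple of b; reducedness and positivity force the
    factor 1. *)
Lemma root_elt_inj a b : a \in positive_roots -> b \in positive_roots ->
  root_elt a = root_elt b -> a = b.
Proof.
move=> /positive_rootsP[Ra pa] /positive_rootsP[Rb pb] e.
have := reflect_root Ra; rewrite -rW_root_elt // e rW_root_elt // root_reflectionE.
set k := pairing _ _ => h.
have h2 : k *: b = 2 *: a.
  by rewrite scaler_nat mulr2n -[X in X + _]opprK -h opprB subrK.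
have aE : a = (k / 2) *: b by rewrite mulrC -scalerA h2 scalerA mulVf ?scale1r.
have /(root_prop Rb) : (k / 2) *: b \in root_seq Phi by rewrite -aE.
case=> ek; rewrite ek in aE; first by rewrite aE scale1r.
by move: pa; rewrite aE scaleN1r heightN oppr_gt0 ltNge ltW.
Qed.

(** * Words in the simple reflections and the exchange property *)

Definition simple_prod (u : seq 'I_n) : gT := (\prod_(i <- u) s i)%g.
Local Notation word_prod := simple_prod.

Lemma word_prod_in u : word_prod u \in W.
Proof. by apply: group_prod => i _; apply: simple_in. Qed.

Lemma word_prod_cons i u : word_prod (i :: u) = (s i * word_prod u)%g.
Proof. by rewrite /word_prod big_cons. Qed.

Lemma word_prod_cat u v : word_prod (u ++ v) = (word_prod u * word_prod v)%g.
Proof. by rewrite /word_prod big_cat. Qed.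

Lemma word_prod_rev u : word_prod (rev u) = (word_prod u)^-1%g.
Proof.
elim: u => [|i u IH]; first by rewrite /word_prod big_nil invg1.
rewrite rev_cons -cats1 word_prod_cat IH [word_prod (i :: u)]word_prod_cons invMg.
by rewrite /word_prod big_seq1 simple_eltV.
Qed.

(** Descent on the height, a natural number: since (a, a) > 0, some [al i] has positive inner
    product with a, and unless a is [al i] reflecting in it gives a positive root of smaller
    height. *)
Lemma positive_root_word a : a \in positive_roots ->
  exists i u, a = al i *m rW (word_prod u).
Proof.
have hn b : b \in positive_roots -> exists m : nat, height b = m%:R.
  move=> /positive_rootsP[Rb pb]; have [k [h|h]] := root_coords_nat Rb.
    exists (\sum_i k i)%N; rewrite natr_sum.
    by apply: eq_bigr => i _.
  exfalso; move: pb; rewrite ltNge => /negP; apply.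
  by apply: sumr_le0 => i _; rewrite h oppr_le0.
have [m] : exists m : nat, height a < m%:R.
  by exists (Num.truncn (height a)).+1; rewrite truncnS_gt.
elim: m a => [|m IH] a lt /positive_rootsP[Ra pa]; first by move: pa; rewrite ltNge ltW.
have [i pi] : exists i, 0 < inner a (al i).
  apply/existsP; apply: contraT; rewrite negb_exists => /forallP h.
  have := inner_root_gt0 Ra; rewrite ltNge => /negP; case.
  rewrite {1}(coords_sum a) inner_sum; apply: sumr_le0 => i _.
  by rewrite innerZ mulr_ge0_le0 ?coords_ge0 // innerC leNgt.
have Ri := simple_root i.
have [->|ne] := eqVneq a (al i).
  by exists i, [::]; rewrite /word_prod big_nil repr_mx1 mulmx1.
have pb := positive_act_simple Ra pa ne.
have Rb := root_act (simple_in i) Ra.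
have Pb : a *m rW (s i) \in positive_roots by apply/positive_rootsP.
have [x ex] := hn _ Pb; have Pa : a \in positive_roots by apply/positive_rootsP.
have [y ey] := hn _ Pa.
have ltb : height (a *m rW (s i)) < m%:R.
  have : height (a *m rW (s i)) < height a.
    rewrite act_simple heightD heightN heightZ height_simple mulr1 gtrDl oppr_lt0.
    by rewrite pairing_inner // divr_gt0 ?inner_root_gt0 // mulr_gt0.
  by move: lt; rewrite ex ey !ltr_nat ltnS => h1 h2; apply: leq_trans h2 h1.
have [j [u e]] := IH _ ltb Pb.
exists j, (u ++ [:: i]); rewrite word_prod_cat repr_mxM ?word_prod_in // mulmxA -e.
rewrite /word_prod big_seq1 -mulmxA -repr_mxM ?simple_in // simple_eltK.
by rewrite repr_mx1 mulmx1.
Qed.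

Lemma root_elt_word a : a \in root_seq Phi -> exists u, root_elt a = word_prod u.
Proof.
move=> Ra; wlog pa : a Ra / 0 < height a => [h|].
  have [[p _]|[p _]] := root_sign Ra; first exact: h.
  have [|u e] := h _ (rootN Ra); first by rewrite heightN oppr_gt0.
  by exists u; rewrite -e root_eltN.
have Pa : a \in positive_roots by apply/positive_rootsP.
have [i [u ->]] := positive_root_word Pa.
exists (rev u ++ i :: u); rewrite root_eltJ ?word_prod_in ?simple_root //.
by rewrite conjgE word_prod_cat word_prod_rev word_prod_cons mulgA.
Qed.

Lemma Weyl_word w : w \in W -> exists u, w = word_prod u.
Proof.
case: weylW => _ _ {1}-> /gen_prodgP[m [c hc ->]].
elim: m c hc => [|m IH] c hc; first by exists [::]; rewrite big_ord0 /word_prod big_nil.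
rewrite big_ord_recl; have [u ->] := IH _ (fun i => hc (lift ord0 i)).
have := hc ord0; rewrite inE => /andP[Wc /hasP[a Ra /eqP e]].
have -> : c ord0 = root_elt a by apply: rW_inj; rewrite ?root_elt_in // rW_root_elt.
by have [v ->] := root_elt_word Ra; exists (v ++ u); rewrite word_prod_cat.
Qed.

(** Follow the root through the letters of the word. Where it turns negative it equals the simple
    root of that letter, by [positive_act_simple], and this is the letter to delete. *)
Lemma exchange a u : a \in positive_roots -> height (a *m rW (word_prod u)) < 0 ->
  exists2 v, size u = (size v).+1 & (root_elt a * word_prod u)%g = word_prod v.
Proof.
elim: u a => [|j u IH] a /positive_rootsP[Ra pa].
  by rewrite /word_prod big_nil repr_mx1 mulmx1 ltNge ltW.
rewrite word_prod_cons repr_mxM ?simple_in ?word_prod_in // mulmxA => neg.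
have [aE|ne] := eqVneq a (al j).
  by exists u => //; rewrite aE mulgA simple_eltK mul1g.
have Pb : a *m rW (s j) \in positive_roots.
  by apply/positive_rootsP; rewrite root_act ?simple_in ?positive_act_simple.
have [v sz e] := IH _ Pb neg.
exists (j :: v); rewrite /= ?sz // word_prod_cons -e root_eltJ ?simple_in //.
by rewrite conjgE !mulgA mulgV mul1g.
Qed.

Lemma reduced_word w : w \in W -> exists2 u, w = word_prod u & size u = len w.
Proof.
move=> /Weyl_word[u ->] {w}; elim: u => [|i u [v e sz]].
  by exists [::]; rewrite // /word_prod big_nil len1.
rewrite word_prod_cons e len_simpleM ?word_prod_in //.
case: ifP => h; last by exists (i :: v); rewrite ?word_prod_cons //= sz e.
have [v' sz' e'] := exchange (simple_positive i) h.
by exists v'; rewrite // -e -sz sz'.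
Qed.

Lemma len_eq0 w : w \in W -> len w = 0%N -> w = 1%g.
Proof.
by move=> /reduced_word[[|? ?] -> <- //]; rewrite /word_prod big_nil.
Qed.

Lemma descent_simpleM i w : w \in W -> descent i (w * s i)%g = ~~ descent i w.
Proof.
move=> Ww; rewrite /descent invMg simple_eltV repr_mxM ?groupV ?simple_in //.
rewrite mulmxA rW_simple reflect_root ?simple_root // mulNmx heightN oppr_lt0.
by rewrite root_act_gt0 ?groupV ?simple_root.
Qed.

(* If s_i w <> w s_j then the root alpha_j w^-1 is not proportional to alpha_i,
   so that s_i does not change its sign. *)
Lemma descent_commute i j w : w \in W -> (s i * w)%g != (w * s j)%g ->
  descent j (s i * w)%g = descent j w.
Proof.
move=> Ww ne; rewrite /descent invMg simple_eltV repr_mxM ?groupV ?simple_in //.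
rewrite mulmxA; set a := al j *m rW w^-1%g.
have Ra : a \in root_seq Phi by rewrite root_act ?groupV ?simple_root.
have ra : root_elt a = (w * s j * w^-1)%g.
  by rewrite root_eltJ ?groupV ?simple_root // conjgE invgK mulgA.
have ni : root_elt a != s i.
  by apply: contra ne => /eqP <-; rewrite ra mulgKV.
have pos b : b \in positive_roots -> root_elt b != s i -> 0 < height (b *m rW (s i)).
  move=> /positive_rootsP[Rb pb] nb; apply: positive_act_simple => //.
  by apply: contra nb => /eqP ->.
have [[p _]|[p _]] := root_sign Ra.
  by rewrite !ltNge !ltW // pos //; apply/positive_rootsP.
rewrite p -oppr_gt0 -heightN -mulNmx pos ?root_eltN //.
by apply/positive_rootsP; rewrite rootN // heightN oppr_gt0.
Qed.

(** The equation makes the root obtained from [al j] by the inverse of w equal to plus or minus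
    [al i], and this one sign decides both descents. *)
Lemma descent_conj i j w : w \in W -> (s i * w)%g = (w * s j)%g ->
  descent j w = descent i w^-1%g.
Proof.
move=> Ww e; rewrite /descent invgK; set a := al j *m rW w^-1%g.
have Ra : a \in root_seq Phi by rewrite root_act ?groupV ?simple_root.
have ra : root_elt a = s i.
  by rewrite root_eltJ ?groupV ?simple_root // conjgE invgK mulgA -e mulgK.
have aE : al j = a *m rW w.
  by rewrite -mulmxA -repr_mxM ?groupV // mulVg repr_mx1 mulmx1.
have [[p _]|[p _]] := root_sign Ra.
  have Ea : a = al i by apply: root_elt_inj => //; [apply/positive_rootsP|apply: simple_positive].
  by rewrite -Ea -aE height_simple ltr10 ltNge ltW.
have Ea : - a = al i.
  apply: root_elt_inj; rewrite ?root_eltN ?simple_positive //.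
  by apply/positive_rootsP; rewrite rootN // heightN oppr_gt0.
by rewrite p -Ea mulNmx -aE heightN height_simple oppr_lt0 ltr01.
Qed.

(** * Longest element and chambers *)

Definition longest w := [forall i, descent i w].

Lemma height_act_simple w a : (forall i, height (al i *m rW w) < 0) ->
  a \in positive_roots -> height (a *m rW w) < 0.
Proof.
move=> h /positive_rootsP[Ra pa]; have nz := root_neq0 Ra.
have p i := coords_ge0 Ra pa i.
have [i pi] : exists i, 0 < coords a 0 i.
  apply/existsP; apply: contraNT nz; rewrite negb_exists => /forallP h0.
  apply/eqP/coords_eq0 => i; apply/le_anti; rewrite p andbT leNgt.
  exact: h0.
have hE : height (a *m rW w) = \sum_i coords a 0 i * height (al i *m rW w).
  rewrite {1}(coords_sum a) mulmx_suml (big_morph height heightD (id1 := 0)).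
    by apply: eq_bigr => j _; rewrite -scalemxAl heightZ.
  by apply: big1 => j _; rewrite /coords mul0mx mxE.
rewrite hE (bigD1 i) //= ltr_wnDr ?nmulr_llt0 //.
by apply: sumr_le0 => j _; rewrite mulr_ge0_le0 // ltW.
Qed.

Lemma longestP w : w \in W -> reflect (len w = size positive_roots) (longest w).
Proof.
move=> Ww; rewrite -lenV //; apply: (iffP forallP) => [h|e i].
  rewrite /len /inversions (eq_in_filter (a2 := predT)) ?filter_predT // => a Pa.
  exact: height_act_simple.
have : all (fun a => height (a *m rW w^-1%g) < 0) positive_roots.
  by rewrite all_count -size_filter; apply/eqP.
by move=> /allP/(_ _ (simple_positive i)).
Qed.

Lemma longestV w : w \in W -> longest w -> longest w^-1%g.
Proof. by move=> Ww /(longestP Ww) e; apply/longestP; rewrite ?groupV ?lenV. Qed.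

(** Each of the two elements and their inverses makes every positive root negative, so [x^-1 * y]
    inverts no root and has length 0. *)
Lemma longest_uniq x y : x \in W -> y \in W -> longest x -> longest y -> x = y.
Proof.
move=> Wx Wy /(longestV Wx)/forallP hx /forallP hy; apply/(mulgI x^-1)%g; rewrite mulVg.
apply/esym/len_eq0; rewrite ?groupM ?groupV //; apply/eqP.
rewrite -lenV ?groupM ?groupV // invMg invgK /len size_filter -leqn0 leqNgt -has_count.
apply/hasPn => a Pa /=; rewrite repr_mxM ?groupV // mulmxA -leNgt.
have na := height_act_simple hy Pa.
have /positive_rootsP[Ra _] := Pa.
have Rb := root_act (groupVr Wy) Ra.
have Pb : - (a *m rW y^-1%g) \in positive_roots.
  by apply/positive_rootsP; rewrite rootN // heightN oppr_gt0.
rewrite -[a *m _]opprK mulNmx heightN oppr_ge0 ltW //.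
by apply: height_act_simple Pb => i; have := hx i; rewrite /descent invgK.
Qed.

(** A point of the open chamber has trivial stabiliser: if w inverted a, the positive root -(a w)
    would have inner product -(y, a) < 0 with y, yet y is positive on positive roots. *)
Lemma fixed_dominant w y : w \in W -> (forall i, 0 < inner y (al i)) ->
  y *m rW w = y -> w = 1%g.
Proof.
move=> Ww dom fixy; apply: len_eq0 => //; apply/eqP.
have pos a : a \in positive_roots -> 0 < inner y a.
  move=> Pa; have /positive_rootsP[Ra pa] := Pa; rewrite innerC (coords_sum a) inner_sum.
  have ge j : 0 <= inner (coords a 0 j *: al j) y.
    by rewrite innerZ mulr_ge0 ?coords_ge0 // innerC ltW.
  rewrite lt0r sumr_ge0 // andbT; apply: contraTneq (root_neq0 Ra) => h0.
  have {h0} h0 := psumr_eq0P (fun j _ => ge j) h0; rewrite negbK.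
  apply/eqP/coords_eq0 => i; have /eqP := h0 i isT.
  by rewrite innerZ mulf_eq0 innerC (gt_eqF (dom i)) orbF => /eqP.
rewrite /len size_filter -leqn0 leqNgt -has_count; apply/hasPn => a Pa /=.
apply/negP => neg; have /positive_rootsP[Ra pa] := Pa.
have Pb : - (a *m rW w) \in positive_roots.
  by apply/positive_rootsP; rewrite rootN ?root_act // heightN oppr_gt0.
have := pos _ Pb; rewrite innerC innerN innerC -{1}fixy inner_act //.
by rewrite oppr_gt0 ltNge ltW ?pos.
Qed.

(** Choose the point of the orbit where [height] is largest. Reflecting in [al i] lowers the height
    by a pairing, which is therefore nonnegative; regularity excludes 0. *)
Lemma regular_dominant x : {in root_seq Phi, forall a, inner x a != 0} ->
  exists2 u, u \in W & forall i, 0 < inner (x *m rW u) (al i).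
Proof.
move=> reg; pose h u := height (x *m rW u).
have [u Wu max] := @arg_maxP _ _ _ 1%g (fun v => v \in W) h (group1 W).
exists u => // i; have Ri := simple_root i; have Wi := simple_in i.
rewrite lt0r; apply/andP; split.
  rewrite -(inner_act _ _ (groupVr Wu)) -mulmxA -repr_mxM ?groupV // mulgV repr_mx1 mulmx1.
  by apply: reg; rewrite root_act ?groupV.
have : h (u * s i)%g <= h u := max (u * s i)%g (groupM Wu Wi).
rewrite /h repr_mxM // mulmxA act_simple heightD heightN heightZ height_simple mulr1.
rewrite gerDl oppr_le0 pairing_inner //.
have pi := inner_root_gt0 Ri.
by rewrite pmulr_lge0 ?invr_gt0 // pmulr_rge0.
Qed.

(** * Every reflection of W is a root reflection *)

Lemma nonroot_exists (p : {poly rat}) : p != 0 -> exists t, p.[t] != 0.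
Proof.
move=> nz; pose rs : seq rat := [seq i%:R | i <- iota 0 (size p)].
have [/allP h|/allPn[t _ h]] := boolP (all (root p) rs); last by exists t.
have urs : uniq rs by rewrite map_inj_uniq ?iota_uniq //; apply: mulrIn; rewrite oner_eq0.
have := max_poly_roots nz _ urs; rewrite size_map size_iota ltnn.
by move=> absurd; case: (notF (absurd _)); apply/allP.
Qed.

(** A row space contained in no root hyperplane has a vector outside all of them: along the moment
    curve (1, t, t^2, ...) each root gives a nonzero polynomial in t, and so does their product. *)
Lemma regular_exists m (K : 'M[rat]_(m, n)) :
  {in root_seq Phi, forall a, K *m inner_mx *m a^T != 0} ->
  exists v : 'rV_m, {in root_seq Phi, forall a, inner (v *m K) a != 0}.
Proof.
move=> h; pose p (a : 'rV[rat]_n) : {poly rat} := \sum_(i < m) (K *m inner_mx *m a^T) i 0 *: 'X^i.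
have pE a : p a = \poly_(i < m) (if insub i is Some j then (K *m inner_mx *m a^T) j 0 else 0).
  by rewrite poly_def; apply: eq_bigr => i _; rewrite valK.
have nz : \prod_(a <- root_seq Phi) p a != 0.
  rewrite prodf_seq_neq0; apply/allP => a Ra /=; apply: contra (h a Ra) => /eqP p0.
  apply/eqP/matrixP => i j; rewrite [RHS]mxE ord1.
  by have := congr1 (fun f : {poly rat} => f`_i) p0; rewrite pE coef_poly coef0 ltn_ord valK.
have [t] := nonroot_exists nz; rewrite horner_prod prodf_seq_neq0 => /allP nt.
exists (\row_i t ^+ i) => a Ra; have /= := nt a Ra.
rewrite /inner -!mulmxA mxE horner_sum !mulmxA; apply: contra => /eqP e; apply/eqP.
by rewrite -[RHS]e; apply: eq_bigr => i _; rewrite hornerZ hornerXn mulrC [(\row_i0 _) _ _]mxE.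
Qed.

Lemma rank_root_reflection a : a \in root_seq Phi ->
  \rank (root_reflection Phi a - 1%:M) = 1%N.
Proof.
move=> Ra; rewrite /root_reflection addrAC subrr add0r mxrank_opp.
apply/eqP; rewrite eqn_leq (leq_trans (mxrankM_maxl _ _) (rank_leq_col _)) /=.
rewrite lt0n mxrank_eq0; apply/eqP => e; have := pairing_coroot Ra.
move: (congr1 (mulmx a) e); rewrite mulmxA mulmx0 [a *m coroot _ _]mx11_scalar.
rewrite -/(pairing _ _) pairing_coroot // mul_scalar_mx => /eqP.
by rewrite scaler_eq0 (negPf (root_neq0 Ra)) orbF pnatr_eq0.
Qed.

(** By invariance the image of w - 1 is orthogonal to the fixed hyperplane, hence lies on the line
    of a. So w sends v to v + phi(v) a for a linear form phi. *)
Lemma reflection_orthogonal w a : w \in W -> a \in root_seq Phi ->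
  \rank (rW w - 1%:M) = 1%N ->
  kermx (rW w - 1%:M) *m inner_mx *m a^T = 0 -> w = root_elt a.
Proof.
move=> Ww Ra; set B := rW w - 1%:M; set K := kermx B => rB ort.
have Kw : K *m rW w = K.
  by apply/eqP; rewrite -subr_eq0 -{2}[K]mulmx1 -mulmxBr mulmx_ker.
have Qw : rW w *m inner_mx *m (rW w)^T = inner_mx.
  apply/matrixP => i j.
  have hX (X : 'M[rat]_n) : X i j = ((delta_mx 0 i : 'rV_n) *m X *m (delta_mx 0 j : 'rV_n)^T) 0 0.
    by rewrite -rowE trmx_delta -colE !mxE.
  have := inner_act (delta_mx 0 i) (delta_mx 0 j) Ww.
  by rewrite !hX /inner trmx_mul !mulmxA.
have Qunit : inner_mx \in unitmx.
  rewrite -row_free_unit -kermx_eq0; apply/rowV0P => v /sub_kermxP e.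
  apply/eqP/negPn/negP => /inner_gt0; rewrite /inner e mul0mx mxE ltxx //.
have ortB : B *m (K *m inner_mx)^T = 0.
  apply: trmx_inj; rewrite trmx_mul trmxK trmx0 /B linearB /= trmx1 mulmxBr mulmx1.
  by rewrite -{1}Kw -(mulmxA _ _ inner_mx) -mulmxA Qw subrr.
have orta : a *m (K *m inner_mx)^T = 0.
  by apply: trmx_inj; rewrite trmx_mul trmxK trmx0.
have rK : \rank (kermx (K *m inner_mx)^T) = 1%N.
  rewrite mxrank_ker mxrank_tr mxrankMfree ?row_free_unit // mxrank_ker rB subKn //.
  by rewrite -rB rank_leq_row.
have sB : (B <= kermx (K *m inner_mx)^T)%MS by apply/sub_kermxP.
have sa : (a <= kermx (K *m inner_mx)^T)%MS by apply/sub_kermxP.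
have ra : \rank a = 1%N.
  by rewrite rank_rV root_neq0.
have sKa : (kermx (K *m inner_mx)^T <= a)%MS.
  by rewrite -(mxrank_leqif_sup sa) ra rK.
have /submxP[f eB] := submx_trans sB sKa.
pose phi (v : 'rV[rat]_n) := (v *m f) 0 0.
have act (v : 'rV[rat]_n) : v *m rW w = v + phi v *: a.
  rewrite -[rW w](subrK 1%:M) -/B mulmxDr mulmx1 addrC eB mulmxA.
  by rewrite [v *m f]mx11_scalar mul_scalar_mx.
have pa := inner_root_gt0 Ra; have nz := lt0r_neq0 pa.
have aw : a *m rW w = (1 + phi a) *: a by rewrite act scalerDl scale1r.
have e1 v : inner v a = (inner v a + phi v * inner a a) * (1 + phi a).
  rewrite -{1}(inner_act v a Ww) aw act innerC innerZ innerC innerD innerZ.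
  by rewrite mulrC.
(* Invariance at v = a gives (1 + phi a)^2 = 1. The value 1 makes phi vanish and w trivial, against
   the rank; the value -1 determines phi as that of the reflection in a. *)
have := e1 a; rewrite -{2}[inner a a]mul1r -mulrDl mulrAC -[X in X = _]mul1r => /(mulIf nz)/eqP.
rewrite eq_sym -expr2 sqrf_eq1 => /orP[] /eqP e2.
  suff B0 : B = 0 by move: rB; rewrite B0 mxrank0.
  apply/row_matrixP => i; rewrite row0 rowE.
  have /eqP := e1 (delta_mx 0 i); rewrite e2 mulr1 addrC -subr_eq subrr eq_sym mulf_eq0 (negPf nz) orbF.
  by move=> /eqP p0; rewrite mulmxBr mulmx1 act p0 scale0r addr0 subrr.
apply: root_elt_eq => // v; rewrite act; congr (_ + _); rewrite -scaleNr; congr (_ *: _).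
apply: (mulIf nz); rewrite mulNr mulfVK //.
have := e1 v; rewrite e2 mulrN1 => /eqP; rewrite -subr_eq0 opprK addrA => /eqP e3.
by apply/eqP; rewrite -subr_eq0 opprK addrC mulr_natl mulr2n e3.
Qed.

(** If the fixed hyperplane were orthogonal to no root, it would contain a regular vector; moved
    into the open chamber, this vector has trivial stabiliser, so w would be 1. *)
Lemma reflectionsE : reflections rW =i [seq root_elt a | a <- positive_roots].
Proof.
move=> w; rewrite inE; apply/andP/mapP => [[Ww /eqP rk]|[a /positive_rootsP[Ra _] ->]]; last first.
  by rewrite root_elt_in // rW_root_elt // rank_root_reflection.
suff [a Ra e] : exists2 a, a \in root_seq Phi & w = root_elt a.
  have [[p _]|[p _]] := root_sign Ra; first by exists a => //; apply/positive_rootsP.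
  exists (- a); rewrite ?root_eltN //.
  by apply/positive_rootsP; rewrite rootN // heightN oppr_gt0.
pose K := kermx (rW w - 1%:M).
have [/hasP[a Ra /eqP ort]|/hasPn reg] := boolP (has (fun a => K *m inner_mx *m a^T == 0) (root_seq Phi)).
  by exists a => //; apply: reflection_orthogonal.
exfalso; have [v rv] := regular_exists reg.
have [u Wu dom] := regular_dominant rv.
have fixv : v *m K *m rW w = v *m K.
  apply/eqP; rewrite -subr_eq0 -{2}[v *m K]mulmx1 -mulmxBr -mulmxA mulmx_ker mulmx0 //.
have w1 : (w ^ u = 1)%g.
  apply: fixed_dominant dom _; rewrite ?groupJ //.
  rewrite -mulmxA -repr_mxM ?groupJ // conjgE mulKVg.
  by rewrite repr_mxM // mulmxA fixv.
move/eqP: w1; rewrite conjg_eq1 => /eqP w1.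
by move: rk; rewrite w1 repr_mx1 subrr mxrank0.
Qed.

Lemma reflections_sum (V : nmodType) (F : gT -> V) :
  \sum_(r in reflections rW) F r = \sum_(a <- positive_roots) F (root_elt a).
Proof.
rewrite -(big_map root_elt predT) big_uniq /=.
  by apply: eq_bigl => r; rewrite reflectionsE.
rewrite map_inj_in_uniq ?positive_roots_uniq // => a b; exact: root_elt_inj.
Qed.

End RootSystems.

(** * Hecke algebra *)

Section Hecke.

Variables (gT : finGroupType) (W : {group gT}) (n : nat) (s : 'I_n -> gT).
Variable descent : 'I_n -> gT -> bool.
Hypothesis s_in : forall i, s i \in W.
Hypothesis sK : forall i, (s i * s i = 1)%g.
Hypothesis descent_s : forall i w, w \in W -> descent i (w * s i)%g = ~~ descent i w.
Hypothesis descent_commute : forall i j w, w \in W ->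
  (s i * w)%g != (w * s j)%g -> descent j (s i * w)%g = descent j w.
Hypothesis descent_conj : forall i j w, w \in W ->
  (s i * w)%g = (w * s j)%g -> descent j w = descent i w^-1%g.
Hypothesis left_ascent_ind : forall P : gT -> Prop, P 1%g ->
  (forall i w, w \in W -> ~~ descent i w^-1%g -> P w -> P (s i * w)%g) ->
  forall w, w \in W -> P w.

Section Ring.

Variables (R : comNzRingType) (q : R).
Local Notation m := #|W|.

Definition hecke_basis (w : gT) : 'rV[R]_m := delta_mx 0 (gring_index W w).
Local Notation e := hecke_basis.

(* Right, respectively left, multiplication by T_{s i} in the basis (T_w) of
   the Hecke algebra, whose quadratic relation is (T - q) (T + 1) = 0. *)
Definition hecke_right i : 'M[R]_m := \matrix_(k < m)
  (let w := enum_val k in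
   if descent i w then (q - 1) *: e w + q *: e (w * s i)%g else e (w * s i)%g).

Definition hecke_left i : 'M[R]_m := \matrix_(k < m)
  (let w := enum_val k in
   if descent i w^-1%g then (q - 1) *: e w + q *: e (s i * w)%g else e (s i * w)%g).
Local Notation A := hecke_right.
Local Notation B := hecke_left.

Lemma hecke_rightE i w : w \in W -> e w *m A i =
  if descent i w then (q - 1) *: e w + q *: e (w * s i)%g else e (w * s i)%g.
Proof. by move=> Ww; rewrite -rowE rowK gring_indexK. Qed.

Lemma hecke_leftE i w : w \in W -> e w *m B i =
  if descent i w^-1%g then (q - 1) *: e w + q *: e (s i * w)%g else e (s i * w)%g.
Proof. by move=> Ww; rewrite -rowE rowK gring_indexK. Qed.

Lemma hecke_mx_ext p (X Y : 'M[R]_(m, p)) :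
  (forall w, w \in W -> e w *m X = e w *m Y) -> X = Y.
Proof.
move=> h; apply/row_matrixP => k; rewrite !rowE.
by have := h _ (enum_valP k); rewrite /e gring_valK.
Qed.

Lemma generator_mulK i w : (s i * (s i * w) = w)%g.
Proof. by rewrite mulgA sK mul1g. Qed.

Lemma mul_generatorK i w : (w * s i * s i = w)%g.
Proof. by rewrite -mulgA sK mulg1. Qed.

Lemma generatorV i : ((s i)^-1 = s i)%g.
Proof. by apply/eqP; rewrite eq_invg_mul sK. Qed.

Lemma left_descent_s i w : w \in W ->
  descent i (s i * w)^-1%g = ~~ descent i w^-1%g.
Proof. by move=> Ww; rewrite invMg generatorV descent_s ?groupV. Qed.

(** This plays the role of associativity. If s_i w = w s_j, the two operators agree on [e w] and on
    [e (s i * w)]; otherwise neither multiplication affects the descent tested by the other. *)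
Lemma hecke_comm i j : A j *m B i = B i *m A j.
Proof.
apply: hecke_mx_ext => w Ww; rewrite !mulmxA.
have Wi := s_in i; have Wj := s_in j; have Wv := groupVr Ww.
have Wl := groupM Wi Ww; have Wr := groupM Ww Wj.
have [eq|ne] := eqVneq (s i * w)%g (w * s j)%g.
  have d1 := descent_conj Ww eq.
  have d2 : descent j (s i * w)%g = descent i (s i * w)^-1%g.
    by rewrite left_descent_s // eq descent_s // d1.
  have e1 : e w *m A j = e w *m B i.
    by rewrite hecke_rightE // hecke_leftE // -d1 eq.
  have e2 : e (s i * w)%g *m A j = e (s i * w)%g *m B i.
    have h : (s i * w * s j = w)%g by rewrite eq mul_generatorK.
    by rewrite hecke_rightE // hecke_leftE // -d2 generator_mulK h.
  rewrite -e1 hecke_rightE // -eq; case: ifP => _ //.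
  by rewrite !mulmxDl -!scalemxAl e1 e2.
have dl : descent j (s i * w)%g = descent j w by apply: descent_commute.
have dr : descent i (w * s j)^-1%g = descent i w^-1%g.
  rewrite invMg generatorV; apply: descent_commute => //.
  by apply: contraNneq ne => /(congr1 invg); rewrite !invMg !generatorV invgK => ->.
have El : e (s i * w)%g *m A j =
    if descent j w then (q - 1) *: e (s i * w)%g + q *: e (s i * w * s j)%g
    else e (s i * w * s j)%g by rewrite hecke_rightE // dl.
have Er : e (w * s j)%g *m B i =
    if descent i w^-1%g then (q - 1) *: e (w * s j)%g + q *: e (s i * w * s j)%g
    else e (s i * w * s j)%g by rewrite hecke_leftE // dr mulgA.
rewrite hecke_rightE // hecke_leftE //; case: ifP El => dw El; case: ifP Er => dv Er.
- rewrite !mulmxDl -!scalemxAl Er El hecke_rightE // hecke_leftE // dw dv.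
  by rewrite !scalerDr !scalerA addrACA (mulrC q (q - 1)).
- by rewrite !mulmxDl -!scalemxAl Er hecke_leftE // dv El.
- by rewrite !mulmxDl -!scalemxAl El hecke_rightE // dw Er.
by rewrite Er El.
Qed.

Lemma hecke_quadratic i : A i *m A i = (q - 1) *: A i + q%:M.
Proof.
apply: hecke_mx_ext => w Ww; have Wi := s_in i; have Wr := groupM Ww Wi.
rewrite mulmxA mulmxDr -scalemxAr mul_mx_scalar hecke_rightE //.
case: ifP => d; last by rewrite hecke_rightE // descent_s // d mul_generatorK.
by rewrite mulmxDl -!scalemxAl !hecke_rightE // descent_s // d mul_generatorK.
Qed.

(** From [e 1] the left multiplications reach every basis vector, one ascent at a time, and X and Y
    both commute with them. *)
Lemma hecke_unital X Y : (forall i, X *m B i = B i *m X) ->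
  (forall i, Y *m B i = B i *m Y) -> e 1 *m X = e 1 *m Y -> X = Y.
Proof.
move=> cX cY e1; apply: hecke_mx_ext; apply: left_ascent_ind => // i w Ww d IH.
have <- : e w *m B i = e (s i * w)%g by rewrite hecke_leftE // (negPf d).
by rewrite -!mulmxA -cX -cY !mulmxA IH.
Qed.

Definition hecke_word (u : seq 'I_n) : 'M[R]_m := foldr (fun i X => A i *m X) 1%:M u.

Lemma hecke_word_cat u v : hecke_word (u ++ v) = hecke_word u *m hecke_word v.
Proof. by elim: u => [|i u IH] /=; rewrite ?mul1mx // IH mulmxA. Qed.

Lemma hecke_word_comm u i : hecke_word u *m B i = B i *m hecke_word u.
Proof.
elim: u => [|j u IH] /=; first by rewrite mul1mx mulmx1.
by rewrite -mulmxA IH !mulmxA hecke_comm.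
Qed.

Lemma hecke_word_eq u v : e 1 *m hecke_word u = e 1 *m hecke_word v ->
  hecke_word u = hecke_word v.
Proof. by apply: hecke_unital => i; apply: hecke_word_comm. Qed.

(** X stands for right multiplication by T_{w0}. By [hecke_unital] only the images of [e 1] matter,
    and these are [e w0] multiplied by T_{s i} on the left and by T_{s j} on the right. *)
Lemma hecke_longest_central X w0 i j : (forall i, X *m B i = B i *m X) ->
  w0 \in W -> e 1 *m X = e w0 -> (s i * w0)%g = (w0 * s j)%g -> ~~ descent i 1%g ->
  A i *m X = X *m A j.
Proof.
move=> cX W0 eX eq d1; apply: hecke_unital => [k|k|].
- by rewrite -mulmxA cX !mulmxA hecke_comm.
- by rewrite -mulmxA hecke_comm !mulmxA cX.
have -> : e 1 *m (A i *m X) = e 1 *m B i *m X.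
  by rewrite mulmxA hecke_rightE // hecke_leftE // invg1 (negPf d1) mul1g mulg1.
rewrite -mulmxA -cX !mulmxA eX hecke_rightE // hecke_leftE //.
by rewrite (descent_conj W0 eq) eq.
Qed.

(** The quotient by q - 1 of T_u T_{rev u} - 1, by a recursion free of division so that it can be
    evaluated at q = 1. The first two terms come from T^2 = 1 + (q - 1) (1 + T). *)
Fixpoint hecke_tail u : 'M[R]_m :=
  if u is i :: u' then 1%:M + A i + A i *m hecke_tail u' *m A i else 0.

Lemma hecke_word_palindrome u :
  hecke_word u *m hecke_word (rev u) = 1%:M + (q - 1) *: hecke_tail u.
Proof.
elim: u => [|i u IH] /=; first by rewrite mul1mx scaler0 addr0.
rewrite rev_cons -cats1 hecke_word_cat /= mulmx1 mulmxA -(mulmxA (A i)) IH.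
rewrite mulmxDr mulmx1 mulmxDl hecke_quadratic -scalemxAr -scalemxAl.
rewrite !scalerDr !addrA; congr (_ + _).
by rewrite addrC scalemx1 -raddfD /= [1 + _]addrC subrK.
Qed.

(** Multiplying a basis vector by a generator yields only that vector and its neighbour, so each
    letter is either skipped or used. *)
Lemma hecke_word_support u x w : x \in W -> w \in W ->
  (forall v, subseq v u -> w != (x * \prod_(i <- v) s i)%g) ->
  (e x *m hecke_word u) 0 (gring_index W w) = 0.
Proof.
elim: u x => [|i u IH] x Wx Ww /= h.
  rewrite mulmx1 mxE /= eq_sym; case: eqP => // eq.
  have /eqP[] := h [::] isT; rewrite big_nil mulg1.
  by move/(congr1 (enum_val (A := mem W))): eq; rewrite !gring_indexK.
have Ws := groupM Wx (s_in i).
have h1 : (e x *m hecke_word u) 0 (gring_index W w) = 0.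
  apply: IH => // v sv; apply: h.
  exact: (subseq_trans sv (subseq_cons u i)).
have h2 : (e (x * s i)%g *m hecke_word u) 0 (gring_index W w) = 0.
  apply: IH => // v sv; have := h (i :: v); rewrite /= eqxx big_cons mulgA; exact.
rewrite mulmxA hecke_rightE //; case: ifP => _ //.
by rewrite mulmxDl -!scalemxAl mxE [X in X + _]mxE [X in _ + X]mxE h1 h2 !mulr0 addr0.
Qed.

(* Since distinct simple reflections multiply to a non-trivial element, a path
   from w to w can only stay in place, which requires each s i to be a descent. *)
Lemma hecke_word_diag u w : uniq u -> w \in W ->
  (forall i v, i \notin v -> (s i * \prod_(j <- v) s j)%g != 1%g) ->
  (e w *m hecke_word u) 0 (gring_index W w) =
  \prod_(i <- u) (if descent i w then q - 1 else 0).
Proof.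
move=> + Ww free; elim: u => [_|i u IH /= /andP[iu uu]].
  by rewrite big_nil mulmx1 mxE !eqxx.
have h : (e (w * s i)%g *m hecke_word u) 0 (gring_index W w) = 0.
  apply: hecke_word_support => //; first exact: groupM.
  move=> v sv; have iv : i \notin v by apply: contra iu; apply: mem_subseq.
  apply: contraNneq (free i v iv) => /esym/eqP.
  by rewrite -mulgA -{2}[w]mulg1 (inj_eq (mulgI w)).
rewrite big_cons mulmxA hecke_rightE //; case: ifP => _; last by rewrite h mul0r.
rewrite mulmxDl -!scalemxAl mxE [X in X + _]mxE [X in _ + X]mxE h mulr0 addr0.
by rewrite IH.
Qed.

(** A diagonal entry is zero unless every letter is a descent of the basis element, and only [w0]
    has that property. *)
Lemma hecke_word_trace u w0 : uniq u -> w0 \in W ->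
  (forall w, w \in W -> (w == w0) = all (descent^~ w) u) ->
  (forall i v, i \notin v -> (s i * \prod_(j <- v) s j)%g != 1%g) ->
  \tr (hecke_word u) = (q - 1) ^+ size u.
Proof.
move=> uu W0 hw0 free; rewrite /mxtrace.
have diag k : hecke_word u k k = if enum_val k == w0 then (q - 1) ^+ size u else 0.
  have Wk := enum_valP k; rewrite hw0 //.
  have <- : (e (enum_val k) *m hecke_word u) 0 (gring_index W (enum_val k)) = hecke_word u k k.
    by rewrite /e gring_valK -rowE mxE.
  rewrite hecke_word_diag //; case: ifP => [/allP h|/negbT/allPn[i iu /negPf di]].
    rewrite big_seq (eq_bigr (fun=> q - 1)) => [|i /h ->//].
    by rewrite -big_seq big_const_seq count_predT iter_mulr_1.
  by rewrite (big_rem i) //= di mul0r.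
rewrite (eq_bigr _ (fun k _ => diag k)) (bigD1 (gring_index W w0)) //=.
rewrite gring_indexK // eqxx big1 ?addr0 // => k ne.
case: eqP => // eq; case/eqP: ne; rewrite -eq gring_valK //.
Qed.

End Ring.

Lemma map_hecke_right (R S : comNzRingType) (f : {rmorphism R -> S}) q i :
  map_mx f (hecke_right q i) = hecke_right (f q) i.
Proof.
apply/row_matrixP => k; rewrite -map_row !rowK /=; case: (descent _ _).
  by rewrite map_mxD !map_mxZ rmorphB rmorph1 /hecke_basis !map_delta_mx.
by rewrite /hecke_basis map_delta_mx.
Qed.

Lemma map_hecke_word (R S : comNzRingType) (f : {rmorphism R -> S}) q u :
  map_mx f (hecke_word q u) = hecke_word (f q) u.
Proof.
elim: u => [|i u IH] /=; first by rewrite map_mx1.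
by rewrite map_mxM IH map_hecke_right.
Qed.

Lemma hecke_right1 (R : fieldType) i : hecke_right (1 : R) i = regular_repr R W (s i).
Proof.
apply/row_matrixP => k; rewrite !rowK.
by rewrite /=; case: (descent _ _); rewrite ?subrr ?scale0r ?scale1r ?add0r.
Qed.

Lemma hecke_word1 (R : fieldType) u :
  hecke_word (1 : R) u = regular_repr R W (\prod_(i <- u) s i)%g.
Proof.
elim: u => [|i u IH] /=; first by rewrite big_nil repr_mx1.
by rewrite big_cons repr_mxM ?group_prod // IH hecke_right1.
Qed.

Lemma map_hecke_tail (R S : comNzRingType) (f : {rmorphism R -> S}) q u :
  map_mx f (hecke_tail q u) = hecke_tail (f q) u.
Proof.
elim: u => [|i u IH] /=; first by rewrite map_mx0.
by rewrite !map_mxD map_mx1 !map_mxM IH !map_hecke_right.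
Qed.

End Hecke.

(** * Forests *)

Section Forest.

Variables (I : finType) (adj : rel I).
Hypothesis adj_sym : symmetric adj.
Hypothesis forest : forall J : {set I}, J != set0 ->
  exists2 i, i \in J & (#|[set j in J | (j != i) && adj i j]| <= 1)%N.

Lemma forest_leaf (J : {set I}) : J != set0 -> exists2 i, i \in J &
  exists j, forall k, k \in J -> k != i -> adj i k -> k = j.
Proof.
move=> /forest[i Ji card]; exists i => //; move: card; set N := [set _ in J | _].
have NP k : k \in J -> k != i -> adj i k -> k \in N by rewrite inE => -> -> ->.
have [N0 _|/set0Pn[j Nj]] := eqVneq N set0.
  (* Without neighbours the condition on j is void, so any vertex serves. *)
  by exists i => k Jk ki ak; have := NP k Jk ki ak; rewrite N0 inE.
rewrite (cardD1 j) Nj ltnS leqn0 => /eqP/card0_eq N1.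
exists j => k Jk ki ak; apply/eqP; have := N1 k.
by rewrite !inE Jk ki ak /= !andbT; case: eqP.
Qed.

(** Remove a leaf, colour the rest, and give the leaf the colour opposite to that of its only
    possible neighbour. *)
Lemma forest_coloring : exists col : I -> bool,
  forall i j, i != j -> adj i j -> col i != col j.
Proof.
suff [col h] : exists col : I -> bool, {in [set: I] &, forall i j, i != j -> adj i j -> col i != col j}.
  by exists col => i j; apply: h; rewrite inE.
have [m] := ubnP #|[set: I]|; elim: m ([set: I]) => // m IH J.
have [->|nz] := eqVneq J set0; first by exists xpredT => i j; rewrite inE.
have [i Ji [j hj]] := forest_leaf nz; rewrite (cardsD1 i) Ji ltnS => /IH[col h].
exists (fun k => if k == i then ~~ col j else col k) => a b Ja Jb ab.
have [ea|na] := eqVneq a i; have [eb|nb] := eqVneq b i.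
- by rewrite ea eb eqxx in ab.
- by rewrite ea => /(hj b Jb nb) ->; case: (col j).
- by rewrite eb adj_sym => /(hj a Ja na) ->; case: (col j).
by move=> adj_ab; apply: h => //; rewrite !inE ?na ?nb.
Qed.

Variable gT : finGroupType.

Definition generated (t : I -> gT) (u : seq I) : {group gT} :=
  <<[set t k | k in u]>>%G.

Lemma prod_commute (t : I -> gT) (g : gT) (u : seq I) :
  {in u, forall k, commute g (t k)} -> commute g (\prod_(k <- u) t k)%g.
Proof.
elim: u => [|k u IH] h; first by rewrite big_nil; apply: commute1.
rewrite big_cons; apply: commuteM; first by apply: h; rewrite inE eqxx.
by apply: IH => l lu; apply: h; rewrite inE lu orbT.
Qed.

(* A leaf i with neighbour j can be moved next to j inside a cyclic word. *)
Lemma merge_leaf (t : I -> gT) u i j : uniq u -> i \in u -> j \in u -> i != j ->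
  {in u, forall k, k != i -> k != j -> commute (t i) (t k)} ->
  exists2 g, g \in generated t u &
    (\prod_(k <- u) t k)%g =
    ((\prod_(k <- rem i u) (if k == j then t j * t i else t k)) ^ g)%g.
Proof.
move=> uu iu ju ij comm; pose t' k := if k == j then (t j * t i)%g else t k.
have eqt' v : j \notin v -> (\prod_(k <- v) t' k = \prod_(k <- v) t k)%g.
  move=> jv; apply: eq_big_seq => k kv; rewrite /t' ifN //.
  by apply: contraNneq jv => <-.
have ti_in : t i \in generated t u by rewrite mem_gen ?imset_f.
have cprod v : {subset v <= u} -> i \notin v -> j \notin v ->
    commute (t i) (\prod_(k <- v) t k)%g.
  move=> sv iv jv; apply: prod_commute => k kv; apply: comm; first exact: sv.
    by apply: contraNneq iv => <-.
  by apply: contraNneq jv => <-.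
suff: exists2 g, g \in generated t u &
  (\prod_(k <- u) t k = (\prod_(k <- rem i u) t' k) ^ g)%g by [].
have remE : rem i u = filter (predC1 i) u by apply: rem_filter.
have [p [r eu]] : exists p r, u = p ++ i :: r.
  by case/splitPr: iu => p r; exists p, r.
have ri : rem i u = p ++ r.
  move: uu; rewrite remE eu cat_uniq => /= /and3P[_ /norP[ip _] /andP[ir _]].
  rewrite filter_cat /= eqxx /=; congr (_ ++ _); apply/all_filterP/allP => k kp /=.
    by apply: contraNneq ip => <-.
  by apply: contraNneq ir => <-.
have ui : i \notin p ++ r by rewrite -ri mem_rem_uniq // inE eqxx.
have uj : uniq (p ++ r) by rewrite -ri rem_uniq.
have sub k : k \in p ++ r -> k \in u.
  by rewrite eu !mem_cat inE => /orP[]->; rewrite ?orbT.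
have jpr : j \in p ++ r by rewrite -ri mem_rem_uniq // inE eq_sym ij.
have -> : (\prod_(k <- u) t k = (\prod_(k <- p) t k) * (t i * \prod_(k <- r) t k))%g.
  by rewrite eu big_cat big_cons.
rewrite ri.
have [jp|jnp] := boolP (j \in p).
  have [p1 [p2 ep]] : exists p1 p2, p = p1 ++ j :: p2.
    by case/splitPr: jp => p1 p2; exists p1, p2.
  move: uj ui sub; rewrite ep -catA /= => uj ui sub.
  move: uj; rewrite cat_uniq /= mem_cat has_cat => /and3P[_ /norP[jp1 _] /andP[/norP[jp2 jr] _]].
  exists 1%g; first exact: group1.
  rewrite conjg1 !(big_cat, big_cons) /= !eqt' // /t' eqxx.
  have c2 : commute (t i) (\prod_(k <- p2) t k)%g.
    apply: cprod => // [k kp|]; first by apply: sub; rewrite mem_cat inE mem_cat kp !orbT.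
    by apply: contra ui => ip; rewrite mem_cat inE mem_cat ip !orbT.
  by rewrite -!mulgA; congr (_ * (_ * _))%g; rewrite !mulgA c2.
have jr : j \in r by move: jpr; rewrite mem_cat (negPf jnp).
have [r1 [r2 er]] : exists r1 r2, r = r1 ++ j :: r2.
  by case/splitPr: jr => r1 r2; exists r1, r2.
move: uj ui sub; rewrite er catA => uj ui sub.
move: uj; rewrite cat_uniq /= => /and3P[_ /norP[jp1 _] /andP[jr2 _]].
move: (jp1); rewrite mem_cat => /norP[_ jr1].
exists (t i)^-1%g; first by rewrite groupV.
rewrite !big_cat !big_cons /= !eqt' // /t' eqxx.
have cX : commute (t i) ((\prod_(k <- p) t k) * (\prod_(k <- r1) t k))%g.
  rewrite -big_cat; apply: cprod => // [k kp|]; first by apply: sub; rewrite mem_cat kp.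
  by apply: contra ui => ip; rewrite mem_cat ip.
have cr1 : commute (t i) (\prod_(k <- r1) t k)%g.
  apply: cprod => // [k kp|]; first by apply: sub; rewrite !mem_cat kp orbT.
  by apply: contra ui => ip; rewrite !mem_cat ip orbT.
have cY : commute (t i) (\prod_(k <- r2) t k)%g.
  apply: cprod => // [k kp|]; first by apply: sub; rewrite !mem_cat inE kp !orbT.
  by apply: contra ui => ip; rewrite !mem_cat inE ip !orbT.
rewrite conjgE invgK; move: cX cY cr1; rewrite /commute !mulgA => cX cY cr1.
rewrite -(mulgA _ (t i)) cr1 mulgA -cX.
by rewrite -!mulgA; congr (_ * (_ * (_ * (_ * _))))%g; rewrite !mulgA cY mulgK.
Qed.

(** The conjugating element is confined to a subgroup because the induction of [forest_conj] needs
    it to commute with an isolated letter that has been split off. *)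
Definition conj_in (S : {group gT}) (x y : gT) := exists2 g, g \in S & x = (y ^ g)%g.

Lemma conj_in_trans (S : {group gT}) x y z : conj_in S x y -> conj_in S y z -> conj_in S x z.
Proof. by move=> [g Sg ->] [h Sh ->]; exists (h * g)%g; rewrite ?groupM ?conjgM. Qed.

Lemma conj_in_sym (S : {group gT}) x y : conj_in S x y -> conj_in S y x.
Proof. by move=> [g Sg ->]; exists g^-1%g; rewrite ?groupV ?conjgK. Qed.

Lemma conj_inS (S S' : {group gT}) x y : S \subset S' -> conj_in S x y -> conj_in S' x y.
Proof. by move=> /subsetP sSS' [g Sg ->]; exists g => //; apply: sSS'. Qed.

Lemma generated_sub (t : I -> gT) (u : seq I) (S : {group gT}) :
  {in u, forall k, t k \in S} -> generated t u \subset S.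
Proof. by move=> h; rewrite gen_subG; apply/subsetP => _ /imsetP[k ku ->]; apply: h. Qed.

(** Induction on the word: a leaf i is absorbed into its neighbour j, both words becoming conjugate
    to words with one letter fewer. The letter [t j * t i] is no longer a generator, so [t] is
    arbitrary; it still commutes with the letters not adjacent to j, as i has no other neighbour. *)
Lemma forest_conj (t : I -> gT) u v : uniq u -> perm_eq u v ->
  {in u &, forall i j, i != j -> ~~ adj i j -> commute (t i) (t j)} ->
  conj_in (generated t u) (\prod_(k <- u) t k)%g (\prod_(k <- v) t k)%g.
Proof.
have [m] := ubnP (size u); elim: m t u v => // m IH t u v sz uu puv comm.
have uv : uniq v by rewrite -(perm_uniq puv).
have muv := perm_mem puv.
case eu : (nilp u).
  have u0 := nilP eu; move: puv; rewrite u0 perm_sym => /perm_nilP ->.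
  by exists 1%g; rewrite ?conjg1.
have nz : [set k in u] != set0.
  case: (u) eu => // k u' _; apply/set0Pn; exists k; by rewrite !inE eqxx.
have [i] := forest_leaf nz; rewrite inE => iu [j0 hj0].
have tin k : k \in u -> t k \in generated t u by move=> ku; rewrite mem_gen ?imset_f.
have iv : i \in v by rewrite -muv.
have szr : (size (rem i u) < m)%N.
  by rewrite size_rem //; case: (u) eu sz.
have ur : uniq (rem i u) by apply: rem_uniq.
have prv : perm_eq (rem i u) (rem i v).
  by rewrite -(perm_cons i) -(permPl (perm_to_rem iu)) perm_sym -(permPl (perm_to_rem iv)) perm_sym.
have remP k : (k \in rem i u) = (k != i) && (k \in u) by rewrite mem_rem_uniq.
have [/existsP[j /and3P[ju ij aij]]|/existsPn none] :=
    boolP [exists j, [&& j \in u, j != i & adj i j]].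
  have ci k : k \in u -> k != i -> k != j -> commute (t i) (t k).
    move=> ku ki kj; apply: comm => //; first by rewrite eq_sym.
    apply: contra kj => aik; apply/eqP.
    by rewrite (hj0 k) ?inE // (hj0 j) ?inE.
  rewrite eq_sym in ij.
  pose t' k := if k == j then (t j * t i)%g else t k.
  have [g1 G1 e1] := merge_leaf uu iu ju ij ci.
  have cv k : k \in v -> k != i -> k != j -> commute (t i) (t k).
    by rewrite -muv; apply: ci.
  have jv : j \in v by rewrite -muv.
  have [g2 G2 e2] := merge_leaf uv iv jv ij cv.
  have sG : generated t v \subset generated t u.
    by apply: generated_sub => k; rewrite -muv; apply: tin.
  apply: (conj_in_trans (y := (\prod_(k <- rem i u) t' k)%g)); first by exists g1.
  apply: (conj_in_trans (y := (\prod_(k <- rem i v) t' k)%g)); last first.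
    by apply: conj_in_sym; exists g2 => //; apply: (subsetP sG).
  have sG' : generated t' (rem i u) \subset generated t u.
    apply: generated_sub => k; rewrite remP /t' => /andP[_ ku].
    by case: ifP => _; rewrite ?groupM ?tin.
  apply: conj_inS sG' _; apply: IH => // a b; rewrite !remP => /andP[ai au] /andP[bi bu] ab nab.
  rewrite /t'; have [aj|aj] := eqVneq a j; have [bj|bj] := eqVneq b j.
  - by rewrite aj bj eqxx in ab.
  - apply: commute_sym; apply: commuteM; apply: commute_sym; last exact: ci.
    by rewrite -aj; apply: comm.
  - apply: commuteM; last by apply: commute_sym; apply: ci.
    by rewrite -bj; apply: comm.
  exact: comm.
have ci k : k \in u -> k != i -> commute (t i) (t k).
  move=> ku ki; apply: comm => //; first by rewrite eq_sym.
  by have := none k; rewrite ku ki.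
have split w : i \in w -> uniq w -> {subset w <= u} ->
    (\prod_(k <- w) t k = t i * \prod_(k <- rem i w) t k)%g.
  move=> iw uw sw; case/splitPr: iw uw sw => p r; rewrite cat_uniq /=.
  move=> /and3P[_ /norP[ip _] _] sw; rewrite big_cat big_cons /=.
  have -> : rem i (p ++ i :: r) = p ++ r.
    by elim: p ip {sw} => [|a p IHp] /=; rewrite ?eqxx // inE negb_or eq_sym => /andP[/negPf-> /IHp->].
  rewrite big_cat !mulgA; congr (_ * _)%g; apply/esym/prod_commute => k kp.
  apply: ci; first by apply: sw; rewrite mem_cat kp.
  by apply: contraNneq ip => <-.
rewrite (split u) // (split v) // => [|k]; last by rewrite -muv.
have [|g G e] := IH t _ _ szr ur prv.
  by move=> a b; rewrite !remP => /andP[_ au] /andP[_ bu]; apply: comm.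
exists g.
  by apply: (subsetP _ _ G); apply: generated_sub => k; rewrite remP => /andP[_ ku]; apply: tin.
(* The conjugator lies in the group generated by the remaining letters, all of which commute with
   [t i]. *)
rewrite e conjMg; congr (_ * _)%g; apply/esym/conjg_fixP/commgP/commute_sym.
suff : g \in 'C[t i]%g by move/cent1P.
apply: (subsetP _ _ G); apply: generated_sub => k; rewrite remP => /andP[ki ku].
by apply/cent1P; apply: commute_sym; apply: ci.
Qed.

End Forest.

(** * Perron eigenvector *)

Section Perron.
Import sesquilinear.
Local Open Scope sesquilinear_scope.

Variables (C : numClosedFieldType) (n : nat) (A : 'M[C]_n).
Hypothesis n_gt0 : (0 < n)%N.
Hypothesis A_ge0 : forall i j, 0 <= A i j.
Hypothesis A_sym : forall i j, A i j = A j i.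
Hypothesis A_connected : forall J : {set 'I_n},
  (forall i j, i \in J -> j \notin J -> A i j = 0) -> J = set0 \/ J = setT.

(* The absolute values of an eigenvector for the largest eigenvalue still
   maximise the Rayleigh quotient, hence form an eigenvector. *)
Lemma perron_eigenvector : exists (z : 'I_n -> C) (lambda : C),
  [/\ lambda \is Num.real, forall i, 0 < z i &
      forall j, \sum_i z i * A i j = lambda * z j].
Proof.
have Areal : A \is a realmx by apply/mxOverP => i j; apply: ger0_real.
have Aherm : A \is hermsymmx.
  apply: realsym_hermsym => //; apply/is_hermitianmxP.
  by rewrite expr0 scale1r map_mx_id //; apply/matrixP => i j; rewrite mxE A_sym.
set P := spectralmx A; set d := spectral_diag A.
have Punit : P \is unitarymx := spectral_unitarymx A.
have dreal := hermitian_spectral_diag_real Aherm.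
have AE : A = P^t* *m diag_mx d *m P.
  by rewrite -(invmx_unitary Punit); apply/orthomx_spectralP/hermitian_normalmx.
have dR k : d 0 k \is Num.real by apply/mxOverP.
have [k kmax] : exists k, forall j, d 0 j <= d 0 k.
  have F_real : {in predT, forall j, d 0 j \is Num.real} by [].
  by case: (real_arg_maxP (isT : predT (Ordinal n_gt0)) F_real) => k _ h; exists k => j; apply: h.
pose lam := d 0 k; pose y := row k P; pose z : 'rV[C]_n := \row_i `|y 0 i|.
(* The defect of x from attaining the largest Rayleigh quotient. In spectral coordinates it is a sum
   of nonnegative terms, so its vanishing characterises eigenvectors for [lam]. *)
pose Q (x : 'rV[C]_n) := lam * (\sum_i `|x 0 i| ^+ 2) - \sum_i \sum_j x 0 i * A i j * (x 0 j)^*.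
have QE x : Q x = \sum_j (lam - d 0 j) * `|(x *m P^t*) 0 j| ^+ 2.
  pose w := x *m P^t*.
  have PtP : P^t* *m P = 1%:M by apply: mulmx1C; apply/unitarymxP.
  have wV : w^t* = P *m x^t* by rewrite /w trmx_mul map_mxM /= trmxCK.
  have e1 : \sum_i `|x 0 i| ^+ 2 = \sum_j `|w 0 j| ^+ 2.
    have f (u : 'rV[C]_n) : \sum_i `|u 0 i| ^+ 2 = (u *m u^t*) 0 0.
      by rewrite mxE; apply: eq_bigr => i _; rewrite !mxE normCK.
    by rewrite !f wV /w mulmxA -(mulmxA x) PtP mulmx1.
  have e2 : \sum_i \sum_j x 0 i * A i j * (x 0 j)^* = \sum_j d 0 j * `|w 0 j| ^+ 2.
    transitivity ((x *m A *m x^t*) 0 0).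
      rewrite exchange_big mxE; apply: eq_bigr => j _; rewrite !mxE mulr_suml.
      by apply: eq_bigr => i _.
    rewrite AE !mulmxA -/w -mulmxA -wV mul_mx_diag mxE; apply: eq_bigr => j _.
    by rewrite !mxE normCK mulrAC mulrC.
  by rewrite /Q e1 e2 mulr_sumr -sumrB; apply: eq_bigr => j _; rewrite mulrBl.
have Qge x : 0 <= Q x.
  rewrite QE; apply: sumr_ge0 => j _; rewrite mulr_ge0 ?exprn_ge0 ?normr_ge0 //.
  by rewrite subr_ge0.
have yP : y *m P^t* = delta_mx 0 k.
  by rewrite /y rowE -mulmxA (unitarymxP Punit) mulmx1.
have Qy : Q y = 0.
  rewrite QE yP big1 // => j _; rewrite mxE /=.
  by case: (eqVneq j k) => [->|]; rewrite ?subrr ?mul0r // normr0 expr0n mulr0.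
have zy i : z 0 i = `|y 0 i| by rewrite mxE.
have zge i : 0 <= z 0 i by rewrite zy.
have zC i : (z 0 i)^* = z 0 i by apply/CrealP/ger0_real.
(* Taking absolute values keeps the norm and, as the entries of A are nonnegative, can only increase
   the quadratic form. *)
have Qz : Q z = 0.
  apply/le_anti; rewrite Qge andbT -Qy /Q.
  rewrite (eq_bigr (fun i => `|y 0 i| ^+ 2)) => [|i _]; last by rewrite zy normr_id.
  rewrite lerD2l lerN2.
  set S := \sum_i \sum_j y 0 i * _ * _.
  have Sreal : S \is Num.real.
    have -> : S = lam * \sum_i `|y 0 i| ^+ 2.
      by apply/eqP; rewrite eq_sym -subr_eq0; apply/eqP; exact: Qy.
    by rewrite realM ?dR // ger0_real // sumr_ge0 // => i _; rewrite exprn_ge0.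
  apply: le_trans (real_ler_norm Sreal) _.
  apply: le_trans (ler_norm_sum _ _ _) _; apply: ler_sum => i _.
  apply: le_trans (ler_norm_sum _ _ _) _; apply: ler_sum => j _.
  by rewrite !normrM norm_conjC zC !zy (ger0_norm (A_ge0 _ _)).
have zA : z *m A = lam *: z.
  apply/eqP; rewrite eq_sym -subr_eq0 -mul_mx_scalar -mulmxBr.
  have -> : lam%:M - A = P^t* *m diag_mx (const_mx lam - d) *m P.
    have PtP : P^t* *m P = 1%:M by apply: mulmx1C; apply/unitarymxP.
    rewrite linearB /= mulmxBr mulmxBl -AE diag_const_mx mul_mx_scalar -scalemxAl PtP.
    by rewrite scalemx1.
  rewrite !mulmxA mul_mx_diag (_ : \matrix_(_, _) _ = 0) ?mul0mx //.
  apply/rowP => j; rewrite !mxE.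
  move: Qz; rewrite QE => /psumr_eq0P h.
  have ge i : 0 <= (lam - d 0 i) * `|(z *m P^t*) 0 i| ^+ 2.
    by rewrite mulr_ge0 ?exprn_ge0 ?normr_ge0 // subr_ge0.
  have /eqP := h (fun i _ => ge i) j isT.
  by rewrite mulf_eq0 sqrf_eq0 normr_eq0 -mulf_eq0 mulrC mxE => /eqP.
have eig j : \sum_i z 0 i * A i j = lam * z 0 j.
  by have := congr1 (fun x : 'rV[C]_n => x 0 j) zA; rewrite !mxE.
exists (fun i => z 0 i), lam; split=> [|i|//]; first exact: dR.
rewrite lt0r zge andbT.
(* At a zero of z the eigenvalue equation is a vanishing sum of nonnegative terms, so no edge leaves
   the zero set; connectedness makes it empty or everything. *)
pose J := [set j | z 0 j == 0].
have [|J0|JT] := A_connected (J := J).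
- move=> a b; rewrite !inE => /eqP za zb; have := eig a; rewrite za mulr0 => /psumr_eq0P h.
  have /(_ b isT)/eqP := h (fun j _ => mulr_ge0 (zge j) (A_ge0 j a)).
  by rewrite mulf_eq0 (negPf zb) A_sym => /eqP.
- have iJ : i \notin J by rewrite J0 inE.
  by move: iJ; rewrite inE.
have y0 : y = 0.
  apply/rowP => j; rewrite [RHS]mxE; apply/eqP; rewrite -normr_eq0 -zy.
  have jJ : j \in J by rewrite JT inE.
  by move: jJ; rewrite inE.
by move: yP; rewrite y0 mul0mx => /matrixP/(_ 0 k)/eqP; rewrite !mxE !eqxx eq_sym oner_eq0.
Qed.

End Perron.

(** * Hecke algebra of a Weyl group *)

Section Weyl.

Variables (n : nat) (Phi : rootSystem n) (Delta : n.-tuple 'rV[rat]_n).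
Variables (gT : finGroupType) (W : {group gT}) (rW : mx_representation rat W n).
Hypothesis simpleDelta : simple_system Phi Delta.
Hypothesis weylW : Weyl_group Phi rW.

Local Notation al := (tnth Delta).
Local Notation s := (simple_elt Phi Delta rW).
Local Notation descent := (right_descent Delta rW).
Local Notation len := (weyl_len Phi Delta rW).
Local Notation height := (height Delta).
Local Notation word_prod := (simple_prod Phi Delta rW).
Local Notation longest := (longest Delta rW).
Local Notation positive_roots := (positive_roots Phi Delta).
Local Notation inversions := (inversions Phi Delta rW).
Local Notation root_elt := (root_elt Phi rW).
Let s_in := simple_in simpleDelta weylW.
Let word_in := word_prod_in simpleDelta weylW.

Lemma len_word_le u : (len (word_prod u) <= size u)%N.
Proof.
elim: u => [|i u IH]; first by rewrite /word_prod big_nil (len1 Phi Delta rW).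
rewrite word_prod_cons (len_simpleM simpleDelta weylW) //; case: ifP => _ /=.
  by rewrite (leq_trans (leq_pred _)) // ltnW.
by rewrite ltnS.
Qed.

Lemma reduced_cons i u : size (i :: u) = len (word_prod (i :: u)) ->
  size u = len (word_prod u) /\ 0 < height (al i *m rW (word_prod u)).
Proof.
rewrite word_prod_cons (len_simpleM simpleDelta weylW) //=.
have le := len_word_le u; case: ifP => h e.
  by have := leq_trans (leq_pred (len (word_prod u))) le; rewrite -e ltnn.
by case: e => ->; split=> //; rewrite (root_act_gt0 simpleDelta weylW) ?h // (simple_root simpleDelta).
Qed.
Lemma left_ascent_ind (P : gT -> Prop) : P 1%g ->
  (forall i w, w \in W -> ~~ descent i w^-1%g -> P w -> P (s i * w)%g) ->
  forall w, w \in W -> P w.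
Proof.
move=> P1 Ps w Ww; have [u -> sz] := reduced_word simpleDelta weylW Ww.
elim: u {w Ww} sz => [|i u IH]; first by rewrite /word_prod big_nil.
move=> /reduced_cons[sz pos]; rewrite word_prod_cons; apply: Ps (word_in u) _ (IH sz).
by rewrite /right_descent invgK -leNgt ltW.
Qed.

Lemma longest_exists : exists2 w, w \in W & longest w.
Proof.
have [w Ww max] := @arg_maxnP _ 1%g (fun w => w \in W) len (group1 W).
exists w => //; apply/forallP => i; have := max (w * s i)%g (groupM Ww (s_in i)).
by rewrite (lenM_simple simpleDelta weylW) //; case: ifP => // _ /=; rewrite ltnn.
Qed.

Lemma coords_word_prod v i x : i \notin v ->
  simple_coords Delta (x *m rW (word_prod v)) 0 i = simple_coords Delta x 0 i.
Proof.
elim: v x => [|j v IH] x; first by rewrite /word_prod big_nil repr_mx1 mulmx1.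
rewrite inE negb_or => /andP[ij iv]; rewrite word_prod_cons repr_mxM // mulmxA IH //.
rewrite (act_simple simpleDelta weylW) coordsD coordsN coordsZ.
by rewrite (coords_simple simpleDelta) eq_sym (negPf ij) mulr0 subr0.
Qed.

(** The i-th coordinate of [al i] becomes -1 under [s i], and the other simple reflections leave
    that coordinate unchanged. *)
Lemma simple_free i v : i \notin v -> (s i * word_prod v)%g != 1%g.
Proof.
move=> iv; apply/eqP => e; have : simple_coords Delta (al i *m rW (s i * word_prod v)%g) 0 i = 1.
  by rewrite e repr_mx1 mulmx1 (coords_simple simpleDelta) eqxx.
rewrite repr_mxM // mulmxA coords_word_prod // (rW_simple simpleDelta weylW).
rewrite reflect_root ?(simple_root simpleDelta) // coordsN (coords_simple simpleDelta) eqxx.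
by move/eqP; rewrite eqNr oner_eq0.
Qed.

(** [s i * w0] is not longest, so it has an ascent j; multiplying by [s j] restores the maximal
    length and hence gives [w0] back. *)
Lemma longest_swap w0 i : w0 \in W -> longest w0 -> exists j, (s i * w0 = w0 * s j)%g.
Proof.
move=> W0 l0; have Wi := s_in i.
have N0 : len w0 = size positive_roots by apply/(longestP simpleDelta weylW).
have d : height (al i *m rW w0) < 0.
  by have /forallP/(_ i) := longestV simpleDelta weylW W0 l0; rewrite /right_descent invgK.
have Wv : (s i * w0)%g \in W by rewrite groupM.
have lv := len_simpleM simpleDelta weylW i W0; rewrite d in lv.
have Npos : (0 < size positive_roots)%N.
  by have := simple_positive simpleDelta i; case: (positive_roots).
have [j dj] : exists j, ~~ descent j (s i * w0)%g.
  apply/existsP; rewrite -negb_forall; apply/negP => /(longestP simpleDelta weylW Wv).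
  by rewrite lv N0; lia.
exists j; have Wj := s_in j; have Wvj : (s i * w0 * s j)%g \in W by rewrite groupM.
have e : (s i * w0 * s j)%g = w0.
  apply: (longest_uniq simpleDelta weylW) => //; apply/(longestP simpleDelta weylW) => //.
  by rewrite (lenM_simple simpleDelta weylW) // (negPf dj) lv N0 prednK.
by rewrite -{2}e -mulgA (simple_eltK simpleDelta weylW) mulg1.
Qed.

Local Notation hecke_word := (hecke_word W s descent).
Local Notation hecke_tail := (hecke_tail W s descent).

Let sK := simple_eltK simpleDelta weylW.

(** At q = 1 the recursion of [hecke_tail] adds 1 + s_i and conjugates the rest by s_i, exactly as
    the inversions grow when a reduced word is extended on the left. *)
Lemma hecke_tail1 (R : fieldType) u : size u = len (word_prod u) ->
  hecke_tail (1 : R) u =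
  \sum_(a <- inversions (word_prod u)) (1%:M + regular_repr R W (root_elt a)).
Proof.
elim: u => [|i u IH] /=.
  have : len 1 = 0%N := len1 Phi Delta rW.
  by rewrite /word_prod big_nil /weyl_len; case: (inversions 1) => // _; rewrite big_nil.
move=> /reduced_cons[sz pos]; rewrite word_prod_cons.
rewrite (inversions_simpleM_sum simpleDelta weylW (fun x => 1%:M + regular_repr R W x)) //.
rewrite IH // hecke_right1 // mulmx_sumr mulmx_suml; congr (_ + _).
apply: eq_big_seq => a /inversionsP[Ra _ _].
rewrite (root_eltJ weylW) // conjgE (simple_eltV simpleDelta weylW).
have Wa := root_elt_in weylW Ra.
have ss : regular_repr R W (s i) *m regular_repr R W (s i) = 1%:M.
  by rewrite -repr_mxM // sK repr_mx1.
by rewrite mulmxDr mulmxDl mulmx1 !repr_mxM ?groupM // mulmxA ss.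
Qed.

Lemma hecke_trace (R : comNzRingType) (q : R) u : perm_eq u (enum 'I_n) ->
  \tr (hecke_word q u) = (q - 1) ^+ n.
Proof.
move=> pu; have [w0 W0 l0] := longest_exists.
have uu : uniq u by rewrite (perm_uniq pu) enum_uniq.
have mu i : i \in u by rewrite (perm_mem pu) mem_enum.
rewrite (hecke_word_trace s_in q uu W0).
- by rewrite (perm_size pu) size_enum_ord.
- move=> w Ww; apply/eqP/allP => [-> i _|h]; first by move/forallP: l0.
  apply: (longest_uniq simpleDelta weylW) => //.
  by apply/forallP => i; apply: h.
exact: simple_free.
Qed.

End Weyl.

(** * Dynkin diagram *)

Section Dynkin.

Variables (n : nat) (Phi : rootSystem n) (Delta : n.-tuple 'rV[rat]_n).
Variables (gT : finGroupType) (W : {group gT}) (rW : mx_representation rat W n).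
Hypothesis simpleDelta : simple_system Phi Delta.
Hypothesis weylW : Weyl_group Phi rW.

Local Notation al := (tnth Delta).
Local Notation s := (simple_elt Phi Delta rW).
Local Notation inner := (inner rW).
Local Notation coords := (simple_coords Delta).
Let s_in := simple_in simpleDelta weylW.
Let Ral := simple_root simpleDelta.
Let csimple := coords_simple simpleDelta.

Definition dynkin_adj i j := inner (al i) (al j) != 0.
Local Notation simple_adj := dynkin_adj.

Lemma simple_adj_sym : symmetric simple_adj.
Proof. by move=> i j; rewrite /simple_adj innerC. Qed.

Lemma pairing_simple_le0 i j : i != j -> pairing (al j) (coroot Phi (al i)) <= 0.
Proof.
move=> ij; have Rj := Ral j; have pj := height_simple simpleDelta j.
have ne : al j != al i.
  apply: contra ij => /eqP e; have := csimple j j.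
  by rewrite e csimple eqxx; case: eqP => // _ /eqP; rewrite eq_sym oner_eq0.
have pos : 0 < height Delta (al j *m rW (s i)).
  by apply: (positive_act_simple simpleDelta weylW) => //; rewrite pj ltr01.
have := coords_ge0 simpleDelta (root_act weylW (s_in i) Rj) pos i.
rewrite (act_simple simpleDelta weylW) coordsD coordsN coordsZ !csimple.
by rewrite eqxx mulr1 eq_sym (negPf ij) add0r oppr_ge0.
Qed.

Lemma simple_inner_le0 i j : i != j -> inner (al i) (al j) <= 0.
Proof.
move=> ij; have := pairing_simple_le0 ij; rewrite (pairing_inner weylW) // innerC.
have p := inner_root_gt0 rW (Ral i).
by rewrite pmulr_lle0 ?invr_gt0 // pmulr_rle0.
Qed.

(** The Cartan integer of two adjacent simple roots is a negative integer, hence at most -1. *)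
Lemma simple_inner_bound i j : i != j -> simple_adj i j ->
  inner (al i) (al j) <= - (inner (al i) (al i) / 2).
Proof.
move=> ij aij; have p := inner_root_gt0 rW (Ral i).
have le := pairing_simple_le0 ij; have := pairing_int (Ral i) (Ral j).
move: le; rewrite (pairing_inner weylW) // innerC => le /intrP[z ez].
have z0 : z < 0.
  rewrite -(ltr_int rat) -ez lt_neqAle le andbT.
  by rewrite !mulf_eq0 invr_eq0 (gt_eqF p) pnatr_eq0 /= orbF.
have : z%:~R <= -1 :> rat by rewrite (_ : -1 = (-1)%:~R) // ler_int; lia.
rewrite -ez ler_pdivrMr //; lra.
Qed.

Lemma inner_simple_eq0 v : inner v v <= 0 -> v = 0.
Proof. by move=> h; apply/eqP; apply: contraTT h => /(inner_gt0 rW); rewrite ltNge. Qed.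

(** Suppose every vertex of J has two neighbours in J and let x be the sum of its simple roots. By
    [simple_inner_bound] two neighbours cancel ([al i], [al i]), so (x, [al i]) <= 0 for all i in J
    and (x, x) <= 0, although x is not 0. *)
Lemma simple_forest (J : {set 'I_n}) : J != set0 ->
  exists2 i, i \in J & (#|[set j in J | (j != i) && simple_adj i j]| <= 1)%N.
Proof.
move=> nz; apply/exists_inP; apply: contraT; rewrite negb_exists => /forallP h.
case/set0Pn: nz => k Jk; pose x := \sum_(i in J) al i.
have x0 : x = 0.
  apply: inner_simple_eq0; rewrite {1}/x inner_sum; apply: sumr_le0 => i Ji.
  rewrite innerC inner_sum (bigD1 i) //=.
  have := h i; rewrite Ji /= -ltnNge; set N := [set _ in J | _] => N2.
  have pd := inner_root_gt0 rW (Ral i).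
  have le : \sum_(j in J | j != i) inner (al j) (al i) <= \sum_(j in N) - (inner (al i) (al i) / 2).
    rewrite (bigID (simple_adj i)) /= -[leRHS]addr0; apply: lerD.
      rewrite [leRHS](eq_bigl (fun j => (j \in J) && (j != i) && simple_adj i j)).
        apply: ler_sum => j /andP[/andP[Jj ji] aij].
        by rewrite innerC simple_inner_bound // eq_sym.
      by move=> j; rewrite inE andbA.
    by apply: sumr_le0 => j /andP[/andP[_ ji] _]; apply: simple_inner_le0.
  apply: le_trans (lerD (lexx _) le) _; rewrite sumr_const mulNrn subr_le0.
  rewrite -[leLHS](mulfVK (x := 2)) ?pnatr_eq0 // -[leRHS]mulr_natr ler_pM2l ?ler_nat //.
  by rewrite divr_gt0.
have : coords x 0 k = 1.
  rewrite /x (_ : \sum_(i in J) al i = \sum_i (i \in J)%:R *: al i).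
    by rewrite (coords_lin simpleDelta) Jk.
  rewrite big_mkcond; apply: eq_bigr => i _; case: ifP => _; by rewrite ?scale1r ?scale0r.
by rewrite x0 /simple_coords mul0mx mxE => /eqP; rewrite eq_sym oner_eq0.
Qed.

Lemma simple_commute i j : i != j -> ~~ simple_adj i j -> commute (s i) (s j).
Proof.
move=> ij; rewrite negbK => /eqP e.
have fixi : al i *m rW (s j) = al i.
  rewrite (act_simple simpleDelta weylW) (pairing_inner weylW) // e mulr0 mul0r scale0r subr0 //.
have := root_eltJ weylW (s_in j) (Ral i); rewrite fixi => e2.
by apply/commgP/conjg_fixP; rewrite -e2.
Qed.

Lemma span_stable (J : {set 'I_n}) u v :
  (forall i j, i \in J -> j \notin J -> inner (al i) (al j) = 0) ->
  (forall i, i \notin J -> coords v 0 i = 0) ->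
  forall i, i \notin J -> coords (v *m rW (simple_prod Phi Delta rW u)) 0 i = 0.
Proof.
move=> orth; elim: u v => [|j u IH] v h i iJ.
  by rewrite /simple_prod big_nil repr_mx1 mulmx1 h.
rewrite word_prod_cons repr_mxM ?(word_prod_in simpleDelta weylW) // mulmxA IH // => k kJ.
rewrite (act_simple simpleDelta weylW).
have [jJ|jJ] := boolP (j \in J).
  rewrite coordsD coordsN coordsZ csimple h // (_ : (j == k) = false) ?mulr0 ?subr0 //.
  by apply: contraNF kJ => /eqP <-.
rewrite (pairing_inner weylW) // (_ : inner v (al j) = 0) ?mulr0 ?mul0r ?scale0r ?subr0 ?h //.
rewrite (coords_sum simpleDelta v) inner_sum big1 // => l _; rewrite innerZ.
by have [lJ|lJ] := boolP (l \in J); [rewrite orth ?mulr0|rewrite h ?mul0r].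
Qed.

Hypothesis irrPhi : irreducible_rootSystem Phi.

(** If J is orthogonal to its complement, W preserves both spans. Every root is, up to sign, the
    image of a simple root, so it lies in one of the two, and irreducibility applies to this
    partition of the roots. *)
Lemma simple_connected (J : {set 'I_n}) :
  (forall i j, i \in J -> j \notin J -> inner (al i) (al j) = 0) ->
  J = set0 \/ J = setT.
Proof.
move=> orth; pose P := [pred a : 'rV[rat]_n | [forall i, (i \notin J) ==> (coords a 0 i == 0)]].
have PP a : reflect (forall i, i \notin J -> coords a 0 i = 0) (a \in P).
  apply: (iffP forallP) => h i; first by move=> iJ; have /implyP/(_ iJ)/eqP := h i.
  by apply/implyP => iJ; rewrite h.
have orthC i j : i \in ~: J -> j \notin ~: J -> inner (al i) (al j) = 0.
  by rewrite !inE negbK => iJ jJ; rewrite innerC orth.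
have dich a : a \in root_seq Phi -> a \in P \/ forall i, i \in J -> coords a 0 i = 0.
  move=> Ra; wlog pa : a Ra / 0 < height Delta a => [hw|].
    have [[p _]|[p _]] := root_sign simpleDelta Ra; first exact: hw.
    have [|h|h] := hw _ (rootN Ra); first by rewrite heightN oppr_gt0.
      by left; apply/PP => i iJ; apply: oppr_inj; rewrite -coordsN oppr0; apply/PP: iJ.
    by right => i iJ; apply: oppr_inj; rewrite -coordsN oppr0 h.
  have Pa : a \in positive_roots Phi Delta by apply/positive_rootsP.
  have [i [u ->]] := positive_root_word simpleDelta weylW Pa.
  have [iJ|iJ] := boolP (i \in J).
    left; apply/PP; apply: span_stable => // k kJ; rewrite csimple.
    by case: eqP => // e; rewrite -e iJ in kJ.
  right=> k kJ; apply: (span_stable (J := ~: J)) => // [l|]; rewrite ?inE ?negbK // => lJ.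
  by rewrite csimple; case: eqP => // e; rewrite e lJ in iJ.
have orthP a b : (forall i, i \notin J -> coords a 0 i = 0) ->
    (forall i, i \in J -> coords b 0 i = 0) -> inner a b = 0.
  move=> ha hb; rewrite (coords_sum simpleDelta a) inner_sum big1 // => i _; rewrite innerZ.
  have [iJ|iJ] := boolP (i \in J); last by rewrite ha ?mul0r.
  rewrite innerC (coords_sum simpleDelta b) inner_sum big1 ?mulr0 // => j _; rewrite innerZ.
  have [jJ|jJ] := boolP (j \in J); first by rewrite hb ?mul0r.
  by rewrite innerC orth ?mulr0.
case: irrPhi => _ /(_ P)[a b Ra Rb Pa Pb|h|h].
- have /PP ha := Pa; have [|hb] := dich b Rb; first by rewrite (negPf Pb).
  have e := orthP _ _ ha hb.
  by rewrite !(pairing_inner weylW) // e innerC e mulr0 !mul0r.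
- right; apply/setP => i; rewrite inE; apply: contraT => iJ.
  by have /PP/(_ i iJ)/eqP := h _ (Ral i); rewrite csimple eqxx oner_eq0.
left; apply/setP => i; rewrite inE; apply/negP => iJ.
have /negP := h _ (Ral i); apply; apply/PP => k kJ; rewrite csimple.
by case: eqP => // e; rewrite -e iJ in kJ.
Qed.

Lemma rank_gt0 : (0 < n)%N.
Proof.
case: n Phi irrPhi => // Phi0 [nz _]; case e : (root_seq Phi0) nz => [|a r] // _.
have Ra : a \in root_seq Phi0 by rewrite e inE eqxx.
by have := root_neq0 Ra; rewrite [a]thinmx0 eqxx.
Qed.

End Dynkin.

(** * Coxeter plane and full twist *)

Section Alternating.

Variables (n : nat) (Phi : rootSystem n) (Delta : n.-tuple 'rV[rat]_n).
Variables (gT : finGroupType) (W : {group gT}) (rW : mx_representation rat W n).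
Hypothesis simpleDelta : simple_system Phi Delta.
Hypothesis weylW : Weyl_group Phi rW.
Hypothesis irrPhi : irreducible_rootSystem Phi.

Local Notation al := (tnth Delta).
Local Notation s := (simple_elt Phi Delta rW).
Local Notation inner := (inner rW).
Local Notation coords := (simple_coords Delta).
Local Notation height := (height Delta).
Local Notation descent := (right_descent Delta rW).
Local Notation len := (weyl_len Phi Delta rW).
Local Notation word_prod := (simple_prod Phi Delta rW).
Local Notation longest := (longest Delta rW).
Local Notation simple_adj := (dynkin_adj Delta rW).
Local Notation hecke_word := (hecke_word W s descent).
Let s_in := simple_in simpleDelta weylW.
Let word_in := word_prod_in simpleDelta weylW.
Let Ral := simple_root simpleDelta.

(** Read from w, every letter raises the length, so the Hecke product involves no quadratic
    correction and follows the product in W. *)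
Fixpoint ascending w u := if u is i :: u' then ~~ descent i w && ascending (w * s i)%g u' else true.

Lemma ascending_cat w u v :
  ascending w (u ++ v) = ascending w u && ascending (w * word_prod u)%g v.
Proof.
elim: u w => [|i u IH] w /=; first by rewrite /word_prod big_nil mulg1.
by rewrite IH andbA word_prod_cons mulgA.
Qed.

Lemma ascending_hecke (R : comNzRingType) (q : R) w u : w \in W -> ascending w u ->
  hecke_basis W R w *m hecke_word q u = hecke_basis W R (w * word_prod u)%g.
Proof.
elim: u w => [|i u IH] w Ww /=; first by rewrite /word_prod big_nil mulg1 mulmx1.
move=> /andP[/negPf d asc]; rewrite mulmxA hecke_rightE // d IH ?groupM //.
by rewrite word_prod_cons mulgA.
Qed.

Lemma ascending_len w u : w \in W -> ascending w u ->
  len (w * word_prod u)%g = (len w + size u)%N.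
Proof.
elim: u w => [|i u IH] w Ww /=; first by rewrite /word_prod big_nil mulg1 addn0.
move=> /andP[/negPf d asc]; rewrite word_prod_cons mulgA IH ?groupM //.
by rewrite (lenM_simple simpleDelta weylW) // d addnS.
Qed.

Variable col : 'I_n -> bool.
Hypothesis colP : forall i j, i != j -> simple_adj i j -> col i != col j.

Definition color_class k := [seq i <- enum 'I_n | col i == k].
Fixpoint alternating k m :=
  if m is m'.+1 then color_class k ++ alternating (~~ k) m' else [::].

(** * Motion of a point of the Coxeter plane *)

Section Plane.

Variables (C : numClosedFieldType) (nu : 'I_n -> C).
Hypothesis nu_gt0 : forall i, 0 < nu i.
Hypothesis nuK : forall i, nu i * nu i = ratr (inner (al i) (al i)).

(** The Perron argument needs a symmetric matrix, which the Cartan matrix need not be. With [nu i]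
    the length of [al i], this is 2 minus twice the normalised Gram matrix. *)
Definition adj_mx : 'M[C]_n :=
  \matrix_(i, j) (if i == j then 0 else - (2 * ratr (inner (al i) (al j)) / (nu i * nu j))).

Lemma adj_mx_ge0 i j : 0 <= adj_mx i j.
Proof.
rewrite mxE; case: eqP => // /eqP ij; rewrite oppr_ge0 pmulr_lle0; last first.
  by rewrite invr_gt0 mulr_gt0.
rewrite pmulr_rle0 ?ltr0n // -(rmorph0 (@ratr C)) ler_rat.
exact: (simple_inner_le0 simpleDelta weylW).
Qed.

Lemma adj_mx_sym i j : adj_mx i j = adj_mx j i.
Proof. by rewrite !mxE eq_sym innerC (mulrC (nu i)). Qed.

Lemma adj_mx_connected (J : {set 'I_n}) :
  (forall i j, i \in J -> j \notin J -> adj_mx i j = 0) -> J = set0 \/ J = setT.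
Proof.
move=> h; apply: (simple_connected simpleDelta weylW irrPhi) => i j iJ jJ.
have ij : i != j by apply: contraNneq jJ => <-.
have nz : (nu i * nu j)^-1 != 0 by rewrite invr_neq0 // gt_eqF // mulr_gt0.
have /eqP := h i j iJ jJ; rewrite mxE (negPf ij) oppr_eq0 mulf_eq0 (negPf nz) orbF.
by rewrite mulf_eq0 pnatr_eq0 fmorph_eq0 => /eqP.
Qed.

Section Evolution.
Variables (z : 'I_n -> C) (lam : C).
Hypothesis lam_real : lam \is Num.real.
Hypothesis z_gt0 : forall i, 0 < z i.
Hypothesis z_eigen : forall j, \sum_i z i * adj_mx i j = lam * z j.

(* A point of the Coxeter plane, seen as a linear form. *)
Definition plane_form (v : 'rV[rat]_n) : C := \sum_i ratr (coords v 0 i) * (nu i * z i).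
Local Notation f := plane_form.
(** By [descent_value] the sign of this number tells whether j is a descent of w. *)
Definition wall_value w j := f (al j *m rW w^-1%g).
Local Notation g := wall_value.

Let formB u v : f (u - v) = f u - f v.
Proof.
rewrite /f -sumrB; apply: eq_bigr => i _.
by rewrite coordsD coordsN rmorphB mulrBl.
Qed.

Let formN u : f (- u) = - f u.
Proof. by rewrite /f -sumrN; apply: eq_bigr => i _; rewrite coordsN rmorphN mulNr. Qed.

Let formZ k u : f (k *: u) = ratr k * f u.
Proof.
by rewrite /f mulr_sumr; apply: eq_bigr => i _; rewrite coordsZ rmorphM mulrA.
Qed.

Let form_gt0 a : a \in root_seq Phi -> 0 < height a -> 0 < f a.
Proof.
move=> Ra pa; have ge i : 0 <= ratr (coords a 0 i) * (nu i * z i).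
  by rewrite mulr_ge0 // ?ler0q ?(coords_ge0 simpleDelta) // ltW // mulr_gt0.
rewrite lt0r sumr_ge0 // andbT; apply: contraTneq (root_neq0 Ra) => h0.
have {}h0 := psumr_eq0P (fun i _ => ge i) h0; rewrite negbK.
apply/eqP/(coords_eq0 simpleDelta) => i; have /eqP := h0 i isT.
by rewrite mulf_eq0 fmorph_eq0 (gt_eqF (mulr_gt0 (nu_gt0 i) (z_gt0 i))) orbF => /eqP.
Qed.

Let descent_value i w : w \in W -> descent i w = (g w i < 0).
Proof.
move=> Ww; have Ra := root_act weylW (groupVr Ww) (Ral i).
rewrite /right_descent /g; have [[p _]|[p _]] := root_sign simpleDelta Ra.
  by rewrite (lt_gtF p) (lt_gtF (form_gt0 Ra p)).
rewrite p; apply/esym; rewrite -oppr_gt0 -formN form_gt0 ?rootN //.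
by rewrite heightN oppr_gt0.
Qed.

Let value_neq0 i w : w \in W -> g w i != 0.
Proof.
move=> Ww; have Ra := root_act weylW (groupVr Ww) (Ral i).
have [[p _]|[p _]] := root_sign simpleDelta Ra; first by rewrite gt_eqF // form_gt0.
by rewrite -oppr_eq0 -formN gt_eqF // form_gt0 ?rootN // heightN oppr_gt0.
Qed.

Let pair j i : C := ratr (pairing (al j) (coroot Phi (al i))).

Let pairE j i : pair j i * nu i = if i == j then 2 * nu j else - (nu j * adj_mx i j).
Proof.
have nz k : nu k != 0 by rewrite gt_eqF.
rewrite /pair (pairing_inner weylW) // fmorph_div rmorphM rmorph_nat /= -(nuK i); case: eqP => [->|/eqP ij].
  by rewrite -nuK mulfK ?mulf_neq0.
rewrite mxE (negPf ij) (innerC rW (al j)); field.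
by rewrite !nz.
Qed.

Let value_step w i j : w \in W -> g (w * s i)%g j = g w j - pair j i * g w i.
Proof.
move=> Ww; rewrite /g invMg (simple_eltV simpleDelta weylW) repr_mxM ?groupV //.
by rewrite mulmxA (act_simple simpleDelta weylW) mulmxBl -scalemxAl formB formZ.
Qed.

Let pair_same i j : i != j -> col i = col j -> pair j i = 0.
Proof.
move=> ij cij; rewrite /pair (pairing_inner weylW) //.
have /negbTE : ~~ simple_adj i j by apply: contraTN isT => /(colP ij); rewrite cij eqxx.
by rewrite /dynkin_adj innerC => /negbFE/eqP ->; rewrite mulr0 mul0r rmorph0.
Qed.

Let ascending_block w k u : w \in W -> uniq u -> {in u, forall i, col i = k} ->
  {in u, forall i, 0 < g w i} ->
  ascending w u /\
  forall j, g (w * word_prod u)%g j = g w j - \sum_(i <- u) pair j i * g w i.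
Proof.
elim: u w => [|i u IH] w Ww /=.
  by move=> _ _ _; split=> // j; rewrite /word_prod !big_nil mulg1 subr0.
move=> /andP[iu uu] cu gu; have ci : col i = k by apply: cu; rewrite inE eqxx.
have eqg j : j \in u -> g (w * s i)%g j = g w j.
  move=> ju; rewrite value_step // pair_same ?mul0r ?subr0 //.
    by apply: contraNneq iu => ->.
  by rewrite ci cu // inE ju orbT.
have [||||asc h] := IH (w * s i)%g => //.
- by rewrite groupM.
- by move=> j ju; apply: cu; rewrite inE ju orbT.
- by move=> j ju; rewrite eqg // gu // inE ju orbT.
have gi : 0 < g w i by rewrite gu // inE eqxx.
split=> [|j]; first by rewrite asc descent_value // lt_gtF.
rewrite word_prod_cons mulgA h big_cons value_step // opprD addrA; congr (_ - _).
by apply: eq_big_seq => l lu; rewrite eqg.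
Qed.

(** The two colour parts of the Perron vector span a plane; p is the coordinate on the colour k to
    be reflected next, r the one on the other colour. *)
Definition plane_state k w p r :=
  forall j, g w j = nu j * z j * (if col j == k then p else r).

(** Reflections of one colour do not affect each other's walls. The block negates p and, by the
    eigenvector equation, adds [lam * p] to r; the state keeps its shape with the colours
    exchanged. *)
Let state_block k w p r : w \in W -> plane_state k w p r -> 0 < p ->
  ascending w (color_class k) /\
  plane_state (~~ k) (w * word_prod (color_class k))%g (r + lam * p) (- p).
Proof.
move=> Ww st p0.
have memc i : (i \in color_class k) = (col i == k) by rewrite mem_filter mem_enum andbT.
have [|i|i|asc h] := @ascending_block w k (color_class k) Ww.
- by rewrite filter_uniq ?enum_uniq.
- by rewrite memc => /eqP.
- by rewrite memc st => /eqP ->; rewrite eqxx !mulr_gt0.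
split=> // j; rewrite h big_filter big_enum_cond st /=.
have -> : (col j == ~~ k) = ~~ (col j == k) by case: (col j); case: (k).
have [cj|cj] /= := eqVneq (col j) k.
  rewrite (bigD1 j) ?cj //= big1 => [|i /andP[/eqP ci ij]]; last first.
    by rewrite pair_same ?mul0r // ci cj.
  rewrite st cj eqxx addr0 !mulrA pairE eqxx; ring.
have -> : \sum_(i | col i == k) pair j i * g w i = - (nu j * p * (lam * z j)).
  rewrite -z_eigen mulr_sumr -sumrN [RHS](bigID (fun i => col i == k)) /=.
  rewrite [X in _ = _ + X]big1 ?addr0 => [|i /negPf ci]; last first.
    rewrite mxE; case: eqP => [|/eqP ij]; first by rewrite !mulr0 oppr0.
    have := @pair_same i j ij; rewrite /pair => e.
    have /negbTE : ~~ simple_adj i j.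
      apply: contraTN isT => /(colP ij); move: ci cj.
      by case: (col i); case: (col j); case: (k).
    rewrite /dynkin_adj => /negbFE/eqP ->.
    by rewrite rmorph0 !mulr0 mul0r oppr0 !mulr0 oppr0.
  apply: eq_bigr => i ci; rewrite st ci !mulrA pairE ifN; first by ring.
  by apply: contraNneq cj => <-.
ring.
Qed.

(** [m] is fuel: each block raises the length, which is at most the number of positive roots. After
    a block the walls of its colour are negative; once those of the other colour are negative too,
    the element is longest. *)
Let alternating_state m k w p r : w \in W -> plane_state k w p r -> 0 < p -> r \is Num.real ->
  color_class k != [::] -> (size (positive_roots Phi Delta) < len w + m)%N ->
  exists l, ascending w (alternating k l.+1) /\ longest (w * word_prod (alternating k l.+1))%g.
Proof.
elim: m k w p r => [|m IH] k w p r Ww st p0 rR ne sz.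
  have : (len w <= size (positive_roots Phi Delta))%N.
    by rewrite /weyl_len [size (inversions _ _ _ _)]size_filter count_size.
  by move: sz; rewrite addn0 ltnNge => /negPf->.
have [asc st'] := state_block Ww st p0.
have Ww' : (w * word_prod (color_class k))%g \in W by rewrite groupM.
have pR : r + lam * p \is Num.real by rewrite realD // realM // gtr0_real.
have done_case : (forall j, col j = ~~ k -> r + lam * p < 0) ->
    exists l, ascending w (alternating k l.+1) /\ longest (w * word_prod (alternating k l.+1))%g.
  move=> h; exists 0%N; rewrite /= cats0; split=> //; apply/forallP => j.
  rewrite descent_value // st'; case: eqP => [cj|_].
    by rewrite pmulr_rlt0 ?(h j) // mulr_gt0.
  by rewrite pmulr_rlt0 ?oppr_lt0 // mulr_gt0.
case e : (color_class (~~ k)) => [|j0 c].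
  apply: done_case => j cj; suff : j \in [::] by [].
  by rewrite -e mem_filter cj eqxx mem_enum.
have cj0 : col j0 = ~~ k.
  have : j0 \in color_class (~~ k) by rewrite e inE eqxx.
  by rewrite mem_filter => /andP[/eqP].
(* Zero would be a value of the form at a root, where it never vanishes. *)
have nz : r + lam * p != 0.
  apply: contraNneq (value_neq0 j0 Ww') => e0.
  by rewrite st' cj0 eqxx e0 mulr0.
have [lt0|gt0] := real_ltP pR (real0 _); first by apply: done_case.
have p0' : 0 < r + lam * p by rewrite lt0r nz.
have [|||l [asc2 lo]] := IH (~~ k) _ _ _ Ww' st' p0'.
- by rewrite realN gtr0_real.
- by rewrite e.
- rewrite ascending_len // -addnA; apply: leq_trans sz _; rewrite leq_add2l.
  by move: ne; case: (color_class k) => //= ? ? _; rewrite addSn ltnS leq_addl.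
exists l.+1; rewrite [alternating k l.+2]/= -/(alternating (~~ k) l.+1).
by rewrite ascending_cat asc asc2 word_prod_cat mulgA.
Qed.

Lemma alternating_longest_class k : color_class k != [::] ->
  exists l, ascending 1 (alternating k l.+1) /\ longest (word_prod (alternating k l.+1)).
Proof.
move=> ne; have st : plane_state k 1 1 1.
  move=> j; rewrite if_same mulr1 /g invg1 repr_mx1 mulmx1 /f (bigD1 j) //=.
  rewrite (coords_simple simpleDelta) eqxx rmorph1 mul1r big1 ?addr0 // => i ij.
  by rewrite (coords_simple simpleDelta) eq_sym (negPf ij) rmorph0 mul0r.
have [||l] := @alternating_state (size (positive_roots Phi Delta)).+1 k 1%g 1 1 (group1 W) st ltr01 _ ne.
- exact: real1.
- by rewrite (len1 Phi Delta rW).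
by rewrite mul1g; exists l.
Qed.

End Evolution.

End Plane.

Lemma alternating_longest k : exists l,
  ascending 1 (alternating k l.+1) /\ longest (word_prod (alternating k l.+1)).
Proof.
pose nu i : algC := sqrtC (ratr (inner (al i) (al i))).
have nu_gt0 i : 0 < nu i by rewrite sqrtC_gt0 ltr0q (inner_root_gt0 rW (Ral i)).
have nuK i : nu i * nu i = ratr (inner (al i) (al i)) by rewrite -expr2 sqrtCK.
have [z [lam [lR z0 zE]]] := perron_eigenvector (rank_gt0 irrPhi) (adj_mx_ge0 nu_gt0)
  (adj_mx_sym nu) (adj_mx_connected nu_gt0).
have base k' := alternating_longest_class nu_gt0 nuK lR z0 zE (k := k').
(* A colour class may be empty, in rank 1; an empty block is then put before the word that starts
   with the other colour. *)
case e : (color_class k) => [|i c]; last by apply: base; rewrite e.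
have [|l [asc lo]] := base (~~ k); last by exists l.+1; rewrite [alternating k _]/= e.
apply/negP => /eqP e'; have := ltn_ord (Ordinal (rank_gt0 irrPhi)).
have : Ordinal (rank_gt0 irrPhi) \in color_class (col (Ordinal (rank_gt0 irrPhi))).
  by rewrite mem_filter eqxx mem_enum.
by case: (col _) (k) e e' => [] [] /= e e'; rewrite ?e ?e'.
Qed.

(** * The full twist and its centrality *)

Let hcomm := hecke_word_comm s_in (simple_eltK simpleDelta weylW)
  (descent_simpleM simpleDelta weylW)
  (@descent_commute _ _ _ _ _ _ simpleDelta weylW)
  (@descent_conj _ _ _ _ _ _ simpleDelta weylW).

Lemma descent1 i : ~~ descent i 1%g.
Proof.
rewrite /right_descent invg1 repr_mx1 mulmx1 (height_simple simpleDelta).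
by rewrite lt_gtF ?ltr01.
Qed.

(** Takes the place of Matsumoto's theorem: both operators send [e 1] to [e w0], which determines
    them. *)
Lemma longest_word_eq (R : comNzRingType) (q : R) u v :
  ascending 1 u -> ascending 1 v ->
  longest (word_prod u) -> longest (word_prod v) -> hecke_word q u = hecke_word q v.
Proof.
move=> au av lu lv; apply: (hecke_word_eq s_in (simple_eltK simpleDelta weylW)
  (descent_simpleM simpleDelta weylW)
  (@descent_commute _ _ _ _ _ _ simpleDelta weylW)
  (@descent_conj _ _ _ _ _ _ simpleDelta weylW)).
  exact: (left_ascent_ind simpleDelta weylW).
rewrite !ascending_hecke // !mul1g; congr hecke_basis.
exact: (longest_uniq simpleDelta weylW).
Qed.

(** Moving a generator past T_{w0} replaces i by its partner j under conjugation by w0. As w0 is an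
    involution, moving it past a second time restores i. *)
Lemma longest_word_central (R : comNzRingType) (q : R) u i :
  ascending 1 u -> longest (word_prod u) ->
  comm_mx (hecke_word q u *m hecke_word q u) (hecke_right W s descent q i).
Proof.
move=> au lu; set X := hecke_word q u.
have eX : hecke_basis W R 1 *m X = hecke_basis W R (word_prod u).
  by rewrite ascending_hecke // mul1g.
have swap j k : (s j * word_prod u)%g = (word_prod u * s k)%g ->
    hecke_right W s descent q j *m X = X *m hecke_right W s descent q k.
  move=> e; apply: (hecke_longest_central s_in (simple_eltK simpleDelta weylW)
    (descent_simpleM simpleDelta weylW)
    (@descent_commute _ _ _ _ _ _ simpleDelta weylW)
    (@descent_conj _ _ _ _ _ _ simpleDelta weylW)
    (left_ascent_ind simpleDelta weylW) _ (word_in u) eX e (descent1 j)).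
  exact: hcomm.
have [j e] := longest_swap simpleDelta weylW i (word_in u) lu.
have wV : ((word_prod u)^-1 = word_prod u)%g.
  apply: (longest_uniq simpleDelta weylW) => //; rewrite ?groupV //.
  exact: (longestV simpleDelta weylW).
have e' : (s j * word_prod u)%g = (word_prod u * s i)%g.
  move/(congr1 invg): e; rewrite !invMg !wV !(simple_eltV simpleDelta weylW) => ->.
  by [].
by rewrite /comm_mx -mulmxA -(swap _ _ e') mulmxA -(swap _ _ e) mulmxA.
Qed.

Lemma alternatingD k a b :
  alternating k (a + b) = alternating k a ++ alternating (k (+) odd a) b.
Proof.
elim: a k => [|a IH] k /=; first by rewrite addbF.
by rewrite IH catA; congr (_ ++ alternating _ _); rewrite addbN addNb.
Qed.

Lemma alternating_double k m :
  alternating k m.*2 = flatten (nseq m (color_class k ++ color_class (~~ k))).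
Proof. by elim: m => //= m IH; rewrite negbK IH catA. Qed.

Lemma perm_color_classes k : perm_eq (color_class k ++ color_class (~~ k)) (enum 'I_n).
Proof.
rewrite perm_sym -(seq.permPl (permEl (perm_filterC (fun i => col i == k) _))) perm_cat2l.
by rewrite (eq_filter (a2 := fun i => col i == ~~ k)) // => i /=; case: (col i); case: (k).
Qed.

Lemma hecke_word_exp (R : comNzRingType) (q : R) u m :
  hecke_word q (flatten (nseq m u)) = hecke_word q u ^+ m.
Proof. by elim: m => //= m IH; rewrite hecke_word_cat IH exprS. Qed.

Lemma longest_word_size u : ascending 1 u -> longest (word_prod u) ->
  size u = size (positive_roots Phi Delta).
Proof.
move=> au /(longestP simpleDelta weylW (word_in u)) <-.
by have := ascending_len (group1 W) au; rewrite mul1g (len1 Phi Delta rW).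
Qed.

Theorem Coxeter_full_twist : exists u m v,
  [/\ perm_eq u (enum 'I_n), (0 < m)%N /\ (m * n = 2 * size (positive_roots Phi Delta))%N,
      ascending 1 v, longest (word_prod v) &
      forall (R : comNzRingType) (q : R),
        hecke_word q u ^+ m = hecke_word q v *m hecke_word q v].
Proof.
have [l1 [a1 o1]] := alternating_longest true.
have [l2 [a2 o2]] := alternating_longest false.
suff main k m va vb : (0 < m)%N -> alternating k m.*2 = va ++ vb ->
    ascending 1 va -> longest (word_prod va) -> ascending 1 vb -> longest (word_prod vb) ->
    exists u m v,
  [/\ perm_eq u (enum 'I_n), (0 < m)%N /\ (m * n = 2 * size (positive_roots Phi Delta))%N,
      ascending 1 v, longest (word_prod v) &
      forall (R : comNzRingType) (q : R),
        hecke_word q u ^+ m = hecke_word q v *m hecke_word q v].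
  (* With an even number of blocks, a longest word can be repeated and the colours still alternate.
     If both counts are odd, the longest word that starts with [true] is followed by the one that
     starts with [false]. *)
  have [d1|d1] := boolP (odd l1.+1); last first.
    apply: (main true l1.+1 _ _ _ _ a1 o1 a1 o1) => //.
    by rewrite -addnn alternatingD (negPf d1) addbF.
  have [d2|d2] := boolP (odd l2.+1); last first.
    apply: (main false l2.+1 _ _ _ _ a2 o2 a2 o2) => //.
    by rewrite -addnn alternatingD (negPf d2) addbF.
  apply: (main true (l1.+1 + l2.+1)./2 _ _ _ _ a1 o1 a2 o2).
    by rewrite half_gt0 addSn addnS.
  by rewrite even_halfK ?oddD ?d1 ?d2 // alternatingD d1.
move=> m0 e av lv ab lb; exists (color_class k ++ color_class (~~ k)), m, va.
split=> //; first exact: perm_color_classes.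
  split=> //; move/(congr1 size): e; rewrite alternating_double size_cat size_flatten.
  rewrite !longest_word_size // mul2n addnn /shape map_nseq sumn_nseq mulnC.
  by rewrite (perm_size (perm_color_classes k)) size_enum_ord mulnC.
move=> R q; rewrite -hecke_word_exp -alternating_double e hecke_word_cat.
by congr (_ *m _); apply: longest_word_eq.
Qed.

End Alternating.

(** * Eigenvalues of a deformed Coxeter element *)

Section Triangular.
Variable C : numClosedFieldType.

Lemma trig_mul n (S T : 'M[C]_n) : is_trig_mx S -> is_trig_mx T ->
  is_trig_mx (S *m T) /\ forall i, (S *m T) i i = S i i * T i i.
Proof.
move=> /is_trig_mxP tS /is_trig_mxP tT; split.
  apply/is_trig_mxP => i j ij; rewrite mxE big1 // => k _.
  have [ik|ki] := ltnP i k; first by rewrite tS ?mul0r.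
  by rewrite tT ?mulr0 //; apply: leq_ltn_trans ki ij.
move=> i; rewrite mxE (bigD1 i) //= big1 ?addr0 // => k ki.
have [ik|ik] := ltnP i k; first by rewrite tS ?mul0r.
by rewrite tT ?mulr0 // ltn_neqAle ki.
Qed.

Lemma trig_exp n (T : 'M[C]_n) l : is_trig_mx T ->
  is_trig_mx (T ^+ l) /\ forall i, (T ^+ l) i i = T i i ^+ l.
Proof.
move=> tT; elim: l => [|l [IH1 IH2]].
  by rewrite expr0; split=> [|i]; [apply: scalar_mx_is_trig|rewrite mxE eqxx expr0].
have [h1 h2] := trig_mul tT IH1.
by rewrite exprS; split=> // i; rewrite h2 IH2 exprS.
Qed.

Lemma eigenvalue_list n (A : 'M[C]_n) : (0 < n)%N -> exists x : 'I_n -> C,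
  [/\ forall i, eigenvalue A (x i), \det A = \prod_i x i &
      forall l, \tr (A ^+ l) = \sum_i x i ^+ l].
Proof.
move=> n0; have [P Pu] := Schur A n0.
have Pun := unitarymx_unit Pu.
rewrite /similar_to /= conjumx //; set T := P *m A *m _ => tT.
have AE : A = invmx P *m T *m P by rewrite /T -!mulmxA mulVmx // mulmx1 mulKmx.
clearbody T; have powE l : A ^+ l = invmx P *m T ^+ l *m P.
  elim: l => [|l IH]; first by rewrite !expr0 mulmx1 mulVmx.
  by rewrite !exprS IH {1}AE -!mulmxE -!mulmxA mulKVmx.
exists (fun i => T i i); split=> [i||l].
- rewrite /eigenvalue kermx_eq0 row_free_unit unitmxE unitfE negbK.
  have -> : A - (T i i)%:M = invmx P *m (T - (T i i)%:M) *m P.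
    by rewrite mulmxBr mulmxBl -AE scalar_mxC -mulmxA mulVmx // mulmx1.
  rewrite !det_mulmx [X in _ * X * _]det_trig.
    by rewrite (bigD1 i) //= !mxE eqxx subrr mul0r mulr0 mul0r.
  apply/is_trig_mxP => a b ab; rewrite !mxE (is_trig_mxP tT _ _ ab) sub0r.
  by rewrite -val_eqE ltn_eqF // mulr0n oppr0.
- by rewrite AE !det_mulmx (det_trig tT) mulrC mulrA -det_mulmx mulmxV // det1 mul1r.
rewrite powE mxtrace_mulC mulmxA mulmxV // mul1mx; apply: eq_bigr => i _.
by case: (trig_exp l tT).
Qed.

(** The relation leaves only the eigenvalues q and -1. *)
Lemma det_quadratic d (X : 'M[C]_d) (q : C) :
  X * X = (q - 1) *: X + q%:M -> exists b a, (a <= d)%N /\ \det X = (-1) ^+ b * q ^+ a.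
Proof.
move=> hX; have [d0|d0] := posnP d.
  by exists 0%N, 0%N; move: X {hX}; rewrite d0 => X; rewrite det_mx00 !expr0 mulr1.
have [x [eig -> _]] := eigenvalue_list X d0.
have root_x i : x i = q \/ x i = -1.
  have /eigenvalueP[v vX nz] := eig i.
  have : (x i - q) * (x i + 1) *: v = 0.
    have : v *m (X * X) = v *m ((q - 1) *: X + q%:M) by rewrite hX.
    rewrite -mulmxE mulmxA vX -scalemxAl vX mulmxDr -scalemxAr vX mul_mx_scalar.
    move/eqP; rewrite -subr_eq0 !scalerA -scalerDl -scalerBl => /eqP h.
    by rewrite -[RHS]h; congr (_ *: _); ring.
  move/eqP; rewrite scaler_eq0 (negPf nz) orbF mulf_eq0 subr_eq0 addr_eq0.
  by case/orP=> /eqP; [left|right].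
exists #|[set i | x i != q]|, #|[set i | x i == q]|; split.
  by rewrite -[leqRHS]card_ord max_card.
rewrite (bigID (fun i => x i == q)) /= mulrC; congr (_ * _).
  rewrite (eq_bigr (fun=> -1)) => [|i ne]; last by case: (root_x i) ne => ->; rewrite ?eqxx.
  by rewrite prodr_const; congr (_ ^+ _); apply: eq_card => i; rewrite !inE.
rewrite (eq_bigr (fun=> q)) => [|i /eqP //].
by rewrite prodr_const; congr (_ ^+ _); apply: eq_card => i; rewrite !inE.
Qed.

(* On an eigenspace of the central product Z, the determinant of Z is both a
   power of its eigenvalue and a product of determinants of its factors. *)
Lemma central_eigenvalue N (As : seq 'M[C]_N) (q z : C) :
  {in As, forall X : 'M[C]_N, X * X = (q - 1) *: X + q%:M} ->
  {in As, forall X : 'M[C]_N, comm_mx (\prod_(X <- As) X) X} ->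
  eigenvalue (\prod_(X <- As) X) z ->
  exists d b a, [/\ (0 < d <= N)%N, (a <= d * size As)%N & z ^+ d = (-1) ^+ b * q ^+ a].
Proof.
move=> quad; set Z := \prod_(X <- As) X => comm eig.
pose V := eigenspace Z z; pose d := \rank V.
have d0 : (0 < d)%N by rewrite lt0n mxrank_eq0.
have stab X : X \in As -> stablemx V X by move=> /comm cX; apply: comm_mx_stable_eigenspace.
pose r X := conjmx (row_base V) X.
have rM X Y : stablemx V X -> stablemx V Y -> r (X * Y) = r X *m r Y.
  by move=> sX sY; rewrite /r -mulmxE conjmxM // inE stablemx_row_base.
have key (Bs : seq 'M[C]_N) : {subset Bs <= As} ->
    stablemx V (\prod_(X <- Bs) X) /\
    exists b a, (a <= d * size Bs)%N /\ \det (r (\prod_(X <- Bs) X)) = (-1) ^+ b * q ^+ a.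
  elim: Bs => [|X Bs IH] sub.
    rewrite big_nil; split; first by rewrite mulmx1.
    exists 0%N, 0%N; split=> //.
    by rewrite /r conjmx_scalar ?row_base_free // det1 !expr0 mulr1.
  have [|sB [b [a [le e]]]] := IH; first by move=> Y YB; apply: sub; rewrite inE YB orbT.
  have XA : X \in As by apply: sub; rewrite inE eqxx.
  rewrite big_cons; split; first by rewrite -mulmxE mulmxA (submx_trans (submxMr _ (stab X XA))).
  have [|b' [a' [le' e']]] := @det_quadratic d (r X) q.
    rewrite -mulmxE -rM ?stab // quad // /r /conjmx mulmxDr mulmxDl -scalemxAr -scalemxAl.
    by congr (_ + _); rewrite -/(conjmx _ _) conjmx_scalar ?row_base_free.
  exists (b' + b)%N, (a' + a)%N; split; first by rewrite /= mulnS leq_add.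
  by rewrite (rM _ _ (stab _ XA) sB) det_mulmx e e' !exprD mulrACA.
have [_ [b [a [le e]]]] := key As (fun _ h => h).
exists d, b, a; split=> //; first by rewrite d0 rank_leq_row.
rewrite -e /r -/Z (_ : conjmx _ _ = z%:M) ?det_scalar //.
by apply: conjmx_eigenvalue; rewrite ?row_base_free // eq_row_base.
Qed.

End Triangular.

Lemma eigenvalue_exp (C : fieldType) n (A : 'M[C]_n) x l :
  eigenvalue A x -> eigenvalue (A ^+ l) (x ^+ l).
Proof.
move=> /eigenvalueP[v vA nz]; apply/eigenvalueP; exists v => //.
elim: l => [|l IH]; first by rewrite !expr0 scale1r mulmx1.
by rewrite !exprS -mulmxE mulmxA vA -scalemxAl IH scalerA.
Qed.

Lemma prod_flatten_nseq (R : pzRingType) (s : seq R) l :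
  \prod_(X <- flatten (nseq l s)) X = (\prod_(X <- s) X) ^+ l.
Proof. by elim: l => [|l IH]; rewrite ?big_nil //= big_cat exprS IH. Qed.

(** Otherwise each pattern stops below some bound, and no pattern is left at the maximum of these
    bounds. *)
Lemma infinite_pigeonhole (T : finType) (P : nat -> T -> Prop) :
  (forall t, exists y, P t y) -> exists y, forall b, exists2 t, (b <= t)%N & P t y.
Proof.
move=> ex; apply: NNPP => no.
have : forall y, exists b, forall t, (b <= t)%N -> ~ P t y.
  move=> y; apply: NNPP => h; apply: no; exists y => b; apply: NNPP => h2; apply: h.
  by exists b => t bt Pty; apply: h2; exists t.
case/fin_all_exists => b hb; have [y Py] := ex (\max_y b y).
exact: hb (leq_bigmax y) Py.
Qed.

Lemma poly_eq_infinite (p r : {poly algC}) :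
  (forall b : nat, exists2 t : nat, (b <= t)%N & p.[t.+1%:R] = r.[t.+1%:R]) -> p = r.
Proof.
move=> h; apply/eqP; rewrite -subr_eq0; apply: contraT => nz.
have [s ps] := closed_field_poly_normal (p - r).
have [t bt e] := h (\sum_(x <- s) Num.bound x)%N.
have : root (p - r) t.+1%:R by rewrite /root hornerD hornerN e subrr.
rewrite ps rootZ ?lead_coef_eq0 // root_prod_XsubC => ts.
have := archi_boundP (ler0n algC t.+1); rewrite ltr_nat ltnNge => /negP[].
by rewrite (leq_trans _ (leqnSn t)) // (leq_trans _ bt) // (big_rem _ ts) leq_addr.
Qed.

(** Applies the linear map sending the monomial of degree i to [F i]; the sums may list exponents
    with repetition. *)
Lemma linear_functional_sum (K L : finType) (V : lmodType algC) (c : K -> algC) (J : K -> nat)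
    (b : L -> algC) (I : L -> nat) (F : nat -> V) :
  \sum_k c k *: 'X^(J k) = \sum_e b e *: 'X^(I e) :> {poly algC} ->
  \sum_k c k *: F (J k) = \sum_e b e *: F (I e).
Proof.
move=> eq; pose D := (\sum_k (J k).+1 + \sum_e (I e).+1)%N.
have gen (M : finType) (d : M -> algC) (Q : M -> nat) : (forall k, Q k < D)%N ->
    \sum_k d k *: F (Q k) = \sum_(i < D) (\sum_k d k *: 'X^(Q k) : {poly algC})`_i *: F i.
  move=> lt; under [RHS]eq_bigr => i _ do rewrite coef_sum scaler_suml.
  rewrite exchange_big; apply: eq_bigr => k _ /=.
  rewrite (bigD1 (Ordinal (lt k))) //= coefZ coefXn eqxx mulr1 big1 ?addr0 // => i ne.
  by rewrite coefZ coefXn (_ : (val i == Q k) = false) ?mulr0 ?scale0r //; apply/negbTE.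
rewrite (gen _ c J) => [|k].
  rewrite (gen _ b I) => [|e]; first by rewrite eq.
  by rewrite /D (bigD1 e) //= addnCA leq_addr.
by rewrite /D (bigD1 k) //= -addnA leq_addr.
Qed.

(** * Eigenvalue patterns uniform in q *)

Section Deformation.

Variables (N m : nat) (As : seq 'M[{poly algC}]_N).
Hypothesis N_gt0 : (0 < N)%N.
Hypothesis m_gt0 : (0 < m)%N.
Let n := size As.
Let T := \prod_(X <- As) X.
Hypothesis quad : {in As, forall X : 'M_N, X * X = ('X - 1) *: X + 'X%:M}.
Hypothesis comm : {in As, forall X : 'M_N, comm_mx (T ^+ m) X}.

Definition ev (t : algC) (X : 'M[{poly algC}]_N) : 'M[algC]_N := map_mx (horner_eval t) X.

Lemma evM t X Y : ev t (X * Y) = ev t X * ev t Y.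
Proof. by rewrite /ev -!mulmxE map_mxM. Qed.

Lemma ev1 t : ev t 1 = 1.
Proof. exact: map_mx1. Qed.

Lemma ev_exp t X l : ev t (X ^+ l) = ev t X ^+ l.
Proof. by elim: l => [|l IH]; rewrite ?ev1 // !exprS evM IH. Qed.

Lemma ev_prod t s : ev t (\prod_(X <- s) X) = \prod_(X <- map (ev t) s) X.
Proof. by elim: s => [|X s IH]; rewrite ?big_nil ?ev1 //= !big_cons evM IH. Qed.

Lemma ev_trace t X : \tr (ev t X) = (\tr X).[t].
Proof. by rewrite /ev trace_map_mx. Qed.

(** [central_eigenvalue] gives x^(m d) = (-1)^b q^a with d <= N: the factor 2 removes the sign, [m]
    the power of T, and the factorial is divisible by every d. *)
Definition uniform_exponent := (2 * m * N`!)%N.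
Local Notation M := uniform_exponent.
Variable w : algC.
Hypothesis w_prim : M.-primitive_root w.

Lemma eigenvalue_shape (t : nat) x : eigenvalue (ev (t.+1%:R ^+ M) T) x ->
  exists p : 'I_M * 'I_(n * M).+1, x = w ^+ p.1 * t.+1%:R ^+ p.2.
Proof.
set q := t.+1%:R ^+ M => eig.
have M0 : (0 < M)%N by rewrite !muln_gt0 m_gt0 fact_gt0.
pose Bs := flatten (nseq m (map (ev q) As)).
have BsE : \prod_(X <- Bs) X = ev q T ^+ m by rewrite prod_flatten_nseq ev_prod.
have memB (P : 'M_N -> Prop) : (forall X, X \in As -> P (ev q X)) -> forall X, X \in Bs -> P X.
  by move=> h X /flattenP[s /nseqP[-> _] /mapP[Y YA ->]]; apply: h.
have [||| d [b [a [/andP[d0 dN] le e]]]] := @central_eigenvalue _ N Bs q (x ^+ m).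
- apply: memB => X XA; rewrite -evM quad // /ev map_mxD map_mxZ map_scalar_mx.
  by rewrite rmorphB rmorph1 /= /horner_eval hornerX.
- apply: memB => X XA; rewrite BsE -ev_exp /comm_mx !mulmxE -!evM.
  by congr (ev q _); apply: comm.
- by rewrite BsE; apply: eigenvalue_exp.
have szB : size Bs = (m * n)%N.
  by rewrite size_flatten /shape map_nseq sumn_nseq size_map mulnC.
rewrite szB -exprM in le e.
have dvd : (d %| N`!)%N by apply: dvdn_fact; rewrite d0.
pose f := (N`! %/ d)%N; have fd : (f * d = N`!)%N by rewrite divnK.
(* Chosen so that x^M = q^J = t^(M J), writing t for the base [t.+1%:R]; then x / t^J is an M-th
   root of unity. The bound on a bounds J, so only finitely many shapes occur. *)
pose J := (2 * a * f)%N.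
have Jle : (J < (n * M).+1)%N.
  rewrite ltnS /J /M -fd.
  apply: (leq_trans (n := 2 * (d * (m * n)) * f)%N); last by apply: eq_leq; lia.
  by apply: leq_mul => //; rewrite leq_mul.
have t0 : (t.+1%:R : algC) != 0 by rewrite pnatr_eq0.
have xM : (x / t.+1%:R ^+ J) ^+ M = 1.
  have xE : x ^+ M = q ^+ J.
    have -> : M = (m * d * (2 * f))%N by rewrite /M -fd; lia.
    rewrite exprM e exprMn -!exprM (mulnCA b) exprM sqrrN !expr1n mul1r.
    by congr (_ ^+ _); rewrite /J; lia.
  by rewrite expr_div_n xE /q -!exprM mulnC divff // expf_neq0.
have [i iE] := prim_rootP w_prim xM.
by exists (i, Ordinal Jle); rewrite /= -iE divfK // expf_neq0.
Qed.

(** Each integer has some pattern valid for all l at once. One of the finitely many patterns recurs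
    at arbitrarily large integers, where two polynomials can agree only if they are equal. *)
Lemma uniform_eigenvalues : exists y : {ffun 'I_N -> 'I_M * 'I_(n * M).+1},
  forall l, (\tr (T ^+ l)) \Po 'X^M = \sum_k (w ^+ (y k).1) ^+ l *: 'X^((y k).2 * l).
Proof.
have M0 : (0 < M)%N by rewrite !muln_gt0 m_gt0 fact_gt0.
have [|y hy] := @infinite_pigeonhole {ffun 'I_N -> 'I_M * 'I_(n * M).+1}
  (fun t y => forall l, \tr (ev (t.+1%:R ^+ M) T ^+ l) =
     \sum_k (w ^+ (y k).1 * t.+1%:R ^+ (y k).2) ^+ l).
  move=> t; have [x [eig _ tr]] := eigenvalue_list (ev (t.+1%:R ^+ M) T) N_gt0.
  have /fin_all_exists[y hy] := fun k => eigenvalue_shape (eig k).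
  by exists (finfun y) => l; rewrite tr; apply: eq_bigr => k _; rewrite ffunE hy.
exists y => l; apply: poly_eq_infinite => b; have [t bt h] := hy b.
exists t => //; rewrite horner_comp hornerXn -ev_trace ev_exp h horner_sum.
by apply: eq_bigr => k _; rewrite hornerZ hornerXn exprMn (exprM _ (y k).2).
Qed.

Variable B : 'M[{poly algC}]_N.
Hypothesis trT : \tr T = ('X - 1) ^+ n.
Hypothesis TmE : T ^+ m = 1%:M + ('X - 1) *: B.

Lemma trace_deformed (c : {poly algC}) l :
  \tr (T * (T ^+ m - c%:M) ^+ l) =
  \sum_(i < n.+1) ((-1) ^+ i * 'C(n, i)%:R)%:P * 'X^(n - i) * ('X^(m * (n - i)) - c) ^+ l.
Proof.
have M0 : (0 < M)%N by rewrite !muln_gt0 m_gt0 fact_gt0.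
have [y hy] := uniform_eigenvalues.
pose z k : algC := w ^+ (y k).1.
(* At q = 1 the trace of T^m is N, which is also the sum of these N numbers of modulus 1; hence each
   of them is 1. *)
have zm k : z k ^+ m = 1.
  have unit_z i : `|z i ^+ m| = 1.
    apply/eqP; rewrite -(pexpr_eq1 M0 (normr_ge0 _)) -normrX /z -!exprM mulnC exprM.
    by rewrite (prim_expr_order w_prim) expr1n normr1.
  have sum1 : \sum_k z k ^+ m = \sum_(k < N) (1 : algC).
    have := congr1 (fun p : {poly algC} => p.[1]) (hy m).
    rewrite horner_comp hornerXn expr1n -ev_trace ev_exp.
    have -> : ev 1 T ^+ m = 1.
      rewrite -ev_exp TmE /ev map_mxD map_mxZ map_mx1 /=.
      have -> : horner_eval (1 : algC) ('X - 1) = 0 by rewrite /horner_eval !hornerE subrr.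
      by rewrite scale0r addr0.
    rewrite mxtrace1 sumr_const card_ord => ->; rewrite horner_sum.
    by apply: eq_bigr => j _; rewrite hornerZ hornerXn expr1n mulr1.
  apply: (normC_sum_upper (P := predT) (F := fun k => z k ^+ m) (G := fun=> 1)) => // i _.
  by rewrite unit_z.
have inj (p r : {poly algC}) : p \Po 'X^M = r \Po 'X^M -> p = r.
  move=> e; apply/eqP; rewrite -subr_eq0; apply: contraT => nz.
  have : (p - r) \Po 'X^M == 0 by rewrite comp_polyB e subrr.
  by rewrite comp_poly_eq0 ?size_polyXn // (negPf nz).
apply: inj; set c' := c \Po 'X^M.
have expand : \tr (T * (T ^+ m - c%:M) ^+ l) =
    \sum_(i < l.+1) (- c) ^+ (l - i) * (\tr (T ^+ (1 + m * i)) *+ 'C(l, i)).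
  have -> : (T ^+ m - c%:M) ^+ l = \sum_(i < l.+1) ((- c) ^+ (l - i) *: T ^+ (m * i)) *+ 'C(l, i).
    rewrite addrC exprDn_comm; last first.
      by rewrite /GRing.comm -!mulmxE -scaleN1r -scalemxAr -scalemxAl scalar_mxC.
    apply: eq_bigr => i _; congr (_ *+ _); rewrite -exprM -raddfN /=.
    by rewrite -rmorphXn -mulmxE mul_scalar_mx.
  rewrite mulr_sumr raddf_sum; apply: eq_bigr => i _ /=.
  by rewrite !mulrnAr raddfMn /= -mulmxE -scalemxAr mxtraceZ mulmxE -exprS add1n.
have -> : \tr (T * (T ^+ m - c%:M) ^+ l) \Po 'X^M =
    \sum_k z k *: ('X^((y k).2 : nat) * ('X^(m * (y k).2) - c') ^+ l).
  rewrite expand rmorph_sum /=.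
  transitivity (\sum_(i < l.+1) \sum_k z k *: ('X^((y k).2 : nat) *
      (((- c') ^+ (l - i) * 'X^(m * (y k).2) ^+ i) *+ 'C(l, i)))).
    apply: eq_bigr => i _; rewrite rmorphM rmorphMn rmorphXn rmorphN /= hy -/c'.
    rewrite mulrnAr -mulrnAl mulr_sumr; apply: eq_bigr => k _.
    rewrite -/(z k) exprD exprM zm expr1n mulr1 expr1 -scalerAr; congr (_ *: _).
    have -> : ((y k).2 * (1 + m * i) = (y k).2 + (m * (y k).2) * i)%N by lia.
    by rewrite exprD exprM mulrnAl mulrnAr mulrCA.
  rewrite exchange_big; apply: eq_bigr => k _ /=.
  rewrite -scaler_sumr -mulr_sumr; congr (_ *: (_ * _)).
  by rewrite addrC exprDn.
(* Since z^(1 + m i) = z, the trace depends on the pattern only through the sum of the z X^J, which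
   is Tr T with X^M in place of X and thus known from [trT]. *)
have main := linear_functional_sum (fun J => 'X^J * ('X^(m * J) - c') ^+ l)
  (c := z) (J := fun k => (y k).2) (b := fun i : 'I_n.+1 => (-1) ^+ i * 'C(n, i)%:R)
  (I := fun i : 'I_n.+1 => (M * (n - i))%N).
rewrite main.
  rewrite rmorph_sum; apply: eq_bigr => i _ /=.
  rewrite -mulrA mul_polyC linearZ /=; congr (_ *: _).
  rewrite rmorphM /= comp_Xn_poly rmorphXn /= rmorphB /= comp_Xn_poly -!exprM -/c'.
  by rewrite mulnCA.
have := hy 1%N; rewrite expr1 trT rmorphXn rmorphB rmorph1 /= comp_polyX exprBn => e.
rewrite (eq_bigr (fun k => w ^+ (y k).1 ^+ 1 *: 'X^((y k).2 * 1))) => [|k _]; last first.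
  by rewrite expr1 muln1.
rewrite -e; apply: eq_bigr => i _.
rewrite expr1n mulr1 -exprM -mul_polyC rmorphM rmorphXn rmorphN rmorph1 rmorph_nat /=.
by rewrite -mulr_natr mulrAC.
Qed.

End Deformation.

Theorem trace_at_one (N m : nat) (As : seq 'M[{poly algC}]_N) (B : 'M[{poly algC}]_N)
    (T := \prod_(X <- As) X) (n := size As) :
  (0 < N)%N -> (0 < m)%N ->
  {in As, forall X : 'M_N, X * X = ('X - 1) *: X + 'X%:M} ->
  {in As, forall X : 'M_N, comm_mx (T ^+ m) X} ->
  \tr T = ('X - 1) ^+ n -> T ^+ m = 1%:M + ('X - 1) *: B ->
  forall (a : algC) l, \tr (ev 1 T * (ev 1 B - a%:M) ^+ l) =
    \sum_(i < n.+1) (-1) ^+ i * 'C(n, i)%:R * ((m * (n - i))%:R - a) ^+ l.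
Proof.
move=> N0 m0 quad comm trT TmE a l.
have M0 : (0 < uniform_exponent N m)%N by rewrite !muln_gt0 m0 fact_gt0.
have [w w_prim] := C_prim_root_exists M0.
(* With this c, both T^m - c and the X^k - c are divisible by X - 1, so (X - 1)^l cancels before
   setting X = 1. *)
pose c : {poly algC} := 1 + ('X - 1) * a%:P.
have := trace_deformed N0 m0 quad comm w_prim trT TmE c l.
have nzX : ('X - 1 : {poly algC}) ^+ l != 0 by rewrite expf_neq0 // polyXsubC_eq0.
have -> : T ^+ m - c%:M = ('X - 1) *: (B - a%:P%:M).
  rewrite TmE /c raddfD /= opprD addrACA subrr add0r scalerBr; congr (_ - _).
  by rewrite scale_scalar_mx.
have -> : (('X - 1) *: (B - a%:P%:M)) ^+ l = ('X - 1) ^+ l *: (B - a%:P%:M) ^+ l.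
  elim: l {nzX} => [|l IH]; first by rewrite !expr0 scale1r.
  by rewrite !exprS IH -!mulmxE -scalemxAl -scalemxAr scalerA.
rewrite -mulmxE -scalemxAr mxtraceZ.
have E k : 'X^k - c = ('X - 1) * (\sum_(j < k) 'X^j - a%:P) :> {poly algC}.
  by rewrite /c opprD addrA subrX1 mulrBr.
rewrite (eq_bigr (fun i : 'I_n.+1 => ('X - 1) ^+ l *
    (((-1) ^+ i * 'C(n, i)%:R)%:P * 'X^(n - i) * (\sum_(j < m * (n - i)) 'X^j - a%:P) ^+ l))).
  rewrite -mulr_sumr => /(mulfI nzX)/(congr1 (fun p : {poly algC} => p.[1])).
  rewrite -ev_trace mulmxE evM ev_exp.
  have -> : ev 1 (B - a%:P%:M) = ev 1 B - a%:M.
    rewrite /ev map_mxB map_scalar_mx; congr (_ - _%:M).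
    by rewrite /= /horner_eval hornerC.
  move=> ->; rewrite horner_sum; apply: eq_bigr => i _.
  rewrite !hornerM hornerC hornerXn expr1n mulr1 horner_exp hornerD hornerN hornerC horner_sum.
  congr (_ * (_ - _) ^+ _).
  under eq_bigr => j _ do rewrite hornerXn expr1n.
  by rewrite sumr_const card_ord.
by move=> i _; rewrite E exprMn mulrCA.
Qed.

(** * Exterior powers *)

Lemma card_extIndex i n : #|extIndex i n| = 'C(n, i).
Proof.
apply/eqP; rewrite -(eqn_pmul2r (fact_gt0 i)) bin_ffact.
have -> : (#|extIndex i n| * i`!)%N = #|[set: extIndex i n * 'S_i]|.
  by rewrite cardsT card_prod card_Sn.
have := card_inj_ffuns 'I_i 'I_n; rewrite !card_ord => <-.
rewrite -(card_imset _ (@ext_perm_inj i n)); apply/eqP/eq_card => phi; rewrite inE.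
apply/imsetP/injectiveP => [[[f s] _ ->] a b|inj].
  by rewrite !ffunE /= => /extIndex_inj; apply: perm_inj.
by have [p ->] := ext_perm_surj inj; exists p; rewrite ?inE.
Qed.

Section RankOneUpdate.

Variable R : comNzRingType.

Lemma det_col_mx_linear i (A : 'M[R]_(i, 1 + i)) b c (x y : 'rV[R]_(1 + i)) :
  \det (col_mx (b *: x + c *: y) A : 'M_(1 + i)) =
  b * \det (col_mx x A : 'M_(1 + i)) + c * \det (col_mx y A : 'M_(1 + i)).
Proof.
apply: (@determinant_multilinear _ _ _ _ _ (lshift i 0)).
- by rewrite !rowKu !row_id.
- by rewrite !row'Ku; congr (@col_mx _ 0 _ _ _ _); rewrite [LHS]flatmx0 [RHS]flatmx0.
by rewrite !row'Ku; congr (@col_mx _ 0 _ _ _ _); rewrite [LHS]flatmx0 [RHS]flatmx0.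
Qed.

(** This is -v adj(M) u, in a form whose linearity in v and u is that of determinants in a row and a
    column. *)
Definition bordered_det i (M : 'M[R]_i) (v : 'rV[R]_i) (u : 'cV[R]_i) : R :=
  \det (block_mx (0 : 'M_1) v u M).

Lemma bordered_det_tr i (M : 'M[R]_i) v u :
  bordered_det M v u = bordered_det M^T u^T v^T.
Proof. by rewrite /bordered_det -det_tr tr_block_mx trmx0. Qed.

Lemma bordered_det_linear i (M : 'M[R]_i) u b c x y :
  bordered_det M (b *: x + c *: y) u = b * bordered_det M x u + c * bordered_det M y u.
Proof.
rewrite /bordered_det /block_mx -det_col_mx_linear.
by rewrite !scale_row_mx add_row_mx !scaler0 addr0.
Qed.

Lemma bordered_det_sum i (M : 'M[R]_i) u (J : finType) (c : J -> R) (x : J -> 'rV[R]_i) :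
  bordered_det M (\sum_j c j *: x j) u = \sum_j c j * bordered_det M (x j) u.
Proof.
apply: (big_rec2 (fun w d => bordered_det M w u = d)) => [|j w d _ IH].
  by have := bordered_det_linear M u 0 0 0 0; rewrite !scale0r addr0 !mul0r addr0.
by have := bordered_det_linear M u (c j) 1 (x j) w; rewrite scale1r mul1r IH => ->.
Qed.

(** Eliminating the border of the block matrix with corner 1 leaves M - u v; splitting its first row
    as (1, 0) + (0, v) gives the two terms. *)
Lemma det_rank_one_update i (M : 'M[R]_i) (v : 'rV[R]_i) (u : 'cV[R]_i) :
  \det (M - u *m v) = \det M + bordered_det M v u.
Proof.
have e : block_mx (1%:M : 'M_1) 0 (- u) 1%:M *m block_mx 1%:M v u M =
         block_mx 1%:M v 0 (M - u *m v).
  rewrite mulmx_block !mul1mx !mulmx1 !mul0mx !addr0 mulNmx (addrC (- u)) subrr.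
  by rewrite (addrC _ M).
have := congr1 (@determinant _ _) e.
rewrite det_mulmx det_lblock !det1 !mul1r det_ublock det1 mul1r => <-.
have := det_col_mx_linear (row_mx u M) 1 1 (row_mx 1%:M 0) (row_mx 0 v).
rewrite !scale1r !mul1r add_row_mx addr0 add0r => h.
by rewrite -[LHS]/(\det (col_mx (row_mx 1%:M v) (row_mx u M) : 'M_(1 + i))) h
  -[X in X + _]/(\det (block_mx (1%:M : 'M_1) 0 u M)) det_lblock det1 mul1r.
Qed.

(* The variation of a minor under a rank one perturbation u v is bilinear in
   (u, v), so only the sum of the perturbations matters. *)
Lemma sum_extpow_rank_one i n (J : Type) (r : seq J) (u : J -> 'cV[R]_n)
    (v : J -> 'rV[R]_n) h :
  \sum_(k <- r) u k *m v k = h%:M ->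
  \sum_(k <- r) extpow_mx i (1%:M - u k *m v k) = ((size r)%:R - h * i%:R)%:M.
Proof.
move=> sum_uv; apply/matrixP => p q; rewrite summxE.
set f := val (enum_val p); set g := val (enum_val q).
pose D : 'M[R]_i := mxsub f g 1%:M.
have entry (w : 'cV[R]_n) (x : 'rV[R]_n) :
    \det (mxsub f g (1%:M - w *m x)) = \det D + bordered_det D (colsub g x) (rowsub f w).
  rewrite -det_rank_one_update; congr (\det _); apply/matrixP => a b; rewrite !mxE.
  by congr (_ - _); apply: eq_bigr => l _; rewrite !mxE.
pose K a b := bordered_det D (colsub g (delta_mx 0 b)) (rowsub f (delta_mx a 0)).
have bil (w : 'cV[R]_n) (x : 'rV[R]_n) :
    bordered_det D (colsub g x) (rowsub f w) = \sum_b \sum_a (w *m x) a b * K a b.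
  have ex : colsub g x = \sum_b x 0 b *: colsub g (delta_mx 0 b).
    by rewrite {1}[x]row_sum_delta raddf_sum; apply: eq_bigr => b _; rewrite /= linearZ.
  rewrite ex bordered_det_sum; apply: eq_bigr => b _.
  rewrite bordered_det_tr.
  have ew : (rowsub f w)^T = \sum_a w a 0 *: (rowsub f (delta_mx a 0))^T.
    apply/rowP => k; rewrite summxE !mxE (bigD1 (f k)) //= !mxE !eqxx mulr1 big1 ?addr0 // => a ne.
    by rewrite !mxE eq_sym (negPf ne) mulr0.
  rewrite ew bordered_det_sum mulr_sumr; apply: eq_bigr => a _.
  by rewrite -bordered_det_tr /K mulrA mxE big_ord1 (mulrC (x 0 b)).
(* The coefficients needed are found by applying [entry] to the perturbation [delta_mx a a]
   itself. *)
have diag a : K a a = \det (mxsub f g (1%:M - delta_mx a a)) - \det D.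
  by rewrite -(mul_delta_mx (0 : 'I_1)) entry addrC addKr.
transitivity ((size r)%:R * \det D + h * \sum_a K a a).
  under eq_bigr => k _ do rewrite mxE -/f -/g entry bil.
  rewrite big_split /= big_const_seq count_predT iter_addr_0 mulr_natl; congr (_ + _).
  rewrite exchange_big mulr_sumr; apply: eq_bigr => b _ /=.
  rewrite exchange_big (bigD1 b) //= -mulr_suml -summxE sum_uv mxE eqxx mulr1n.
  rewrite big1 ?addr0 // => a ne; rewrite -mulr_suml -summxE sum_uv mxE (negPf ne) mul0r //.
have extD : \det D = (p == q)%:R.
  by have := congr1 (fun X : 'M_#|extIndex i n| => X p q) (extpow_mx1 R i n); rewrite !mxE.
rewrite !mxE extD; have [eqpq|ne] := eqVneq p q; last first.
  rewrite mulr0 add0r mulr0n big1 ?mulr0 // => a _; rewrite diag extD (negPf ne) subr0.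
  have /existsP[k /forallP kP] : [exists k, forall l, f k != g l].
    apply: contraR ne => /existsPn noP.
    apply/eqP/enum_val_inj/extIndex_sub => k.
    by have /forallPn[l /negPn/eqP eq_kl] := noP k; exists l.
  rewrite (expand_det_row _ k) big1 // => l _.
  rewrite !mxE (negPf (kP l)) sub0r (_ : _ && _ = false) ?oppr0 ?mul0r //.
  by apply: contraNF (kP l) => /andP[/eqP-> /eqP->].
have fg : f = g by rewrite /f eqpq.
have finj : injective f by apply: extIndex_inj.
have diagE a : K a a = - (a \in codom f)%:R.
  rewrite diag extD eqpq eqxx.
  rewrite [mxsub _ _ _](_ : _ = diag_mx (\row_k (f k != a)%:R)); last first.
    apply/matrixP => k l; rewrite -fg !mxE (inj_eq finj).
    have [->|kl] := eqVneq k l; first by rewrite andbb; case: eqP; rewrite ?subrr ?subr0.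
    rewrite mulr0n sub0r (_ : _ && _ = false) ?oppr0 //.
    by apply: contraNF kl => /andP[/eqP fa /eqP la]; apply/eqP/finj; rewrite fa.
  rewrite det_diag; case: (codomP) => [[k ek]|nf].
    by rewrite (bigD1 k) //= mxE ek eqxx mul0r sub0r.
  rewrite big1 ?subrr ?oppr0 // => k _; rewrite mxE; case: eqP => // ek.
  by case: nf; exists k.
rewrite (eq_bigr _ (fun a _ => diagE a)) sumrN mulr1 mulrN mulr1n; congr (_ - _ * _).
rewrite -natr_sum -[in RHS](card_ord i) -(card_codom finj) -sum1_card; congr (_%:R).
by rewrite [RHS]big_mkcond.
Qed.

End RankOneUpdate.

(** * Factorizations *)

Section Counting.

Variables (gT : finGroupType) (W : {group gT}).
Variable S : {set gT}.
Hypothesis SW : S \subset W.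

Lemma factorization_count0 c : factorization_count S c 0 = (c == 1%g).
Proof.
rewrite /factorization_count eq_sym.
have [<-|ne] := eqVneq 1%g c.
  rewrite (eq_card (B := [set [tuple]])) ?cards1 // => t.
  by rewrite !inE [t]tuple0 /= big_nil !eqxx.
rewrite (eq_card0 (A := _)) // => t.
by rewrite !inE [t]tuple0 /= big_nil (negPf ne).
Qed.

Lemma factorization_countS c l :
  factorization_count S c l.+1 = \sum_(r in S) factorization_count S (r^-1 * c)%g l.
Proof.
rewrite /factorization_count -sum1_card.
have cons_bij : bijective (fun p : gT * l.-tuple gT => [tuple of p.1 :: p.2]).
  exists (fun t : l.+1.-tuple gT => (thead t, [tuple of behead t])) => [[r t]|t] /=.
    by congr (_, _); apply: val_inj.
  by rewrite [RHS]tuple_eta.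
rewrite (reindex _ (onW_bij _ cons_bij)) /= (eq_bigl (fun p : gT * l.-tuple gT => (p.1 \in S) &&
    (p.2 \in [set t : l.-tuple gT | all (mem S) t && (\prod_(r <- t) r == p.1^-1 * c)%g]))).
  rewrite -(pair_big_dep (mem S) (fun r (t : l.-tuple gT) =>
    t \in [set t : l.-tuple gT | all (mem S) t && (\prod_(r <- t) r == r^-1 * c)%g]) (fun _ _ => 1%N)) /=.
  by apply: eq_bigr => r _; rewrite sum1_card.
move=> [r t]; rewrite !inE /= big_cons -andbA; congr (_ && (_ && _)).
by rewrite -(inj_eq (mulgI r^-1%g)) mulKg.
Qed.

Lemma repr_sum_exp (F : fieldType) N (rG : mx_representation F W N) l :
  (\sum_(r in S) rG r) ^+ l = \sum_(w in W) (factorization_count S w l)%:R *: rG w.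
Proof.
elim: l => [|l IH].
  rewrite expr0 (bigD1 1%g) ?group1 //= factorization_count0 eqxx scale1r repr_mx1.
  by rewrite big1 ?addr0 // => w /andP[_ /negPf ne]; rewrite factorization_count0 ne scale0r.
rewrite exprS IH mulr_suml.
under [RHS]eq_bigr => w Ww do rewrite factorization_countS natr_sum scaler_suml.
rewrite exchange_big; apply: eq_bigr => r Sr /=.
have Wr : r \in W by apply: (subsetP SW).
rewrite mulr_sumr [RHS](reindex_inj (mulgI r)) /=.
apply: eq_big => [w|w Ww]; first by rewrite groupMl.
by rewrite mulKg repr_mxM // -mulmxE -scalemxAr.
Qed.

(** [gset_mx] is the sum over S in the regular representation; [repr_sum_exp] expands both powers
    with the same coefficients. *)
Lemma cfRepr_gset_exp N (rG : mx_representation algC W N) l :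
  (cfRepr rG).[gset_mx algC W S ^+ l]%CF = \tr ((\sum_(r in S) rG r) ^+ l).
Proof.
rewrite [gset_mx _ _ _ ^+ l]repr_sum_exp repr_sum_exp !raddf_sum; apply: eq_bigr => w Ww /=.
by rewrite xcfunZr xcfunG // mxtraceZ cfunE Ww mulr1n.
Qed.

Lemma trace_regular (F : fieldType) x : x \in W ->
  \tr (regular_repr F W x) = (#|W| * (x == 1%g))%:R.
Proof.
move=> Wx; rewrite /mxtrace.
have e k : regular_repr F W x k k = (x == 1%g)%:R.
  have Wk := enum_valP k; rewrite !mxE eqxx /=.
  have [->|ne] := eqVneq x 1%g; first by rewrite mulg1 gring_valK eqxx.
  rewrite (_ : (k == _) = false) //; apply: contraNF ne => /eqP.
  move/(congr1 (enum_val (A := mem W))); rewrite gring_indexK ?groupM // => /eqP.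
  by rewrite -{1}[enum_val k]mulg1 (inj_eq (mulgI _)) eq_sym.
by rewrite (eq_bigr _ (fun k _ => e k)) sumr_const card_ord natrM mulr_natl.
Qed.

(** The regular trace detects the identity, so multiplying by c extracts the coefficient of its
    inverse. *)
Lemma trace_factorization (F : fieldType) c l : c \in W ->
  \tr (regular_repr F W c * gset_mx F W S ^+ l) =
  (#|W| * factorization_count S c^-1%g l)%:R.
Proof.
move=> Wc; rewrite [gset_mx _ _ _ ^+ l]repr_sum_exp mulr_sumr raddf_sum /=.
rewrite (bigD1 c^-1%g) ?groupV //= big1 => [|w /andP[Ww ne]].
  rewrite addr0 -mulmxE -scalemxAr mxtraceZ -repr_mxM ?groupV // mulgV.
  by rewrite trace_regular // eqxx muln1 -natrM mulnC.
rewrite -mulmxE -scalemxAr mxtraceZ -repr_mxM // trace_regular ?groupM //.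
by rewrite -eq_invg_mul eq_sym (negPf ne) muln0 mulr0.
Qed.

Lemma factorization_countJ c x l : {in S, forall r, (r ^ x)%g \in S} ->
  (factorization_count S c l <= factorization_count S (c ^ x)%g l)%N.
Proof.
move=> stab; pose f (t : l.-tuple gT) := [tuple of map (conjg^~ x) t].
have f_inj : injective f.
  move=> t t' /(congr1 val) /= e; apply: val_inj; apply: inj_map e; exact: conjg_inj.
rewrite /factorization_count -(card_imset _ f_inj); apply: subset_leq_card.
apply/subsetP => _ /imsetP[t + ->]; rewrite !inE => /andP[/allP St /eqP e]; apply/andP; split.
  by apply/allP => _ /mapP[r rt ->]; apply/stab/St.
rewrite big_map /= -e; apply/eqP.
elim: (val t) => [|r t' IH]; first by rewrite !big_nil conj1g.
by rewrite !big_cons conjMg IH.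
Qed.

End Counting.

Section Conclusion.

Variables (n : nat) (Phi : rootSystem n) (Delta : n.-tuple 'rV[rat]_n).
Variables (gT : finGroupType) (W : {group gT}) (rW : mx_representation rat W n).
Hypothesis simpleDelta : simple_system Phi Delta.
Hypothesis weylW : Weyl_group Phi rW.
Hypothesis irrPhi : irreducible_rootSystem Phi.

Local Notation al := (tnth Delta).
Local Notation s := (simple_elt Phi Delta rW).
Local Notation inner := (inner rW).
Local Notation descent := (right_descent Delta rW).
Local Notation len := (weyl_len Phi Delta rW).
Local Notation word_prod := (simple_prod Phi Delta rW).
Local Notation longest := (longest Delta rW).
Local Notation positive_roots := (positive_roots Phi Delta).
Local Notation root_elt := (root_elt Phi rW).
Local Notation ascending := (ascending Phi Delta rW).
Local Notation hecke_word := (hecke_word W s descent).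
Local Notation hecke_right := (hecke_right W s descent).
Local Notation hecke_tail := (hecke_tail W s descent).
Let s_in := simple_in simpleDelta weylW.
Let word_in := word_prod_in simpleDelta weylW.
Let Ral := simple_root simpleDelta.

Lemma reflections_sub : reflections rW \subset W.
Proof. by apply/subsetP => r; rewrite inE => /andP[]. Qed.

Lemma reflectionsJ x : x \in W -> {in reflections rW, forall r, (r ^ x)%g \in reflections rW}.
Proof.
move=> Wx r; rewrite !inE => /andP[Wr rk]; rewrite groupJ //=.
have xu : rW x \in unitmx by apply: repr_mx_unit.
have -> : rW (r ^ x)%g - 1%:M = rW x^-1%g *m (rW r - 1%:M) *m rW x.
  rewrite conjgE !repr_mxM ?groupM ?groupV // mulmxBr mulmxBl mulmx1 mulmxA.
  by rewrite -(repr_mxM rW (groupVr Wx) Wx) mulVg repr_mx1.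
rewrite mxrankMfree ?row_free_unit // -(mxrank_tr) trmx_mul mxrankMfree ?mxrank_tr //.
by rewrite row_free_unit unitmx_tr repr_mx_unit // groupV.
Qed.

Lemma factorization_count_conj c x l : x \in W ->
  factorization_count (reflections rW) (c ^ x)%g l = factorization_count (reflections rW) c l.
Proof.
move=> Wx; apply/eqP; rewrite eqn_leq andbC factorization_countJ; last exact: reflectionsJ.
rewrite -{2}(conjgK x c) factorization_countJ //.
by apply: reflectionsJ; rewrite groupV.
Qed.

Lemma len_word_prod_le w u : w \in W -> (len (w * word_prod u)%g <= len w + size u)%N.
Proof.
elim: u w => [|i u IH] w Ww; first by rewrite /simple_prod big_nil mulg1 addn0.
rewrite word_prod_cons mulgA (leq_trans (IH _ _)) ?groupM //.
rewrite (lenM_simple simpleDelta weylW) // addnS -addSn leq_add2r.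
by case: ifP => _ //; apply: leq_trans (leq_pred _) (leqnSn _).
Qed.

Lemma reduced_ascending w u : w \in W ->
  len (w * word_prod u)%g = (len w + size u)%N -> ascending w u.
Proof.
elim: u w => //= i u IH w Ww; rewrite word_prod_cons mulgA => e.
have Wsi : (w * s i)%g \in W by rewrite groupM.
have := len_word_prod_le u Wsi; rewrite e (lenM_simple simpleDelta weylW) //.
case: ifP => d.
  rewrite addnS -addSn leq_add2r => le.
  by have := leq_trans le (leq_pred _); rewrite ltnn.
by move=> _ /=; apply: IH => //; rewrite e (lenM_simple simpleDelta weylW) // d addnS.
Qed.

Let class_sum := \sum_(r in reflections rW) rW r.

Lemma class_sumE : \sum_(a <- positive_roots) coroot Phi a *m a =
  (size positive_roots)%:R%:M - class_sum.
Proof.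
rewrite /class_sum (reflections_sum simpleDelta weylW) -sum1_size natr_sum raddf_sum /= -sumrB.
apply: eq_big_seq => a /positive_rootsP[Ra _].
by rewrite (rW_root_elt weylW) // /root_reflection opprB addrC subrK.
Qed.

Lemma class_sum_comm x : x \in W -> rW x *m class_sum = class_sum *m rW x.
Proof.
move=> Wx; rewrite mulmx_sumr mulmx_suml.
rewrite [RHS](reindex_inj (conjg_inj x^-1%g)) /=.
apply: eq_big => [r|r].
  apply/idP/idP => h; first by apply: reflectionsJ => //; rewrite groupV.
  by rewrite -(conjgKV x r); apply: reflectionsJ.
move=> /(subsetP reflections_sub) Wr.
by rewrite -!repr_mxM ?groupJ ?groupV // conjgE invgK !mulgA mulgKV.
Qed.

Lemma class_sum_adjoint u v : inner (u *m class_sum) v = inner u (v *m class_sum).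
Proof.
rewrite mulmx_sumr inner_sum [RHS]innerC mulmx_sumr inner_sum !(reflections_sum simpleDelta weylW).
apply: eq_big_seq => a /positive_rootsP[Ra _]; have Wa := root_elt_in weylW Ra.
rewrite innerC -(inner_act _ _ _ Wa) -mulmxA -repr_mxM // (root_eltK weylW) //.
by rewrite repr_mx1 mulmx1.
Qed.

(** The sum commutes with the reflection in a, hence preserves its (-1)-eigenspace, the line of
    a. *)
Lemma class_sum_root a : a \in root_seq Phi -> exists k, a *m class_sum = k *: a.
Proof.
move=> Ra; have Wa := root_elt_in weylW Ra.
have e : a *m class_sum *m rW (root_elt a) = - (a *m class_sum).
  by rewrite -mulmxA -class_sum_comm // mulmxA (rW_root_elt weylW) // reflect_root // mulNmx.
exists (pairing (a *m class_sum) (coroot Phi a) / 2).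
move: e; rewrite (rW_root_elt weylW) // root_reflectionE; set k := pairing _ _ => e.
rewrite mulrC -scalerA -[k *: a](subKr (a *m class_sum)) e opprK.
by rewrite -mulr2n -scaler_nat scalerA mulVf ?scale1r // pnatr_eq0.
Qed.

(** Every root is an eigenvector and the sum is self-adjoint, so roots with different eigenvalues
    are orthogonal; irreducibility then leaves one eigenvalue, even when the reflections form
    several classes. *)
Lemma class_sum_scalar : exists k, class_sum = k%:M.
Proof.
have [i0] : exists i : 'I_n, true by exists (Ordinal (rank_gt0 irrPhi)).
have [k0 e0] := class_sum_root (Ral i0) => _; exists k0.
pose Q := [pred v : 'rV[rat]_n | v *m class_sum == k0 *: v].
case: irrPhi => _ /(_ Q)[a b Ra Rb Qa Qb|h|h]; last first.
- by have := h _ (Ral i0); rewrite inE e0 eqxx.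
- have all_simple i : al i *m class_sum = al i *m k0%:M.
    by have /eqP := h _ (Ral i); rewrite mul_mx_scalar.
  have e : simple_mx Delta *m class_sum = simple_mx Delta *m k0%:M.
    by apply/row_matrixP => i; rewrite !row_mul rowK all_simple.
  by rewrite -(mulKmx (simple_mx_unit simpleDelta) class_sum) e mulKmx ?(simple_mx_unit simpleDelta).
have [k1 e1] := class_sum_root Rb.
have ne : k0 != k1 by apply: contraNneq Qb => e; rewrite inE e1 e.
have orth : inner a b = 0.
  have := class_sum_adjoint a b; rewrite e1 (eqP (Qa : a *m class_sum == _)) innerZ innerC.
  rewrite [RHS]innerC innerZ => /eqP; rewrite -subr_eq0 -mulrBl mulf_eq0 subr_eq0 (negPf ne).
  by move/eqP; rewrite innerC.
by rewrite !(pairing_inner weylW) // orth innerC orth mulr0 !mul0r.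
Qed.

(** The sum is scalar by [class_sum_scalar]. Each term has trace 2, so the scalar times n is 2 N,
    that is m n. *)
Lemma coroot_sum (m : nat) : (m * n = 2 * size positive_roots)%N ->
  \sum_(a <- positive_roots) coroot Phi a *m a = m%:R%:M.
Proof.
move=> mn; have [k ek] := class_sum_scalar.
have [h eh] : exists h, \sum_(a <- positive_roots) coroot Phi a *m a = h%:M.
  by exists ((size positive_roots)%:R - k); rewrite class_sumE ek -raddfB.
have := congr1 (@mxtrace _ _) eh; rewrite raddf_sum mxtrace_scalar /=.
rewrite (eq_big_seq (fun=> 2%:R)) => [|a /positive_rootsP[Ra _]]; last first.
  by rewrite mxtrace_mulC trace_mx11 -(pairing_coroot Ra).
rewrite big_const_seq count_predT iter_addr_0 -mulrnA -mn mulrnA.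
rewrite -[LHS]mulr_natr -[RHS]mulr_natr => /mulIf e.
by rewrite eh e // pnatr_eq0 -lt0n (rank_gt0 irrPhi).
Qed.

Lemma exterior_character_formula (m i l : nat) : (m * n = 2 * size positive_roots)%N ->
  (cfRepr (extpow_repr i (ref_repr rW))).[gset_mx algC W (reflections rW) ^+ l]%CF =
  'C(n, i)%:R * ((size positive_roots)%:R - m%:R * i%:R) ^+ l.
Proof.
move=> mn; rewrite cfRepr_gset_exp ?reflections_sub //.
rewrite (reflections_sum simpleDelta weylW).
have -> : \sum_(a <- positive_roots) extpow_repr i (ref_repr rW) (root_elt a) =
    ((size positive_roots)%:R - m%:R * i%:R)%:M.
  rewrite -(@sum_extpow_rank_one _ i n _ positive_roots
    (fun a => map_mx (@ratr algC) (coroot Phi a)) (fun a => map_mx (@ratr algC) a)).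
    apply: eq_big_seq => a /positive_rootsP[Ra _] /=; rewrite -map_mxM.
    have -> : extpow_repr_mx i (ref_repr rW) (root_elt a) =
      extpow_mx i (map_mx (@ratr algC) (rW (root_elt a))) by [].
    by rewrite (rW_root_elt weylW) // /root_reflection map_mxB map_mx1.
  under eq_bigr => a _ do rewrite -map_mxM.
  by rewrite -map_mx_sum (coroot_sum mn) map_scalar_mx rmorph_nat.
by rewrite -rmorphXn /= mxtrace_scalar card_extIndex -[LHS]mulr_natl.
Qed.

Lemma hecke_word_prod (R : comNzRingType) (q : R) u :
  hecke_word q u = \prod_(X <- map (hecke_right q) u) X.
Proof. by elim: u => [|i u IH] /=; rewrite ?big_nil // big_cons -IH. Qed.

Lemma simple_orders_conj u v : perm_eq u (enum 'I_n) -> perm_eq v (enum 'I_n) ->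
  exists2 g, g \in W & word_prod u = (word_prod v ^ g)%g.
Proof.
move=> pu pv; have uu : uniq u by rewrite (perm_uniq pu) enum_uniq.
have puv : perm_eq u v by rewrite (seq.permPl pu) perm_sym.
have [g Gg e] := forest_conj (simple_forest simpleDelta weylW) (t := s)
  uu puv (fun i j _ _ => @simple_commute _ _ _ _ _ _ simpleDelta weylW i j).
by exists g => //; apply: (subsetP _ _ Gg); apply: generated_sub => k _.
Qed.

Lemma factorization_count_formula c : Coxeter_element Phi rW Delta c ->
  exists m : nat, (m * n = 2 * size positive_roots)%N /\
  forall l, (#|W| * factorization_count (reflections rW) c l)%:R =
   \sum_(i < n.+1) (-1) ^+ i * 'C(n, i)%:R *
     ((m * (n - i))%:R - (size positive_roots)%:R) ^+ l :> algC.
Proof.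
move=> [s' hs' [p [x [Wx ->]]]].
have [col colP] := forest_coloring (simple_adj_sym Delta rW) (simple_forest simpleDelta weylW).
have [u [k [v [pu [k0 kn] av lv tw]]]] := Coxeter_full_twist simpleDelta weylW irrPhi colP.
exists k; split=> // l.
have s'E i : s' i = s i.
  have [Wi e] := hs' i; apply: (rW_inj weylW) => //.
  by rewrite e (rW_simple simpleDelta weylW).
have -> : (\prod_(i < n) s' (p i))%g = word_prod [seq p i | i <- enum 'I_n].
  by rewrite /simple_prod big_map enumT [index_enum _]unlock; apply: eq_bigr => i _; rewrite s'E.
rewrite factorization_count_conj //.
have pp : perm_eq [seq p i | i <- enum 'I_n] (enum 'I_n).
  have p_inj : injective (fun i => p i) by apply: perm_inj.
  apply: uniq_perm; rewrite ?(map_inj_uniq p_inj) ?enum_uniq // => i.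
  rewrite mem_enum; apply/mapP; exists ((p^-1)%g i); rewrite ?mem_enum //.
  by rewrite permKV.
(* The trace counts factorizations of an inverse, so c is conjugated to the reversed word, whose
   inverse is the product of [u]. *)
have pru : perm_eq (rev u) (enum 'I_n) by rewrite perm_rev.
have [g Wg ->] := simple_orders_conj pp pru.
rewrite factorization_count_conj // (word_prod_rev simpleDelta weylW).
rewrite -(trace_factorization reflections_sub) ?word_in //.
pose As := map (hecke_right ('X : {poly algC})) u; pose B := hecke_tail ('X : {poly algC}) v.
have szv : size v = len (word_prod v).
  have := ascending_len simpleDelta weylW (group1 W) av.
  by rewrite mul1g (len1 Phi Delta rW).
have WV : (word_prod v)^-1%g \in W by rewrite groupV.
(* The palindrome formula concerns T_v T_{rev v}, while the full twist is T_v T_v; both agree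
   because [rev v] is also an ascending word of the longest element. *)
have lrv : longest (word_prod (rev v)).
  by rewrite (word_prod_rev simpleDelta weylW) (longestV simpleDelta weylW).
have arv : ascending 1 (rev v).
  apply: reduced_ascending; rewrite ?group1 // mul1g (len1 Phi Delta rW) size_rev szv.
  by rewrite (word_prod_rev simpleDelta weylW) lenV.
have TE : \prod_(X <- As) X = hecke_word ('X : {poly algC}) u by rewrite hecke_word_prod.
have sizeAs : size As = n by rewrite size_map (perm_size pu) size_enum_ord.
have main := @trace_at_one #|W| k As B (cardG_gt0 W) k0.
rewrite sizeAs TE tw in main.
have {}main := main _ _ (hecke_trace simpleDelta weylW _ pu).
have hev (u0 : seq 'I_n) : ev 1 (hecke_word ('X : {poly algC}) u0) = regular_repr algC W (word_prod u0).
  rewrite /ev map_hecke_word /= (_ : horner_eval 1 'X = 1); last by rewrite /horner_eval hornerX.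
  by rewrite hecke_word1.
(* Every positive root is an inversion of the longest element, so the tail at q = 1 is N plus the
   sum of reflections; hence the choice a = N below. *)
have BE : ev 1 B - (size positive_roots)%:R%:M = gset_mx algC W (reflections rW).
  rewrite /ev map_hecke_tail /= (_ : horner_eval 1 'X = 1); last by rewrite /horner_eval hornerX.
  rewrite (hecke_tail1 simpleDelta weylW) //.
  have -> : inversions Phi Delta rW (word_prod v) = positive_roots.
    apply/all_filterP; rewrite all_count -size_filter.
    by apply/eqP/(longestP simpleDelta weylW).
  rewrite big_split /= big_const_seq count_predT iter_addr_0 -scaler_nat scalemx1.
  apply/eqP; rewrite subr_eq [eqbRHS]addrC; apply/eqP; congr (_ + _).
  by rewrite /gset_mx (reflections_sum simpleDelta weylW).
rewrite -BE -hev main //.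
- move=> _ /mapP[i _ ->]; rewrite -mulmxE hecke_quadratic //.
  + exact: (simple_eltK simpleDelta weylW).
  + exact: (descent_simpleM simpleDelta weylW).
- move=> _ /mapP[i _ ->]; exact: (longest_word_central simpleDelta weylW).
rewrite -hecke_word_palindrome; first by congr (_ *m _); apply: (longest_word_eq simpleDelta weylW).
- exact: s_in.
- exact: (simple_eltK simpleDelta weylW).
exact: (descent_simpleM simpleDelta weylW).
Qed.

End Conclusion.

Theorem mainTheorem1
    (n : nat) (Phi : rootSystem n) (Delta : n.-tuple 'rV[rat]_n)
    (gT : finGroupType) (W : {group gT}) (rW : mx_representation rat W n)
    (c : gT)
    (irrPhi : irreducible_rootSystem Phi)
    (simpleDelta : simple_system Phi Delta)
    (weylW : Weyl_group Phi rW)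
    (coxc : Coxeter_element Phi rW Delta c)
    (l : nat) :
  (#|W| * factorization_count (reflections rW) c l)%:R =
  \sum_(i < n.+1)
    (-1) ^+ i *
    (cfRepr (extpow_repr i (ref_repr rW))).[gset_mx algC W (reflections rW) ^+ l]%CF.
Proof.
have [m [mn ->]] := factorization_count_formula simpleDelta weylW irrPhi coxc.
apply: eq_bigr => i _; rewrite (exterior_character_formula simpleDelta weylW irrPhi _ _ mn) mulrA.
congr (_ * _ ^+ l); have le_in : (i <= n)%N by rewrite -ltnS.
(* m (n - i) - N = N - m i because m n = 2 N. *)
rewrite mulnBr natrB ?leq_mul2l ?le_in ?orbT // mn !natrM.
by rewrite addrAC mulr_natl mulr2n addrK.
Qed.
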